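(* The equivalence group $G^\sim_1$ of the class of systems ${\rm DE}_1(\mathcal L)$ is isomorphic to the equivalence group $G^\sim$ of the class of equations $\mathcal L$: $u_t=Au_{xx}+Bu_x+Cu$. The canonical isomorphism sends the transformation from $G^\sim$ with $\tilde t=T(t)$, $\tilde x=X(t,x)$, $\tilde u=U^1(t,x)u$ to the transformation from $G^\sim_1$ in which $t$, $x$, $A$, $B$, $C$ are transformed in the same way and $$\tilde g^1=\frac{X_x}{T_t}g^1+\frac{X_t}{T_t},\qquad \tilde g^2=\frac1{T_t}g^2+\frac{U^1_x}{T_tU^1}g^1+\frac{U^1_t}{T_tU^1},\qquad \tilde g^3=\frac{U^1}{T_t}g^3.$$
   Context: All considerations are local. The class of equations considered consists of all $\mathcal L$: $u_t-A(t,x)u_{xx}-B(t,x)u_x-C(t,x)u=0$ with analytic arbitrary elements $A,B,C$, $A\ne0$. With each $\mathcal L$ one associates the system ${\rm DE}_1(\mathcal L)$ for $g^i=g^i(t,x)$, $i=1,2,3$ (the determining equations for reduction operators $\partial_t+g^1\partial_x+(g^2u+g^3)\partial_u$ of $\mathcal L$): $$g^1_t-Ag^1_{xx}-Bg^1_x+\Bigl(2g^1_x-\tfrac{A_x}{A}g^1-\tfrac{A_t}{A}\Bigr)(g^1+B)+B_xg^1+2Ag^2_x+B_t=0,$$ $$g^2_t-Ag^2_{xx}-Bg^2_x+\Bigl(2g^1_x-\tfrac{A_x}{A}g^1-\tfrac{A_t}{A}\Bigr)(g^2-C)-C_xg^1-C_t=0,$$ $$g^3_t-Ag^3_{xx}-Bg^3_x+\Bigl(2g^1_x-\tfrac{A_x}{A}g^1-\tfrac{A_t}{A}\Bigr)g^3-Cg^3=0.$$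 The equivalence group of a class of (systems of) differential equations is the group of point transformations of the independent and dependent variables (together with the induced action on the arbitrary elements $A,B,C$) that can be applied to every system of the class and map it to a system of the same class. The equivalence group $G^\sim$ of the class of equations $\mathcal L$ is known to consist of the transformations $\tilde t=T(t)$, $\tilde x=X(t,x)$, $\tilde u=U^1(t,x)u$ with $T_tX_xU^1\neq0$ and $$\tilde A=\frac{X_x^2}{T_t}A,\quad \tilde B=\frac{X_x}{T_t}\Bigl(B-2\frac{U^1_x}{U^1}A\Bigr)-\frac{X_t-AX_{xx}}{T_t},\quad \tilde C=-\frac{U^1}{T_t}L\frac1{U^1},\qquad L=\partial_t-A\partial_{xx}-B\partial_x-C.$$ *)

(* Defs.v *)
From HB Require Import structures.
From mathcomp Require Import all_boot all_order all_algebra.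
From mathcomp Require Import all_classical all_reals all_analysis.

Set Implicit Arguments.
Unset Strict Implicit.
Unset Printing Implicit Defensive.

Import Order.TTheory GRing.Theory Num.Theory.
Import numFieldNormedType.Exports.

Local Open Scope classical_set_scope.
Local Open Scope ring_scope.

(* Everything is local: objects are total functions of which only the germ at
   a given point matters.  A point of 'rV[R]_2 is (t, x), with t in column 0
   and x in column 1; a point of 'rV[R]_(2 + n) is (t, x, w), where w in
   'rV[R]_n are the n dependent variables. *)

Section Analytic.
Variable R : realType.

(* f is the sum, on the polydisc of radius r around a, of a power series with
   coefficients c_alpha = O(r^-|alpha|); the partial sums are taken over the
   boxes alpha_i < N. *)
Definition analytic_at n (f : 'rV[R]_n -> R) (a : 'rV[R]_n) : Prop :=
  exists (c : {ffun 'I_n -> nat} -> R) (r M : R),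
    [/\ 0 < r,
        forall alpha, `|c alpha| * r ^+ (\sum_i alpha i)%N <= M
      & forall h : 'rV[R]_n, (forall i, `|h 0 i| < r) ->
          (fun N : nat => \sum_(alpha : {ffun 'I_n -> 'I_N})
             c [ffun i => nat_of_ord (alpha i)] * \prod_i h 0 i ^+ alpha i)
            @ \oo --> f (a + h)].

Definition analytic_map_at m n (f : 'rV[R]_m -> 'rV[R]_n) (a : 'rV[R]_m) :=
  forall k, analytic_at (fun q => f q 0 k) a.

Definition germ_eq m n (a : 'rV[R]_m) (f g : 'rV[R]_m -> 'rV[R]_n) : Prop :=
  \forall y \near a, f y = g y.

Definition dt (f : 'rV[R]_2 -> R) (q : 'rV[R]_2) : R := 'D_('e_0) f q.
Definition dx (f : 'rV[R]_2 -> R) (q : 'rV[R]_2) : R := 'D_('e_1) f q.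

End Analytic.

Section Equations.
Variable R : realType.

Record coefs := Coefs {
  cA : 'rV[R]_2 -> R;
  cB : 'rV[R]_2 -> R;
  cC : 'rV[R]_2 -> R }.

Definition admissible (th : coefs) (p : 'rV[R]_2) : Prop :=
  [/\ analytic_at (cA th) p, analytic_at (cB th) p, analytic_at (cC th) p
    & cA th p != 0].

(* The derivatives of order at most 2 that enter the systems considered. *)
Record jet n := Jet {
  jw : 'rV[R]_n;
  jt : 'rV[R]_n;
  jx : 'rV[R]_n;
  jxx : 'rV[R]_n }.

(* A class of systems with arbitrary elements A, B, C; each system is the
   subset of the jet space that it defines. *)
Definition system_class n := coefs -> 'rV[R]_2 -> jet n -> Prop.

Definition parabolic : system_class 1 := fun th p j =>
  jt j 0 0 - cA th p * jxx j 0 0 - cB th p * jx j 0 0 - cC th p * jw j 0 0 = 0.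

Definition DE1 : system_class 3 := fun th p j =>
  let A := cA th p in let B := cB th p in let C := cC th p in
  let g1 := jw j 0 0 in let g2 := jw j 0 1 in let g3 := jw j 0 2 in
  let K := 2 * jx j 0 0 - dx (cA th) p / A * g1 - dt (cA th) p / A in
  [/\ jt j 0 0 - A * jxx j 0 0 - B * jx j 0 0 + K * (g1 + B)
        + dx (cB th) p * g1 + 2 * A * jx j 0 1 + dt (cB th) p = 0,
      jt j 0 1 - A * jxx j 0 1 - B * jx j 0 1 + K * (g2 - C)
        - dx (cC th) p * g1 - dt (cC th) p = 0
    & jt j 0 2 - A * jxx j 0 2 - B * jx j 0 2 + K * g3 - C * g3 = 0].

End Equations.

Section EquivalenceGroup.
Variable R : realType.

Definition point_transformation n
    (Phi : 'rV[R]_(2 + n) -> 'rV[R]_(2 + n)) (z : 'rV[R]_(2 + n)) : Prop :=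
  analytic_map_at Phi z /\
  exists2 Psi : 'rV[R]_(2 + n) -> 'rV[R]_(2 + n),
    analytic_map_at Psi (Phi z)
    & germ_eq z (Psi \o Phi) id /\ germ_eq (Phi z) (Phi \o Psi) id.

(* Gradient of eta in the coordinates beta instead of q: if eta = phi \o beta,
   the chain rule reads jacobian eta q = jacobian beta q *m jacobian phi (beta q),
   row i of a jacobian being the i-th partial derivative. *)
Definition grad_along n (beta : 'rV[R]_2 -> 'rV[R]_2)
    (eta : 'rV[R]_2 -> 'rV[R]_n) (q : 'rV[R]_2) : 'M[R]_(2, n) :=
  invmx (jacobian beta q) *m jacobian eta q.

(* Jet, at beta q, of the function phi whose graph is locally parametrized by
   q |-> (beta q, omega q), i.e. such that phi \o beta = omega near q. *)
Definition jet_along n (beta : 'rV[R]_2 -> 'rV[R]_2)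
    (omega : 'rV[R]_2 -> 'rV[R]_n) (q : 'rV[R]_2) : jet R n :=
  let phi_x q' := row 1 (grad_along beta omega q') in
  Jet (omega q) (row 0 (grad_along beta omega q)) (phi_x q)
      (row 1 (grad_along beta phi_x q)).

Definition jet_of n (f : 'rV[R]_2 -> 'rV[R]_n) (q : 'rV[R]_2) : jet R n :=
  jet_along id f q.

Definition on_graph n (Phi : 'rV[R]_(2 + n) -> 'rV[R]_(2 + n))
    (f : 'rV[R]_2 -> 'rV[R]_n) (q : 'rV[R]_2) : 'rV[R]_(2 + n) :=
  Phi (row_mx q (f q)).

(* Near z, the change of variables Phi turns the system E th into the system
   E th': the second prolongation of Phi, computed on the graphs of arbitrary
   functions f whose image under Phi is again a graph, identifies the two
   systems as subsets of the jet space. *)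
Definition maps_system n (E : system_class R n)
    (Phi : 'rV[R]_(2 + n) -> 'rV[R]_(2 + n)) (z : 'rV[R]_(2 + n))
    (th th' : coefs R) : Prop :=
  \forall y \near z, forall f : 'rV[R]_2 -> 'rV[R]_n,
    let q := lsubmx y in
    let beta q' := lsubmx (on_graph Phi f q') in
    let omega q' := rsubmx (on_graph Phi f q') in
    analytic_map_at f q -> f q = rsubmx y -> jacobian beta q \in unitmx ->
    (E th q (jet_of f q) <-> E th' (beta q) (jet_along beta omega q)).

(* The germ of Phi at z belongs to the equivalence (pseudo)group of E. *)
Definition equivalence n (E : system_class R n)
    (Phi : 'rV[R]_(2 + n) -> 'rV[R]_(2 + n)) (z : 'rV[R]_(2 + n)) : Prop :=
  \forall y \near z,
    point_transformation Phi y /\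
    forall th, admissible th (lsubmx y) ->
      exists2 th', admissible th' (lsubmx (Phi y)) & maps_system E Phi y th th'.

(* Isomorphism, over the space of (t, x), of two pseudogroups given by their
   germs.  kappa z sends germs at z to germs at every z1 with the same (t, x),
   i.e. it identifies the two groupoids of germs after both have been pulled
   back to the pairs (z, z1) over a common (t, x). *)
Definition same_base n m (z : 'rV[R]_(2 + n)) (z1 : 'rV[R]_(2 + m)) : Prop :=
  lsubmx z = lsubmx z1.

Record pseudogroup_iso n m
    (G : ('rV[R]_(2 + n) -> 'rV[R]_(2 + n)) -> 'rV[R]_(2 + n) -> Prop)
    (H : ('rV[R]_(2 + m) -> 'rV[R]_(2 + m)) -> 'rV[R]_(2 + m) -> Prop)
    (kappa : 'rV[R]_(2 + n) -> ('rV[R]_(2 + n) -> 'rV[R]_(2 + n)) ->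
             ('rV[R]_(2 + m) -> 'rV[R]_(2 + m))) : Prop := PseudogroupIso {
  iso_mem : forall z z1 Phi, same_base z z1 -> G Phi z -> H (kappa z Phi) z1;
  iso_base : forall z z1 Phi, same_base z z1 -> G Phi z ->
    \forall y \near z & y1 \near z1,
      same_base y y1 -> same_base (Phi y) (kappa z Phi y1);
  iso_inj : forall z z1 Phi Psi, same_base z z1 -> G Phi z -> G Psi z ->
    germ_eq z Phi Psi <-> germ_eq z1 (kappa z Phi) (kappa z Psi);
  iso_surj : forall z z1 Phi1, same_base z z1 -> H Phi1 z1 ->
    exists2 Phi, G Phi z & germ_eq z1 (kappa z Phi) Phi1;
  iso_comp : forall z z1 Phi Psi, same_base z z1 -> G Phi z -> G Psi (Phi z) ->
    G (Psi \o Phi) z /\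
    germ_eq z1 (kappa z (Psi \o Phi)) (kappa (Phi z) Psi \o kappa z Phi) }.

End EquivalenceGroup.

Section Canonical.
Variable R : realType.
Variables (T : R -> R) (X U : 'rV[R]_2 -> R).

Definition Tt (q : 'rV[R]_2) : R := derive1 T (q 0 0).

Definition base (q : 'rV[R]_2) : 'rV[R]_2 := \row_(i < 2) [:: T (q 0 0); X q]`_i.

Definition nondegenerate_at (p : 'rV[R]_2) : Prop :=
  [/\ analytic_at (fun q : 'rV[R]_2 => T (q 0 0)) p, analytic_at X p,
      analytic_at U p & Tt p * dx X p * U p != 0].

Definition lift_u (y : 'rV[R]_(2 + 1)) : 'rV[R]_(2 + 1) :=
  let q := lsubmx y in row_mx (base q) (U q *: rsubmx y).

Definition lift_g (y : 'rV[R]_(2 + 3)) : 'rV[R]_(2 + 3) :=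
  let q := lsubmx y in
  let g1 := rsubmx y 0 0 in let g2 := rsubmx y 0 1 in let g3 := rsubmx y 0 2 in
  row_mx (base q)
    (\row_(i < 3)
       [:: dx X q / Tt q * g1 + dt X q / Tt q;
           1 / Tt q * g2 + dx U q / (Tt q * U q) * g1 + dt U q / (Tt q * U q);
           U q / Tt q * g3]`_i).

Definition Lop (th : coefs R) (v : 'rV[R]_2 -> R) (q : 'rV[R]_2) : R :=
  dt v q - cA th q * dx (dx v) q - cB th q * dx v q - cC th q * v q.

Definition coefs_transformed (p : 'rV[R]_2) (th th' : coefs R) : Prop :=
  \forall q \near p,
    [/\ cA th' (base q) = dx X q ^+ 2 / Tt q * cA th q,
        cB th' (base q) = dx X q / Tt q * (cB th q - 2 * (dx U q / U q) * cA th q)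
                          - (dt X q - cA th q * dx (dx X) q) / Tt q
      & cC th' (base q) = - (U q / Tt q) * Lop th (fun q' => 1 / U q') q].

End Canonical.

(* Main.v *)
(* For both classes a system has the form w_t = A w_xx + H(w, w_x), with H affine
   in w_x.  Let Phi be an equivalence transformation.  Since a system constrains
   f_t but not f_tt, varying f_tt and f_xx along the graphs of solutions forces
   Phi to have the form (T(t), X(t, x), W(t, x, w)) with A' T_t = A X_x^2, and
   what remains of "Phi maps th to th'" is one identity, the master identity, in
   the free variables t, x, w and s = w_x.  Its second difference in s makes W
   affine in w: W = w0 + w M with w0, M functions of (t, x).  The master identities
   at the two sources A = 1, B = 0, C = 0 and A = 1, B = 0, C = 1 alone determine
   w0 and M in terms of T, X and one function U, which gives the forms lift_u and
   lift_g.  Conversely, for these forms the master identity at arbitrary (A, B, C)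
   is equivalent to the transformation law of A, B, C.  Hence both pseudogroups
   are parametrized by the same germs (T, X, U), and the chain rule shows that
   both parametrizations turn composition into the same operation on (T, X, U).

   An analytic inverse of (t, x) |-> (T, X) is read off the inverse of Phi, so no
   inverse function theorem is used. *)
Require Import Defs.
From HB Require Import structures.
From mathcomp Require Import all_boot all_order all_algebra.
From mathcomp Require Import all_classical all_reals all_analysis.
From mathcomp Require Import finmap ring lra.
Import Order.TTheory GRing.Theory Num.Theory.
Import numFieldNormedType.Exports.
Set Implicit Arguments.
Unset Strict Implicit.
Unset Printing Implicit Defensive.
Local Open Scope classical_set_scope.
Local Open Scope ring_scope.

(** * Unconditional sums *)

Section Hasum.
Variable R : realType.

(** [analytic_at] offers only a convergent series, while the argument composes, restricts,
    differentiates and inverts analytic maps; hence a theory of power series comes before any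
    symmetry. Series with finite weighted absolute sum on a polydisc form a Banach algebra, and
    dividing such a series by a coordinate gives Hadamard's lemma, from which differentiability,
    analyticity of derivatives and symmetry of second derivatives follow.

    On the side of the determining equations the obstacle is that A, B, C enter with their first
    derivatives. Relations between values at one point do not suffice, so each relation is proved on
    a neighbourhood and differentiated there before the next unknown is eliminated.

    The source C = 1 has one task in each class: for the parabolic equations it excludes the shift
    w0, for the determining equations it excludes a contribution of g^2 to the new g^3. In the
    latter class U arises as T_t times the coefficient of g^3 in the new g^3.

    The isomorphism picks a triple (T, X, U) for each germ; it is well defined because a lift of
    either kind determines the germ of its triple, and conversely. *)

Definition totally (I : choiceType) : set_system {fset I} :=
  filter_from setT (fun A => [set B | (A `<=` B)%fset]).

#[global] Instance totally_filter (I : choiceType) : ProperFilter (@totally I).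
Proof.
apply: filter_from_proper; last by move=> A _; exists A; rewrite /= fsubset_refl.
apply: filter_fromT_filter; first by exists fset0.
by move=> A B /=; exists (A `|` B)%fset => P /=; rewrite fsubUset => /andP[].
Qed.

(** Summation along finite subsets ordered by inclusion: multi-indices need no enumeration, and
    regrouping a sum is a statement about finite sets only. *)
Definition hasum (I : choiceType) (f : I -> R) (s : R) :=
  (fun A : {fset I} => \sum_(i <- A) f i) @ @totally I --> s.

(** The norm bound of the theory. Bounding all finite partial sums avoids naming the sum of the
    absolute values. *)
Definition absum_le (I : choiceType) (f : I -> R) (N : R) :=
  forall A : {fset I}, \sum_(i <- A) `|f i| <= N.

Implicit Types I J : choiceType.

Lemma hasum_uniq I (f : I -> R) s t : hasum f s -> hasum f t -> s = t.
Proof. by move=> /cvg_lim <- // /cvg_lim <-. Qed.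

Lemma hasumP I (f : I -> R) s :
  hasum f s <-> forall e, 0 < e -> exists A : {fset I},
    forall B : {fset I}, (A `<=` B)%fset -> `|s - \sum_(i <- B) f i| <= e.
Proof.
split=> [/cvgrPdist_le fs e e0|H].
  by have [A _ AP] := fs _ e0; exists A => B /AP.
by apply/cvgrPdist_le => e /H[A AP]; exists A.
Qed.

Lemma hasumD I (f g : I -> R) s t :
  hasum f s -> hasum g t -> hasum (fun i => f i + g i) (s + t).
Proof.
move=> fs gt; rewrite /hasum.
under eq_fun do rewrite big_split.
exact: cvgD.
Qed.

Lemma hasumZ I (f : I -> R) k s : hasum f s -> hasum (fun i => k * f i) (k * s).
Proof.
move=> fs; rewrite /hasum.
under eq_fun do rewrite -mulr_sumr.
exact: cvgMr.
Qed.

Lemma hasum_finite I (f : I -> R) (A : {fset I}) :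
  (forall i, i \notin A -> f i = 0) -> hasum f (\sum_(i <- A) f i).
Proof.
move=> fA; apply/hasumP => e e0; exists A => B AB.
rewrite -(big_fset_incl _ AB) ?subrr ?normr0 ?ltW// => i _; exact: fA.
Qed.

(** Any sequence of finite sets that eventually swallows each finite set computes the sum. This
    links unconditional sums with the partial sums over boxes in [analytic_at]. *)
Lemma hasum_exhaust I (f : I -> R) s (A : nat -> {fset I}) :
  (forall B : {fset I}, \forall k \near \oo, (B `<=` A k)%fset) ->
  hasum f s -> (fun k => \sum_(i <- A k) f i) @ \oo --> s.
Proof.
move=> AE fs; apply: (@cvg_comp _ _ _ A _ \oo (@totally I) _ _ fs).
by move=> P [B _ BP]; have := AE B; apply: filterS => k /BP.
Qed.

(** For nonnegative terms the supremum of the finite partial sums is the sum. In general f is the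
    difference of the nonnegative families f + |f| and |f|. *)
Lemma absum_le_hasum I (f : I -> R) N : absum_le f N -> exists s, hasum f s.
Proof.
move=> fN.
have pos (g : I -> R) M : (forall i, 0 <= g i) -> absum_le g M ->
    exists s, hasum g s.
  move=> g0 gM; pose S := [set \sum_(i <- A) g i | A in [set: {fset I}]].
  have hS : has_sup S.
    split; first by exists (\sum_(i <- fset0) g i); exists fset0.
    exists M => _ [A _ <-]; apply: le_trans (gM A).
    by apply: ler_sum => i _; apply: ler_norm.
  exists (sup S); apply/hasumP => e e0.
  have [_ [A _ <-] Ae] := sup_adherent e0 hS; exists A => B AB.
  have AlB : \sum_(i <- A) g i <= \sum_(i <- B) g i.
    rewrite [leRHS](big_fsetID _ (mem A)) /=.
    rewrite [X in _ <= X + _](_ : _ = \sum_(i <- A) g i) ?lerDl ?sumr_ge0//.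
    by apply: eq_fbigl => i; rewrite !inE -in_fsetI (fsetIidPr AB).
  have BS : \sum_(i <- B) g i <= sup S.
    by apply: ub_le_sup; [case: hS | exists B].
  rewrite ger0_norm ?subr_ge0// lerBlDr -lerBlDl.
  exact: le_trans (ltW Ae) AlB.
have [||s1 h1] := pos (fun i => `|f i|) N.
- by move=> i.
- by move=> A; under eq_bigr do rewrite normr_id; apply: fN.
have [||s2 h2] := pos (fun i => f i + `|f i|) (N + N).
- by move=> i; rewrite -lerBlDl sub0r lerNl; have := ler_norm (- f i); rewrite normrN; lra.
- move=> A; apply: (@le_trans _ _ (\sum_(i <- A) (`|f i| + `|f i|))).
    apply: ler_sum => i _; apply: le_trans (ler_normD _ _) _.
    by rewrite normr_id.
  by rewrite big_split /= lerD// ?fN.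
exists (s2 + (-1) * s1).
have := hasumD h2 (@hasumZ _ _ (-1) _ h1).
by under eq_fun do rewrite mulN1r addrK.
Qed.

Lemma cvg_fsum T (F : set_system T) (FF : Filter F) (K : Type) (r : seq K)
    (f : K -> T -> R) (l : K -> R) :
  (forall i, f i @ F --> l i) ->
  (fun x => \sum_(i <- r) f i x) @ F --> \sum_(i <- r) l i.
Proof.
move=> fl; elim: r => [|i r IH].
  by under eq_fun do rewrite big_nil; rewrite big_nil; apply: cvg_cst.
under eq_fun do rewrite big_cons; rewrite big_cons.
by apply: cvgD; [exact: fl | exact: IH].
Qed.

Lemma hasum_norm_le I (f : I -> R) N s : absum_le f N -> hasum f s -> `|s| <= N.
Proof.
move=> fN fs; apply/ler_addgt0Pr => e e0.
have [A /(_ A (fsubset_refl _)) Ae] := (hasumP _ _).1 fs _ e0.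
have -> : s = (s - \sum_(i <- A) f i) + \sum_(i <- A) f i by rewrite subrK.
apply: le_trans (ler_normD _ _) _; rewrite addrC lerD//.
by apply: le_trans (fN A); apply: ler_norm_sum.
Qed.

(** The bound on finite rectangles survives the limit in A, taken for each of the finitely many j in
    B at once. *)
Lemma absum_le_sum I J (F : I -> J -> R) (t : J -> R) N :
  (forall (A : {fset I}) (B : {fset J}),
     \sum_(i <- A) \sum_(j <- B) `|F i j| <= N) ->
  (forall j, hasum (F ^~ j) (t j)) -> absum_le t N.
Proof.
move=> FN Ft B.
have : (fun A : {fset I} => \sum_(j <- B) `|\sum_(i <- A) F i j|) @ @totally I
    --> \sum_(j <- B) `|t j|.
  apply: cvg_fsum => j; apply: cvg_norm; exact: Ft.
move=> /cvgr_to_le; apply; apply: nearW => A; apply: le_trans (FN A B).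
rewrite exchange_big /=; apply: ler_sum => j _; exact: ler_norm_sum.
Qed.

Lemma sum_fsetM I J (F : I -> J -> R) (A : {fset I}) (B : {fset J}) :
  \sum_(p <- (A `*` B)%fset) F p.1 p.2 = \sum_(i <- A) \sum_(j <- B) F i j.
Proof. by rewrite big_imfset2 //= => -[? ?] [? ?] _ _ /= [-> ->]. Qed.

Lemma fset_sub_prod I J (C : {fset I * J}) :
  (C `<=` (fst @` C) `*` (snd @` C))%fset.
Proof.
by apply/fsubsetP => p pC; rewrite in_fsetM !in_imfset.
Qed.

(** If A contains the first projection of C, then A x B contains C for all large B; fixing A and
    letting B grow turns closeness of rectangle sums to P into closeness of the sums of row
    totals. *)
Lemma hasum_rows I J (F : I -> J -> R) (s : I -> R) P :
  hasum (fun p => F p.1 p.2) P -> (forall i, hasum (F i) (s i)) -> hasum s P.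
Proof.
move=> FP Fs; apply/hasumP => e e0.
have [C CP] := (hasumP _ _).1 FP _ e0.
exists (fst @` C)%fset => A CA.
have h : (fun B : {fset J} => `|P - \sum_(i <- A) \sum_(j <- B) F i j|)
    @ @totally J --> `|P - \sum_(i <- A) s i|.
  apply: cvg_norm; apply: cvgB; first exact: cvg_cst.
  apply: cvg_fsum => i; exact: Fs.
apply: (cvgr_to_le h).
exists (snd @` C)%fset => // B CB /=; rewrite -sum_fsetM; apply: CP.
apply: fsubset_trans (fset_sub_prod C) _.
apply/fsubsetP => p; rewrite !in_fsetM => /andP[/(fsubsetP CA)-> /(fsubsetP CB)->].
by [].
Qed.

Lemma hasum_cols I J (F : I -> J -> R) (t : J -> R) P :
  hasum (fun p => F p.1 p.2) P -> (forall j, hasum (F ^~ j) (t j)) -> hasum t P.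
Proof.
move=> FP; apply: hasum_rows; apply/hasumP => e e0.
have [C CP] := (hasumP _ _).1 FP _ e0.
exists ((fun p => (p.2, p.1)) @` C)%fset => D CD.
have -> : \sum_(i <- D) F i.2 i.1 =
    \sum_(i <- ((fun p => (p.2, p.1)) @` D)%fset) F i.1 i.2.
  by rewrite big_imfset //= => -[a b] [c d] _ _ [-> ->].
apply: CP; apply/fsubsetP => -[i j] ijC; apply/imfsetP; exists (j, i) => //=.
apply: (fsubsetP CD); apply/imfsetP; exists (i, j) => //.
Qed.

Lemma absum_le_pair I J (F : I -> J -> R) N :
  (forall (A : {fset I}) (B : {fset J}),
     \sum_(i <- A) \sum_(j <- B) `|F i j| <= N) ->
  absum_le (fun p : I * J => F p.1 p.2) N.
Proof.
move=> FN C; apply: le_trans (FN (fst @` C)%fset (snd @` C)%fset).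
rewrite -(sum_fsetM (fun i j => `|F i j|)).
rewrite [leRHS](big_fsetID _ (mem C)) /=.
rewrite [X in _ <= X + _](_ : _ = \sum_(i <- C) `|F i.1 i.2|) ?lerDl ?sumr_ge0//.
apply: eq_fbigl => p; rewrite !inE /=; apply/andP/idP => [[]//|pC].
by split=> //; have := fsubsetP (fset_sub_prod C) p pC; rewrite in_fsetM.
Qed.

(** Fubini: the bound on rectangles makes the double sum exist, and summing it by rows identifies
    its value. *)
Lemma hasum_pair I J (F : I -> J -> R) (s : I -> R) S N :
  (forall (A : {fset I}) (B : {fset J}),
     \sum_(i <- A) \sum_(j <- B) `|F i j| <= N) ->
  (forall i, hasum (F i) (s i)) -> hasum s S -> hasum (fun p => F p.1 p.2) S.
Proof.
move=> FN Fs sS; have [P FP] := absum_le_hasum (absum_le_pair FN).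
by have -> : S = P by apply: hasum_uniq sS (hasum_rows FP Fs).
Qed.

End Hasum.

(** * Power series on polydiscs *)

Section PowerSeries.
Variable R : realType.

Local Notation mi n := {ffun 'I_n -> nat}.
Local Notation deg al := (\sum_i al i)%N.
Local Notation mono h al := (\prod_i h 0 i ^+ al i).

Definition in_box n (r : R) (h : 'rV[R]_n) := forall i, `|h 0 i| <= r.

(* The Banach algebra of functions given on the polydisc of radius r around a
   by a power series with sum of |c_alpha| r^|alpha| at most N. *)
Definition ell1 n (a : 'rV[R]_n) (r N : R) (f : 'rV[R]_n -> R) :=
  exists c : mi n -> R,
    absum_le (fun al => c al * r ^+ deg al) N /\
    forall h, in_box r h -> hasum (fun al => c al * mono h al) (f (a + h)).

Lemma mono_le n (h : 'rV[R]_n) r (al : mi n) :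
  in_box r h -> `|mono h al| <= r ^+ deg al.
Proof.
move=> hr; rewrite normr_prod -prodrXr; apply: ler_prod => i _.
by rewrite normr_ge0 normrX lerXn2r ?nnegrE ?hr// (le_trans _ (hr i)).
Qed.

Lemma sum_delta_le (I : choiceType) (B : {fset I}) (a : I) (x : R) : 0 <= x ->
  \sum_(i <- B) (if a == i then x else 0) <= x.
Proof.
move=> x0; have [aB|aB] := boolP (a \in B).
  rewrite (big_fsetD1 a)//= eqxx big1_fset ?addr0// => i.
  by rewrite !inE eq_sym => /andP[/negPf->].
rewrite big1_fset// => i iB _; case: eqP => // ai; by rewrite ai iB in aB.
Qed.

Lemma ell1_ge0 n (a : 'rV[R]_n) r N f : ell1 a r N f -> 0 <= N.
Proof. by case=> c [/(_ fset0) + _]; rewrite big_seq_fset0. Qed.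

Lemma ell1_terms n (c : mi n -> R) r N h : 0 < r ->
  absum_le (fun al => c al * r ^+ deg al) N -> in_box r h ->
  absum_le (fun al => c al * mono h al) N.
Proof.
move=> r0 cN hr A; apply: le_trans (cN A); apply: ler_sum => al _.
by rewrite !normrM ler_wpM2l// (le_trans (mono_le al hr))// ler_norm.
Qed.

(** Products, families of series and quotients by a coordinate produce monomials indexed by other
    sets than the multi-indices, with repeated exponents. Fubini for the array [D], supported where
    [m j == al], gathers them into one power series without increasing the bound. *)
Lemma ell1_collect n (J : choiceType) (d : J -> R) (m : J -> mi n) a r N f :
  0 < r -> absum_le (fun j => d j * r ^+ deg (m j)) N ->
  (forall h, in_box r h -> hasum (fun j => d j * mono h (m j)) (f (a + h))) ->
  ell1 a r N f.
Proof.
move=> r0 dN df.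
pose D j al := if m j == al then d j else 0.
have rect (q : mi n -> R) : (forall al, `|q al| <= r ^+ deg al) ->
    forall (A : {fset J}) (B : {fset mi n}),
    \sum_(j <- A) \sum_(al <- B) `|D j al * q al| <= N.
  move=> qr A B; apply: le_trans (dN A); apply: ler_sum => j _.
  apply: le_trans (sum_delta_le B (m j) (normr_ge0 (d j * r ^+ deg (m j)))).
  apply: ler_sum => al _; rewrite /D; case: eqP => [->|_]; last first.
    by rewrite mul0r normr0.
  by rewrite !normrM ler_wpM2l// (le_trans (qr al))// ler_norm.
have rr (al : mi n) : `|r ^+ deg al| <= r ^+ deg al.
  by rewrite ger0_norm// exprn_ge0// ltW.
have [c cP] : {c : mi n -> R & forall al, hasum (D ^~ al) (c al)}.
  apply: (@choice _ _ (fun al s => hasum (D ^~ al) s)) => al.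
  apply: (@absum_le_hasum _ _ _ (N / r ^+ deg al)) => A.
  rewrite ler_pdivlMr ?exprn_gt0// mulr_suml.
  have := rect _ rr A [fset al]%fset; apply: le_trans; apply: ler_sum => j _.
  by rewrite big_seq_fset1 normrM ler_wpM2l// ler_norm.
exists c; split.
  apply: (@absum_le_sum _ _ _ (fun j al => D j al * r ^+ deg al)).
    exact: rect.
  move=> al; under eq_fun do rewrite mulrC; rewrite mulrC; exact: hasumZ.
move=> h hr.
apply: (@hasum_cols _ _ _ (fun j al => D j al * mono h al)); last first.
  move=> al; under eq_fun do rewrite mulrC; rewrite mulrC; exact: hasumZ.
apply: (@hasum_pair _ _ _ (fun j al => D j al * mono h al)) (df h hr); first by apply: rect => al; apply: mono_le.
move=> j; have -> : d j * mono h (m j) =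
    \sum_(al <- [fset m j]%fset) D j al * mono h al.
  by rewrite big_seq_fset1 /D eqxx.
apply: hasum_finite => al; rewrite inE /D eq_sym => /negPf ->.
by rewrite mul0r.
Qed.

Lemma ell1_bound n (a : 'rV[R]_n) r N f h : 0 < r -> ell1 a r N f ->
  in_box r h -> `|f (a + h)| <= N.
Proof.
move=> r0 [c [cN cf]] hr.
exact: hasum_norm_le (ell1_terms r0 cN hr) (cf h hr).
Qed.

Lemma ell1_le n (a : 'rV[R]_n) r N N' f : N <= N' -> ell1 a r N f -> ell1 a r N' f.
Proof.
by move=> NN [c [cN cf]]; exists c; split=> // A; apply: le_trans (cN A) NN.
Qed.

Lemma ell1_eq n (a : 'rV[R]_n) r N f g :
  (forall h, in_box r h -> f (a + h) = g (a + h)) -> ell1 a r N f -> ell1 a r N g.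
Proof.
by move=> fg [c [cN cf]]; exists c; split=> // h hr; rewrite -fg//; exact: cf.
Qed.

Lemma ell1_cst n (a : 'rV[R]_n) r k : 0 < r -> ell1 a r `|k| (cst k).
Proof.
move=> r0.
apply: (@ell1_collect _ unit (fun=> k) (fun=> [ffun=> 0%N] : mi n)) => //.
  move=> A; rewrite (eq_bigr (fun j => if tt == j then `|k| else 0)).
    exact: sum_delta_le.
  by move=> [] _; rewrite eqxx big1 ?expr0 ?mulr1// => i _; rewrite ffunE.
move=> h hr; have -> : cst k (a + h) = \sum_(i <- [fset tt]%fset) k.
  by rewrite big_seq_fset1.
rewrite (_ : (fun=> _) = fun=> k).
  by apply: hasum_finite => -[]; rewrite inE.
by apply/funext => _; rewrite big1 ?mulr1// => i _; rewrite ffunE expr0.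
Qed.

Lemma ell1_coord n (a : 'rV[R]_n) r i : 0 < r ->
  ell1 a r r (fun q => q 0 i - a 0 i).
Proof.
move=> r0; have r0' := ltW r0.
apply: (@ell1_collect _ unit (fun=> 1) (fun=> [ffun j => (j == i) : nat] : mi n)) => //.
  move=> A; rewrite (eq_bigr (fun j => if tt == j then r else 0)).
    exact: sum_delta_le.
  move=> [] _; rewrite eqxx (bigD1 i)//= ffunE eqxx big1 ?mul1r ?ger0_norm//.
  by move=> j /negPf ji; rewrite ffunE ji.
move=> h hr; rewrite mxE addrAC subrr add0r.
have -> : h 0 i = \sum_(i0 <- [fset tt]%fset) h 0 i by rewrite big_seq_fset1.
rewrite (_ : (fun=> _) = fun=> h 0 i).
  by apply: hasum_finite => -[]; rewrite inE.
apply/funext => _; rewrite mul1r (bigD1 i)//= ffunE eqxx big1 ?mulr1//.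
by move=> j /negPf ji; rewrite ffunE ji.
Qed.

Lemma ell1_add n (a : 'rV[R]_n) r N M f g :
  ell1 a r N f -> ell1 a r M g -> ell1 a r (N + M) (fun q => f q + g q).
Proof.
move=> [c [cN cf]] [d [dM dg]]; exists (fun al => c al + d al); split.
  move=> A; apply: le_trans (lerD (cN A) (dM A)); rewrite -big_split /=.
  by apply: ler_sum => al _; rewrite mulrDl ler_normD.
move=> h hr; have := hasumD (cf h hr) (dg h hr).
by under eq_fun do rewrite -mulrDl.
Qed.

Lemma ell1_scale n (a : 'rV[R]_n) r N k f :
  ell1 a r N f -> ell1 a r (`|k| * N) (fun q => k * f q).
Proof.
move=> [c [cN cf]]; exists (fun al => k * c al); split.
  move=> A; rewrite (eq_bigr (fun al => `|k| * `|c al * r ^+ deg al|)); last first.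
    by move=> al _; rewrite -mulrA normrM.
  by rewrite -mulr_sumr ler_wpM2l.
move=> h hr; have := hasumZ (k := k) (cf h hr).
by under eq_fun do rewrite mulrA.
Qed.

(** Completeness of the algebra, in the form used for substitution and for the geometric series: a
    family whose norms are summable sums to a member of the algebra. *)
Lemma ell1_family n (K : choiceType) (f_ : K -> 'rV[R]_n -> R) (N_ : K -> R)
    (a : 'rV[R]_n) r N f : 0 < r ->
  (forall k, ell1 a r (N_ k) (f_ k)) -> absum_le N_ N ->
  (forall h, in_box r h -> hasum (fun k => f_ k (a + h)) (f (a + h))) ->
  ell1 a r N f.
Proof.
move=> r0 fN NN hf.
have [c cP] := choice fN.
have rect (q : mi n -> R) : (forall al, `|q al| <= r ^+ deg al) ->
    forall (A : {fset K}) (B : {fset mi n}),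
    \sum_(k <- A) \sum_(al <- B) `|c k al * q al| <= N.
  move=> qr A B; apply: le_trans (NN A); apply: ler_sum => k _.
  apply: le_trans (le_trans _ ((cP k).1 B)) (ler_norm _).
  apply: ler_sum => al _.
  by rewrite !normrM ler_wpM2l// (le_trans (qr al))// ler_norm.
apply: (@ell1_collect _ (K * mi n)%type (fun p => c p.1 p.2) (fun p => p.2)) => //.
  apply: (@absum_le_pair _ _ _ (fun k al => c k al * r ^+ deg al)).
  apply: rect => al; by rewrite ger0_norm// exprn_ge0// ltW.
move=> h hr.
apply: (@hasum_pair _ _ _ (fun k al => c k al * mono h al)) (hf h hr).
  by apply: rect => al; apply: mono_le.
by move=> k; apply: (cP k).2.
Qed.

Lemma prodDn n (h : 'rV[R]_n) (al be : mi n) :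
  mono h [ffun i => (al i + be i)%N] = mono h al * mono h be.
Proof. by rewrite -big_split /=; apply: eq_bigr => i _; rewrite ffunE exprD. Qed.

Lemma degD n (al be : mi n) : deg [ffun i => (al i + be i)%N] = (deg al + deg be)%N.
Proof. by rewrite -big_split /=; apply: eq_bigr => i _; rewrite ffunE. Qed.

Lemma ell1_mul n (a : 'rV[R]_n) r N M f g : 0 < r ->
  ell1 a r N f -> ell1 a r M g -> ell1 a r (N * M) (fun q => f q * g q).
Proof.
move=> r0 fN gM; have M0 := ell1_ge0 gM.
have N0 := ell1_ge0 fN.
case: fN gM => [c [cN cf]] [d [dM dg]].
have rect (u v : mi n -> R) : (forall al, `|u al| <= r ^+ deg al) ->
    (forall al, `|v al| <= r ^+ deg al) ->
    forall (A B : {fset mi n}),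
    \sum_(al <- A) \sum_(be <- B) `|(c al * u al) * (d be * v be)| <= N * M.
  move=> ur vr A B.
  rewrite (eq_bigr (fun al => `|c al * u al| * \sum_(be <- B) `|d be * v be|)); last first.
    by move=> al _; rewrite mulr_sumr; apply: eq_bigr => be _; rewrite normrM.
  rewrite -mulr_suml ler_pM ?sumr_ge0//.
    apply: le_trans (cN A); apply: ler_sum => al _.
    by rewrite !normrM ler_wpM2l// (le_trans (ur al))// ler_norm.
  apply: le_trans (dM B); apply: ler_sum => al _.
  by rewrite !normrM ler_wpM2l// (le_trans (vr al))// ler_norm.
have rr (al : mi n) : `|r ^+ deg al| <= r ^+ deg al.
  by rewrite ger0_norm// exprn_ge0// ltW.
apply: (@ell1_collect _ (mi n * mi n)%type (fun p => c p.1 * d p.2)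
   (fun p => [ffun i => (p.1 i + p.2 i)%N])) => //.
  rewrite (_ : (fun _ => _) = (fun p : mi n * mi n =>
      (c p.1 * r ^+ deg p.1) * (d p.2 * r ^+ deg p.2))).
    by apply: (@absum_le_pair _ _ _ (fun al be =>
      (c al * r ^+ deg al) * (d be * r ^+ deg be))); apply: rect.
  by apply/funext => p; rewrite degD exprD; ring.
move=> h hr.
rewrite (_ : (fun _ => _) = (fun p : mi n * mi n =>
      (c p.1 * mono h p.1) * (d p.2 * mono h p.2))); last first.
  by apply/funext => p; rewrite prodDn; ring.
apply: (@hasum_pair _ _ _ (fun al be => (c al * mono h al) * (d be * mono h be))
  (fun al => c al * mono h al * g (a + h)) _ (N * M)).
- by apply: rect => al; apply: mono_le.
- by move=> al; apply: hasumZ; apply: dg.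
- under eq_fun do rewrite mulrC; rewrite mulrC; apply: hasumZ; exact: cf.
Qed.

Lemma ell1_exp n (a : 'rV[R]_n) r N f k : 0 < r ->
  ell1 a r N f -> ell1 a r (N ^+ k) (fun q => f q ^+ k).
Proof.
move=> r0 fN; elim: k => [|k IH].
  rewrite expr0; have := ell1_cst a 1 r0; rewrite normr1.
  by apply: ell1_eq => h _; rewrite expr0.
by rewrite exprS; apply: (ell1_eq _ (ell1_mul r0 fN IH)) => h _; rewrite exprS.
Qed.

Lemma ell1_prod n (a : 'rV[R]_n) r (I : Type) (s : seq I) (N_ : I -> R)
    (f_ : I -> 'rV[R]_n -> R) :
  0 < r -> (forall i, ell1 a r (N_ i) (f_ i)) ->
  ell1 a r (\prod_(i <- s) N_ i) (fun q => \prod_(i <- s) f_ i q).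
Proof.
move=> r0 fN; elim: s => [|i s IH].
  rewrite big_nil; have := ell1_cst a 1 r0; rewrite normr1.
  by apply: ell1_eq => h _; rewrite big_nil.
rewrite big_cons; apply: (ell1_eq _ (ell1_mul r0 (fN i) IH)) => h _.
by rewrite big_cons.
Qed.

(** Each increment of g has norm at most s, so substituting it into a monomial of degree d gives
    norm at most s^d; the substituted monomials, weighted by c, are then a family with summable
    norms. *)
Lemma ell1_comp n m (a : 'rV[R]_n) (b : 'rV[R]_m) r s N
    (g : 'rV[R]_n -> 'rV[R]_m) (f : 'rV[R]_m -> R) : 0 < r -> 0 < s ->
  ell1 b s N f -> (forall i, ell1 a r s (fun q => g q 0 i - b 0 i)) ->
  ell1 a r N (f \o g).
Proof.
move=> r0 s0 [c [cN cf]] gs.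
apply: (@ell1_family _ _ (fun al q => c al * \prod_i (g q 0 i - b 0 i) ^+ al i)
  (fun al => `|c al| * s ^+ deg al)) => //.
- move=> al; apply: ell1_scale; rewrite -prodrXr; apply: ell1_prod => // i.
  exact: ell1_exp.
- move=> A; apply: le_trans (cN A); apply: ler_sum => al _.
  by rewrite !normrM normr_id.
move=> h hr /=.
have -> : f (g (a + h)) = f (b + (g (a + h) - b)) by rewrite [b + _]addrC subrK.
rewrite (_ : (fun _ => _) = (fun al => c al * mono (g (a + h) - b) al)).
  apply: cf => i; rewrite !mxE; exact: (ell1_bound r0 (gs i) hr).
by apply/funext => al; congr (_ * _); apply: eq_bigr => i _; rewrite !mxE.
Qed.

Lemma in_box_le n r r' (h : 'rV[R]_n) : r <= r' -> in_box r h -> in_box r' h.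
Proof. by move=> rr hr i; apply: le_trans (hr i) rr. Qed.

Lemma ell1_radius n (a : 'rV[R]_n) r r' N f : 0 < r' <= r ->
  ell1 a r N f -> ell1 a r' N f.
Proof.
move=> /andP[r'0 rr] [c [cN cf]]; exists c; split; last first.
  by move=> h hr; apply: cf; exact: in_box_le hr.
move=> A; apply: le_trans (cN A); apply: ler_sum => al _.
have r0 : 0 <= r := le_trans (ltW r'0) rr.
by rewrite !normrM ler_wpM2l// !normrX !ger0_norm ?lerXn2r ?nnegrE ?(ltW r'0).
Qed.

Lemma mono0 n (al : mi n) : mono (0 : 'rV[R]_n) al = (deg al == 0%N)%:R.
Proof.
have [d0|d0] := eqVneq (deg al) 0%N.
  rewrite big1// => i _; move/eqP: d0; rewrite sum_nat_eq0 => /forallP/(_ i)/eqP ->.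
  by rewrite expr0.
have [i i0] : exists i, al i != 0%N.
  apply/existsP; move: d0; apply: contraR; rewrite negb_exists => /forallP h.
  by rewrite sum_nat_eq0; apply/forallP => i; have := h i; rewrite negbK.
by rewrite (bigD1 i)//= mxE expr0n (negPf i0) mul0r.
Qed.

Lemma deg_eq0 n (al : mi n) : deg al = 0%N -> al = [ffun=> 0%N].
Proof.
move=> /eqP; rewrite sum_nat_eq0 => /forallP h; apply/ffunP => i.
by rewrite ffunE; apply/eqP/h.
Qed.

(** Without a constant term, every monomial gains at least one factor r' / r when the radius
    shrinks. This makes increments as small as composition and inversion require. *)
Lemma ell1_shrink n (a : 'rV[R]_n) r r' N f : 0 < r' <= r -> f a = 0 ->
  ell1 a r N f -> ell1 a r' (r' / r * N) f.
Proof.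
move=> /andP[r'0 rr] fa [c [cN cf]].
have r0 : 0 < r := lt_le_trans r'0 rr.
(* At h = 0 every monomial of positive degree vanishes, so f a is the constant coefficient. *)
have c0 : c [ffun=> 0%N] = 0.
  have h0 : in_box r (0 : 'rV[R]_n) by move=> i; rewrite mxE normr0 ltW.
  have := cf 0 h0; rewrite addr0 fa.
  have := @hasum_finite R _ (fun al => c al * mono (0 : 'rV[R]_n) al)
    [fset [ffun=> 0%N]]%fset.
  rewrite big_seq_fset1 mono0 => H h; rewrite -(hasum_uniq (H _) h).
    by rewrite big1 ?eqxx ?mulr1// => i _; rewrite ffunE.
  move=> al; rewrite inE mono0; have [/deg_eq0 ->|_ _] := eqVneq (deg al) 0%N; last by rewrite mulr0.
  by rewrite eqxx.
exists c; split; last by move=> h hr; apply: cf; exact: in_box_le hr.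
move=> A; apply: le_trans (ler_wpM2l _ (cN A)); last by rewrite divr_ge0// ltW.
rewrite mulr_sumr; apply: ler_sum => al _; rewrite !normrM.
have [/deg_eq0 ->|d0] := eqVneq (deg al) 0%N; first by rewrite c0 normr0 !mul0r mulr0.
rewrite mulrCA ler_wpM2l// !normrX !ger0_norm ?(ltW r0) ?(ltW r'0)//.
rewrite -mulrA -{1}(prednK (n := deg al)) ?lt0n// -{2}(prednK (n := deg al)) ?lt0n//.
by rewrite !exprS mulKf ?gt_eqF// ler_wpM2l ?(ltW r'0)// lerXn2r ?nnegrE ?(ltW r'0) ?(ltW r0).
Qed.

(** Change of centre is substitution of the identity map: around b the increment of coordinate i
    measured from a has norm at most |b_i - a_i| + r'. *)
Lemma ell1_recentre n (a b : 'rV[R]_n) r r' N f : 0 < r' ->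
  (forall i, `|b 0 i - a 0 i| + r' <= r) -> 0 < r -> ell1 a r N f -> ell1 b r' N f.
Proof.
move=> r'0 ab r0 fN; apply: (ell1_comp (g := id) r'0 r0 fN) => i.
apply: (@ell1_le _ _ _ (`|b 0 i - a 0 i| + r')); first exact: ab.
have := ell1_add (ell1_cst b (b 0 i - a 0 i) r'0) (ell1_coord b i r'0).
apply: ell1_eq => h _ /=; rewrite mxE; ring.
Qed.

(** Lowering the exponent of coordinate i divides by that coordinate, at the price of a factor 1 / r
    in the norm. The selection [P] lets a series be split into parts, each divided by a different
    coordinate. *)
Lemma ell1_div n (a : 'rV[R]_n) r N (c : mi n -> R) (P : pred (mi n)) i :
  0 < r -> absum_le (fun al => c al * r ^+ deg al) N ->
  (forall al, P al -> (0 < al i)%N) ->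
  exists2 g, ell1 a r (N / r) g &
    forall h, in_box r h ->
      hasum (fun al => if P al then c al * mono h al else 0) (h 0 i * g (a + h)).
Proof.
move=> r0 cN Pi.
pose m (al : mi n) : mi n := [ffun j => (al j - (j == i))%N].
pose d al := if P al then c al else 0.
have mE (h : 'rV[R]_n) al : P al -> h 0 i * mono h (m al) = mono h al.
  move=> /Pi i0; rewrite (bigD1 i)//= [RHS](bigD1 i)//= ffunE eqxx mulrA -exprS.
  rewrite subn1 prednK//; congr (_ * _); apply: eq_bigr => j ji.
  by rewrite ffunE (negPf ji) subn0.
have mD al : P al -> deg al = (deg (m al)).+1.
  move=> /Pi i0; rewrite (bigD1 i)//= [X in _ = X.+1](bigD1 i)//= ffunE eqxx subn1.
  rewrite -addSn prednK//; congr (_ + _)%N; apply: eq_bigr => j ji.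
  by rewrite ffunE (negPf ji) subn0.
have dN : absum_le (fun al => d al * r ^+ deg (m al)) (N / r).
  move=> A; rewrite ler_pdivlMr// mulr_suml; apply: le_trans (cN A).
  apply: ler_sum => al _; rewrite /d; case: ifPn => [Pal|_].
    by rewrite (mD _ Pal) -{2}(gtr0_norm r0) -normrM -mulrA -exprSr.
  by rewrite mul0r normr0 mul0r.
have [g0 g0P] : {g : 'rV[R]_n -> R & forall h, in_box r h ->
    hasum (fun al => d al * mono h (m al)) (g h)}.
  apply: (@choice _ _ (fun h s => in_box r h -> hasum (fun al => d al * mono h (m al)) s)) => h.
  (* The value 0 outside the polydisc is arbitrary: [ell1] does not look there. *)
  have [hr|hr] := pselect (in_box r h); last by exists 0.
  suff /absum_le_hasum[s sP] : absum_le (fun al => d al * mono h (m al)) (N / r).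
    by exists s.
  move=> A; apply: le_trans (dN A); apply: ler_sum => al _.
  by rewrite !normrM ler_wpM2l// (le_trans (mono_le _ hr))// ler_norm.
exists (fun q => g0 (q - a)).
  apply: (@ell1_collect _ _ d m) => // h hr.
  by rewrite addrAC subrr add0r; apply: g0P.
move=> h hr; rewrite addrAC subrr add0r.
have := hasumZ (k := h 0 i) (g0P h hr).
rewrite (_ : (fun _ => _ * (_ * _)) = (fun al => if P al then c al * mono h al else 0))//.
apply/funext => al; rewrite /d; case: ifPn => [Pal|_]; last by rewrite mul0r mulr0.
by rewrite mulrCA mE.
Qed.

End PowerSeries.

(** * Analytic functions *)

Section Analytic.
Variable R : realType.

Local Notation mi n := {ffun 'I_n -> nat}.
Local Notation deg al := (\sum_i al i)%N.
Local Notation mono h al := (\prod_i h 0 i ^+ al i).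

Definition box_index n N (al : {ffun 'I_n -> 'I_N}) : mi n := [ffun i => al i : nat].

Lemma box_index_inj n N : injective (@box_index n N).
Proof.
by move=> al be /ffunP ab; apply/ffunP => i; apply/val_inj; have := ab i; rewrite !ffunE.
Qed.

Definition box n N : {fset mi n} := [fset box_index al | al in {ffun 'I_n -> 'I_N}]%fset.

Lemma sum_box n N (F : mi n -> R) :
  \sum_(al <- box n N) F al = \sum_(al : {ffun 'I_n -> 'I_N}) F (box_index al).
Proof.
rewrite /box big_imfset /=; last by move=> ? ? _ _; exact: box_index_inj.
by rewrite big_enum.
Qed.

Lemma box_exhaust n (B : {fset mi n}) : \forall N \near \oo, (B `<=` box n N)%fset.
Proof.
exists (\max_(al <- B) \max_i al i).+1 => // N /= BN.
apply/fsubsetP => al alB; apply/imfsetP => /=.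
have aN i : (al i < N)%N.
  apply: leq_trans BN; rewrite ltnS; apply: leq_trans (leq_bigmax_seq _ alB _) => //.
  exact: (leq_bigmax (F := fun i => al i)).
exists [ffun i => Ordinal (aN i)] => //.
by apply/ffunP => i; rewrite !ffunE.
Qed.

Lemma geo_le2 N : \sum_(k < N) (2^-1 : R) ^+ k <= 2.
Proof.
suff -> : \sum_(k < N) (2^-1 : R) ^+ k = 2 - 2 * 2^-1 ^+ N.
  by rewrite lerBlDr lerDl mulr_ge0// exprn_ge0// invr_ge0.
elim: N => [|N IH]; first by rewrite big_ord0 expr0 mulr1 subrr.
by rewrite big_ord_recr /= IH exprS; lra.
Qed.

(** Halving the radius turns the bound M on the terms into geometric decay 2^-|alpha|, and the sum
    of these weights over a box is a product of n geometric sums, each at most 2; hence the constant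
    M 2^n. In the other direction a single term is bounded by the total. *)
Lemma analytic_ell1 n (f : 'rV[R]_n -> R) (a : 'rV[R]_n) :
  analytic_at f a <-> exists r N, 0 < r /\ ell1 a r N f.
Proof.
split=> [[c [r [M [r0 cM fc]]]]|[r [N [r0 [c [cN cf]]]]]]; last first.
  exists c, r, N; split=> // [al|h hr].
    by have := cN [fset al]%fset; rewrite big_seq_fset1 normrM [X in _ * X <= _ -> _]ger0_norm// exprn_ge0// ltW.
  have hr' : in_box r h by move=> i; rewrite ltW.
  have := hasum_exhaust (@box_exhaust n) (cf h hr').
  under eq_fun do rewrite sum_box.
  apply: cvg_trans; apply: near_eq_cvg; apply: nearW => N' /=.
  apply: eq_bigr => al _; congr (_ * _); apply: eq_bigr => i _.
  by rewrite ffunE.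
have M0 : 0 <= M by apply: le_trans (cM [ffun=> 0%N]); rewrite mulr_ge0// exprn_ge0// ltW.
have r20 : 0 < r / 2 by rewrite divr_gt0.
have cN : absum_le (fun al => c al * (r / 2) ^+ deg al) (M * 2 ^+ n).
  move=> A; apply: (@le_trans _ _ (\sum_(al <- A) M * 2^-1 ^+ deg al)).
    apply: ler_sum => al _; rewrite exprMn mulrA normrM.
    rewrite [X in _ * X]ger0_norm; last by rewrite exprn_ge0// invr_ge0.
    rewrite ler_wpM2r ?exprn_ge0 ?invr_ge0//.
    by have := cM al; rewrite normrM [X in _ -> _ * X <= _]ger0_norm// exprn_ge0// ltW.
  rewrite -mulr_sumr ler_wpM2l//.
  have [N _ /(_ N (leqnn N)) AN] := box_exhaust A.
  apply: (@le_trans _ _ (\sum_(al <- box n N) 2^-1 ^+ deg al)).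
    rewrite [leRHS](big_fsetID _ (mem A)) /=.
    rewrite [X in _ <= X + _](_ : _ = \sum_(i <- A) 2^-1 ^+ deg i).
      by rewrite lerDl sumr_ge0// => i _; rewrite exprn_ge0// invr_ge0.
    by apply: eq_fbigl => i; rewrite !inE -in_fsetI (fsetIidPr AN).
  rewrite sum_box.
  rewrite (eq_bigr (fun al : {ffun 'I_n -> 'I_N} => \prod_i 2^-1 ^+ al i)); last first.
    by move=> al _; rewrite prodrXr; congr (_ ^+ _); apply: eq_bigr => i _; rewrite ffunE.
  rewrite -(bigA_distr_bigA (fun (i : 'I_n) (k : 'I_N) => (2^-1 : R) ^+ k)).
  rewrite prodr_const card_ord lerXn2r ?nnegrE ?geo_le2//.
  by rewrite sumr_ge0// => i _; rewrite exprn_ge0// invr_ge0.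
exists (r / 2), (M * 2 ^+ n); split=> //; exists c; split=> // h hr.
have [s hs] := absum_le_hasum (ell1_terms r20 cN hr).
suff -> : f (a + h) = s by [].
have := hasum_exhaust (@box_exhaust n) hs.
under eq_fun do rewrite sum_box.
have hr' i : `|h 0 i| < r.
  by rewrite (le_lt_trans (hr i))// ltr_pdivrMr// ltr_pMr// ltr1n.
have := fc h hr'.
under eq_fun => N.
  rewrite (eq_bigr (fun al => c (box_index al) * mono h (box_index al))); last first.
    move=> al _; congr (_ * _); apply: eq_bigr => i _; by rewrite ffunE.
  over.
by move=> /cvg_lim <- // /cvg_lim <-.
Qed.

Lemma near_box n (a : 'rV[R]_n) r (P : 'rV[R]_n -> Prop) : 0 < r ->
  (forall h, in_box r h -> P (a + h)) -> \forall q \near a, P q.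
Proof.
move=> r0 H; near=> q; have -> : q = a + (q - a) by rewrite addrC subrK.
apply: H => i; rewrite !mxE.
have : `|a - q| < r by near: q; apply: cvgr_dist_lt.
rewrite distrC => aq; apply: le_trans (ltW aq).
rewrite [leRHS]mx_normrE; apply: le_trans (le_bigmax _ _ (0, i)) => /=.
by rewrite !mxE.
Unshelve. all: by end_near. Qed.

Lemma near_boxP n (a : 'rV[R]_n) (P : 'rV[R]_n -> Prop) : (\forall q \near a, P q) ->
  exists2 r, 0 < r & forall h, in_box r h -> P (a + h).
Proof.
move=> /nbhs_ballP[e /= e0 eP]; exists (e / 2); first by rewrite divr_gt0.
move=> h hr; apply: eP; rewrite -ball_normE /ball_/= opprD addrA subrr sub0r normrN.
rewrite (@le_lt_trans _ _ (e / 2)) ?ltr_pdivrMr ?ltr_pMr ?ltr1n//.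
rewrite [leLHS]mx_normrE; apply: bigmax_le; first by rewrite divr_ge0 ?ltW.
by move=> [i j] _ /=; rewrite ord1.
Qed.

Lemma norm_in_box n (h : 'rV[R]_n) : in_box `|h| h.
Proof.
by move=> i; rewrite [leRHS]mx_normrE; apply: le_trans (le_bigmax _ _ (0, i)).
Qed.

Lemma analytic_near n (f : 'rV[R]_n -> R) a :
  analytic_at f a -> \forall b \near a, analytic_at f b.
Proof.
move=> /analytic_ell1[r [N [r0 fN]]].
have r20 : 0 < r / 2 by rewrite divr_gt0.
apply: (near_box r20) => h hr; apply/analytic_ell1; exists (r / 2), N; split=> //.
apply: (ell1_recentre (r' := r / 2) _ _ r0 fN) => // i.
by rewrite mxE addrAC subrr add0r [leRHS]splitr lerD2r.
Qed.

Lemma analytic_eq n (f g : 'rV[R]_n -> R) a :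
  (\forall b \near a, f b = g b) -> analytic_at f a -> analytic_at g a.
Proof.
move=> /near_boxP[r r0 fg] /analytic_ell1[s [N [s0 fN]]]; apply/analytic_ell1.
have t0 : 0 < Num.min r s by rewrite lt_min r0.
exists (Num.min r s), N; split=> //.
apply: (@ell1_eq _ _ _ _ _ f).
  by move=> h hr; apply: fg; apply: in_box_le hr; rewrite ge_min lexx.
by apply: ell1_radius fN; rewrite t0 ge_min lexx orbT.
Qed.

Lemma analytic_ext n (f g : 'rV[R]_n -> R) a :
  f =1 g -> analytic_at f a -> analytic_at g a.
Proof. by move=> /funext ->. Qed.

Lemma analytic_comp n m (f : 'rV[R]_m -> R) (g : 'rV[R]_n -> 'rV[R]_m) a :
  analytic_map_at g a -> analytic_at f (g a) -> analytic_at (f \o g) a.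
Proof.
move=> ga /analytic_ell1[s [N [s0 fN]]]; apply/analytic_ell1.
have /choice[rN rNP] : forall k, exists p : R * R,
    0 < p.1 /\ ell1 a p.1 p.2 (fun q => g q 0 k - g a 0 k).
  move=> k; have /analytic_ell1[r [M [r0 gM]]] := ga k.
  exists (r, M + `|- g a 0 k|); split=> //=.
  exact: ell1_add gM (ell1_cst a (- g a 0 k) r0).
(* On radius r the increment of component k has norm at most r / r_k times N_k; the second entry of
   the minimum makes this at most s. The denominator 1 + N_k is positive even if N_k = 0. *)
pose r := \big[Num.min/1]_k Num.min (rN k).1 (s * (rN k).1 / (1 + (rN k).2)).
have N0 k : 0 <= (rN k).2 by have [_ /ell1_ge0] := rNP k.
have N1 k : 0 < 1 + (rN k).2 by rewrite ltr_wpDr.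
have r0 : 0 < r.
  rewrite /r; elim/big_ind : _ => // [x y x0 y0|k _].
    by rewrite lt_min x0.
  by have [k0 _] := rNP k; rewrite lt_min k0 divr_gt0// mulr_gt0.
exists r, N; split=> //; apply: (ell1_comp r0 s0 fN) => k.
have [k0 gk] := rNP k.
have rk : r <= Num.min (rN k).1 (s * (rN k).1 / (1 + (rN k).2)) by exact: bigmin_le_cond.
apply: (@ell1_le _ _ _ _ (r / (rN k).1 * (rN k).2)); last first.
  apply: ell1_shrink gk; last by rewrite subrr.
  by rewrite r0 /= (le_trans rk)// ge_min lexx.
have : r <= s * (rN k).1 / (1 + (rN k).2) by rewrite (le_trans rk)// ge_min lexx orbT.
rewrite ler_pdivlMr// mulrDr mulr1 => h.
rewrite mulrAC ler_pdivrMr// (le_trans _ h)// lerDr ltW//.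
Qed.

Lemma analytic_map_comp n m k (f : 'rV[R]_m -> 'rV[R]_k) (g : 'rV[R]_n -> 'rV[R]_m) a :
  analytic_map_at g a -> analytic_map_at f (g a) -> analytic_map_at (f \o g) a.
Proof. by move=> ga fga i; apply: (analytic_comp ga (fga i)). Qed.

Lemma analytic_cst n k (a : 'rV[R]_n) : analytic_at (cst k) a.
Proof. by apply/analytic_ell1; exists 1, `|k|; split=> //; apply: ell1_cst. Qed.

Lemma ell1_common n (f g : 'rV[R]_n -> R) a : analytic_at f a -> analytic_at g a ->
  exists r N M, [/\ 0 < r, ell1 a r N f & ell1 a r M g].
Proof.
move=> /analytic_ell1[r [N [r0 fN]]] /analytic_ell1[s [M [s0 gM]]].
have t0 : 0 < Num.min r s by rewrite lt_min r0.
exists (Num.min r s), N, M; split=> //.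
  by apply: ell1_radius fN; rewrite t0 ge_min lexx.
by apply: ell1_radius gM; rewrite t0 ge_min lexx orbT.
Qed.

Lemma analyticD n (f g : 'rV[R]_n -> R) a :
  analytic_at f a -> analytic_at g a -> analytic_at (fun q => f q + g q) a.
Proof.
move=> fa /(ell1_common fa)[r [N [M [r0 fN gM]]]]; apply/analytic_ell1.
by exists r, (N + M); split=> //; apply: ell1_add.
Qed.

Lemma analyticM n (f g : 'rV[R]_n -> R) a :
  analytic_at f a -> analytic_at g a -> analytic_at (fun q => f q * g q) a.
Proof.
move=> fa /(ell1_common fa)[r [N [M [r0 fN gM]]]]; apply/analytic_ell1.
by exists r, (N * M); split=> //; apply: ell1_mul.
Qed.

Lemma analyticN n (f : 'rV[R]_n -> R) a :
  analytic_at f a -> analytic_at (fun q => - f q) a.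
Proof.
move=> fa; have := analyticM (analytic_cst (-1) a) fa.
by apply: analytic_ext => b; rewrite mulN1r.
Qed.

Lemma analyticB n (f g : 'rV[R]_n -> R) a :
  analytic_at f a -> analytic_at g a -> analytic_at (fun q => f q - g q) a.
Proof. by move=> fa ga; apply: analyticD fa (analyticN ga). Qed.

Lemma analytic_sum n (I : Type) (s : seq I) (f : I -> 'rV[R]_n -> R) a :
  (forall i, analytic_at (f i) a) -> analytic_at (fun q => \sum_(i <- s) f i q) a.
Proof.
move=> fa; elim: s => [|i s IH].
  by apply: analytic_ext (analytic_cst 0 a) => b; rewrite big_nil.
apply: analytic_ext (analyticD (fa i) IH) => b.
by rewrite big_cons.
Qed.

Lemma analytic_coord n i (a : 'rV[R]_n) : analytic_at (fun q => q 0 i) a.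
Proof.
have : analytic_at (fun q : 'rV[R]_n => (q 0 i - a 0 i) + cst (a 0 i) q) a.
  apply: analyticD (analytic_cst _ _).
  by apply/analytic_ell1; exists 1, 1; split=> //; apply: ell1_coord.
by apply: analytic_ext => q; rewrite subrK.
Qed.

Lemma hasum_geo (x : R) : `|x| <= 2^-1 -> hasum (fun k : nat => x ^+ k) (1 - x)^-1.
Proof.
move=> x2.
have ex (N : nat) : exists A : {fset nat}, forall k, (k \in A) = (k < N)%N.
  exists [fset nat_of_ord i | i in 'I_N]%fset => k.
  by apply/imfsetP/idP => [[i _ ->]//|kN]; exists (Ordinal kN).
have /choice[A AP] := ex.
have sumA N (F : nat -> R) : \sum_(k <- A N) F k = \sum_(k < N) F k.
  rewrite (@eq_fbigl _ _ _ _ (A N) [fset nat_of_ord i | i in 'I_N]%fset) /=.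
    by rewrite big_imfset /= ?big_enum// => ? ? _ _; exact: val_inj.
  move=> k; rewrite AP; apply/idP/imfsetP => [kN|[i _ ->]//].
  by exists (Ordinal kN).
have AE (B : {fset nat}) : \forall N \near \oo, (B `<=` A N)%fset.
  exists (\max_(k <- B) k).+1 => // N /= BN; apply/fsubsetP => k kB.
  by rewrite AP (leq_trans _ BN)// ltnS (@leq_bigmax_seq nat (enum_fset B) xpredT (fun k => k) _ kB).
have bx : absum_le (fun k : nat => x ^+ k) 2.
  move=> B; have [N _ /(_ N (leqnn N)) BN] := AE B.
  apply: le_trans (geo_le2 N); rewrite -(sumA N (fun k => 2^-1 ^+ k)).
  rewrite [leRHS](big_fsetID _ (mem B)) /=.
  rewrite [X in _ <= X + _](_ : _ = \sum_(i <- B) 2^-1 ^+ i).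
    apply: ler_wpDr; first by apply: sumr_ge0 => i _; rewrite exprn_ge0 ?invr_ge0.
    by apply: ler_sum => k _; rewrite normrX lerXn2r ?nnegrE// invr_ge0.
  by apply: eq_fbigl => i; rewrite !inE -in_fsetI (fsetIidPr BN).
have [s hs] := absum_le_hasum bx.
suff -> : (1 - x)^-1 = s by [].
have x1 : `|x| < 1 by apply: le_lt_trans x2 _; lra.
have := hasum_exhaust AE hs; under eq_fun do rewrite sumA.
have := @cvg_geometric_series R 1 x x1; rewrite mul1r.
rewrite (_ : series _ = fun N => \sum_(k < N) x ^+ k); last first.
  by apply/funext => N; rewrite /series /= big_mkord; apply: eq_bigr => k _; rewrite mul1r.
by move=> /cvg_lim <- // /cvg_lim <-.
Qed.

(** With u = 1 - f / f(a), the reciprocal is f(a)^-1 times the geometric series in u. Since u(a) =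
    0, a small radius brings the norm of u below 1/2, and the norms of the powers then sum to at
    most 2. *)
Lemma analyticV n (f : 'rV[R]_n -> R) a :
  f a != 0 -> analytic_at f a -> analytic_at (fun q => (f q)^-1) a.
Proof.
move=> fa0 fa.
pose u q := 1 - (f a)^-1 * f q.
have ua : analytic_at u a by apply: analyticB (analytic_cst _ _) (analyticM (analytic_cst _ _) fa).
have u0 : u a = 0 by rewrite /u mulVf// subrr.
suff h : analytic_at (fun q => (1 - u q)^-1) a.
  apply: analytic_ext (analyticM (analytic_cst (f a)^-1 a) h) => q.
  by rewrite /u subKr /= invfM invrK mulrA mulVf// mul1r.
move/analytic_ell1 : ua => [r [N [r0 uN]]]; have N0 := ell1_ge0 uN.
pose s := Num.min r (r * 2^-1 / (1 + N)).
have N1 : 0 < 1 + N by rewrite ltr_wpDr.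
have s0 : 0 < s by rewrite lt_min r0 divr_gt0// mulr_gt0// invr_gt0.
have us : ell1 a s 2^-1 u.
  apply: (@ell1_le _ _ _ _ (s / r * N)); last first.
    by apply: ell1_shrink uN => //; rewrite s0 ge_min lexx.
  have : s <= r * 2^-1 / (1 + N) by rewrite ge_min lexx orbT.
  rewrite ler_pdivlMr// mulrDr mulr1 => h.
  by rewrite mulrAC ler_pdivrMr// mulrC [leRHS]mulrC mulrC (le_trans _ h)// lerDr ltW.
apply/analytic_ell1; exists s, 2; split=> //.
apply: (@ell1_family _ _ _ (fun (k : nat) q => u q ^+ k) (fun k => 2^-1 ^+ k)) => //.
- by move=> k; apply: ell1_exp.
- move=> A; have := @hasum_geo 2^-1; rewrite ger0_norm ?invr_ge0// lexx => /(_ isT) h.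
  have : \sum_(i <- A) `|2^-1 ^+ i : R| = \sum_(i <- A) 2^-1 ^+ i.
    by apply: eq_bigr => i _; rewrite ger0_norm// exprn_ge0// invr_ge0.
  move=> ->; apply/ler_addgt0Pr => e e0.
  have [B BP] := (hasumP _ _).1 h _ e0.
  have := BP _ (fsubsetUl B A); rewrite ler_distlC => /andP[_].
  rewrite (_ : (1 - 2^-1)^-1 = 2); last by field.
  apply: le_trans.
  rewrite [leRHS](big_fsetID _ (mem A)) /=.
  rewrite [X in _ <= X + _](_ : _ = \sum_(i <- A) 2^-1 ^+ i).
    by rewrite lerDl sumr_ge0// => i _; rewrite exprn_ge0// invr_ge0.
  by apply: eq_fbigl => i; rewrite !inE andb_orl andbb orb_idl// => /andP[].
- by move=> h hr; apply: hasum_geo; apply: ell1_bound us hr.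
Qed.

End Analytic.

(** * Differentiability of analytic functions *)

Section Differentiation.
Variable R : realType.

Lemma littleo_sq n (a : 'rV[R]_n) (e : 'rV[R]_n -> R) C r : 0 < r ->
  (forall h, in_box r h -> `|e (a + h)| <= C * `|h| ^+ 2) ->
  differentiable e a /\ forall v, 'D_v e a = 0.
Proof.
move=> r0 eC.
have ea : e a = 0.
  have h0 : in_box r (0 : 'rV[R]_n) by move=> i; rewrite mxE normr0 ltW.
  have := eC 0 h0; rewrite addr0 normr0 expr0n mulr0 /=.
  by rewrite normr_le0 => /eqP.
pose D := `|C|.
have D0 : 0 <= D by exact: normr_ge0.
have D1 : 0 < D + 1 by rewrite ltr_wpDl.
have eD h : in_box r h -> `|e (a + h)| <= D * `|h| ^+ 2.
  by move=> /eC/le_trans; apply; rewrite ler_wpM2r ?exprn_ge0 ?ler_norm.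
have H : e \o shift a = cst (e a) + (0 : 'rV[R]_n -> R) +o_ (0 : 'rV[R]_n) id.
  apply/eqaddoP => _/posnumP[d].
  suff : \forall h \near (0 : 'rV[R]_n), `|(e \o shift a - (cst (e a) + 0)) h| <= d%:num * `|h| by [].
  have : \forall h \near (0 : 'rV[R]_n), `|h| < Num.min r (d%:num / (D + 1)).
    by apply: nbhs0_lt; rewrite lt_min r0 divr_gt0.
  apply: filterS => h hd; rewrite !fctE /= ea add0r subr0 addrC.
  have hr : in_box r h.
    apply: in_box_le (norm_in_box h); rewrite ltW//; apply: lt_le_trans hd _.
    by rewrite ge_min lexx.
  apply: le_trans (eD h hr) _; rewrite expr2 mulrA ler_wpM2r//.
  have : `|h| <= d%:num / (D + 1).
    by rewrite ltW// (lt_le_trans hd)// ge_min lexx orbT.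
  rewrite ler_pdivlMr // => hD.
  by rewrite mulrC (le_trans _ hD)// ler_wpM2l// lerDl.
have dE : ('d e a : 'rV[R]_n -> R) = 0.
  apply: (@diff_unique R _ _ e (\0%R : {linear 'rV[R]_n -> R})) H.
  exact: cst_continuous.
have de : differentiable e a.
  by apply/diff_locallyP; rewrite dE; split=> //; exact: cst_continuous.
by split=> // v; rewrite deriveE// dE.
Qed.

Local Notation mi n := {ffun 'I_n -> nat}.
Local Notation deg al := (\sum_i al i)%N.
Local Notation mono h al := (\prod_i h 0 i ^+ al i).

Lemma hasum_sum (I : choiceType) (J : Type) (s : seq J) (f : J -> I -> R) (l : J -> R) :
  (forall j, hasum (f j) (l j)) ->
  hasum (fun i => \sum_(j <- s) f j i) (\sum_(j <- s) l j).
Proof.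
move=> fl; rewrite /hasum.
rewrite (_ : (fun A : {fset I} => _) =
  (fun A : {fset I} => \sum_(j <- s) \sum_(i <- A) f j i)).
  by apply: (@cvg_fsum R _ (@totally I) _ J s (fun j (A : {fset I}) => \sum_(i <- A) f j i) l) => j; exact: fl.
by apply/funext => A; rewrite exchange_big.
Qed.

(** Every nonconstant monomial is divisible by some coordinate; distributing the monomials among the
    coordinates and dividing each share gives the functions g i. *)
Lemma analytic_hadamard n (f : 'rV[R]_n -> R) a : analytic_at f a ->
  exists g : 'I_n -> 'rV[R]_n -> R, (forall i, analytic_at (g i) a) /\
    exists2 r, 0 < r &
      forall h, in_box r h -> f (a + h) = f a + \sum_i h 0 i * g i (a + h).
Proof.
move=> /analytic_ell1[r [N [r0 [c [cN cf]]]]].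
(* [pick] assigns each nonzero multi-index to exactly one coordinate with positive exponent, so the
   shares partition the series minus its constant term. *)
pose P i (al : mi n) := [pick j | (0 < al j)%N] == Some i.
have Pi i al : P i al -> (0 < al i)%N by rewrite /P; case: pickP => // j ? /eqP[<-].
have /choice[g gP] : forall i, exists g, ell1 a r (N / r) g /\
    forall h, in_box r h ->
      hasum (fun al => if P i al then c al * mono h al else 0) (h 0 i * g (a + h)).
  by move=> i; have [g ? ?] := ell1_div a r0 cN (Pi i); exists g.
exists g; split.
  by move=> i; apply/analytic_ell1; exists r, (N / r); split=> //; have [] := gP i.
exists r => //.
have E h : in_box r h -> f (a + h) = c [ffun=> 0%N] + \sum_i h 0 i * g i (a + h).
  move=> hr.
  have h0 : hasum (fun al : mi n => if al == [ffun=> 0%N] then c al else 0) (c [ffun=> 0%N]).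
    rewrite -[X in hasum _ X](_ : \sum_(i <- [fset [ffun=> 0%N]]%fset)
       (if i == [ffun=> 0%N] then c i else 0) = c [ffun=> 0%N]).
      by apply: hasum_finite => al; rewrite inE => /negPf ->.
    by rewrite big_seq_fset1 eqxx.
  have := hasumD h0 (hasum_sum (s := index_enum 'I_n) (fun i => (gP i).2 h hr)).
  apply: hasum_uniq; have := cf h hr; congr hasum; apply/funext => al.
  rewrite /P; case: pickP => [j aj|a0].
    rewrite [\sum_(i < n) _](bigD1 j)//= eqxx [\sum_(i < n | _) _]big1 ?addr0; last first.
      by move=> i /negPf ij; rewrite (_ : (_ == _) = false)//; apply/negbTE/eqP => -[ji]; rewrite ji eqxx in ij.
    case: eqP => [a0|_]; last by rewrite add0r.
    by rewrite a0 ffunE in aj.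
  have -> : al = [ffun=> 0%N].
    by apply/ffunP => i; rewrite ffunE; apply/eqP; rewrite -leqn0 leqNgt a0.
  rewrite eqxx [\sum_(i < n) _]big1 ?addr0; last by move=> i _.
  by rewrite big1 ?mulr1// => i _; rewrite ffunE expr0.
have h0 : in_box r (0 : 'rV[R]_n) by move=> i; rewrite mxE normr0 ltW.
have := E 0 h0; rewrite addr0 big1 ?addr0; last by move=> i _; rewrite mxE mul0r.
by move=> -> h /E.
Qed.

Lemma analytic_lipschitz n (f : 'rV[R]_n -> R) a : analytic_at f a ->
  exists C r, [/\ 0 < r, 0 <= C & forall t h, 0 < t <= r -> in_box t h ->
    `|f (a + h) - f a| <= C * t].
Proof.
move=> /analytic_ell1[r [N [r0 fN]]]; have N0 := ell1_ge0 fN.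
have gN := ell1_add fN (ell1_cst a (- f a) r0).
exists ((N + `|- f a|) / r), r; split=> //; first by rewrite divr_ge0 ?addr_ge0// ltW.
move=> t h /andP[t0 tr] ht.
have := ell1_shrink (r' := t) _ _ gN; rewrite t0 tr => /(_ isT) H.
have := ell1_bound t0 (H (subrr _)) ht => /= /le_trans; apply.
by rewrite mulrAC [t * _]mulrC mulrAC.
Qed.

(** By Hadamard's lemma the remainder after the linear part is the sum of h_i (g_i(a + h) - g_i(a)),
    which is quadratically small because each g_i is Lipschitz at a. *)
Lemma analytic_diff n (f : 'rV[R]_n -> R) a : analytic_at f a -> differentiable f a.
Proof.
move=> /analytic_hadamard[g [ga [r r0 fg]]].
have /choice[p pP] : forall i, exists p : R * R, [/\ 0 < p.2, 0 <= p.1 &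
    forall t h, 0 < t <= p.2 -> in_box t h -> `|g i (a + h) - g i a| <= p.1 * t].
  by move=> i; have [C [s ?]] := analytic_lipschitz (ga i); exists (C, s).
pose l (q : 'rV[R]_n) := f a + \sum_i (g i a * (q 0 i - a 0 i)).
have dl : differentiable l a.
  apply: differentiableD => //.
  rewrite (_ : (fun q => _) = \sum_i (fun q : 'rV[R]_n => g i a * (q 0 i - a 0 i))); last first.
    by apply/funext => q; rewrite fct_sumE.
  apply: differentiable_sum => i; apply: differentiableM => //.
  apply: differentiableB => //; exact: differentiable_coord.
pose e q := f q - l q.
have -> : f = l \+ e by apply/funext => q; rewrite /= /e addrC subrK.
apply: differentiableD => //.
pose s := \big[Num.min/r]_i (p i).2.
have s0 : 0 < s.
  rewrite /s; elim/big_ind : _ => // [x y x0 y0|i _]; first by rewrite lt_min x0.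
  by have [] := pP i.
suff [] : differentiable e a /\ forall v, 'D_v e a = 0 by [].
apply: (littleo_sq (C := \sum_i (p i).1) s0) => h hs.
have hr : in_box r h by apply: in_box_le hs; rewrite /s; exact: bigmin_le_id.
rewrite /e /l fg// opprD addrACA subrr add0r.
have [->|h0] := eqVneq h 0.
  rewrite normr0 expr0n mulr0 !big1 ?subr0 ?normr0// => i _; rewrite !mxE ?mul0r//.
  by rewrite addr0 subrr mulr0.
rewrite -sumrB (le_trans (ler_norm_sum _ _ _))// mulr_suml; apply: ler_sum => i _.
rewrite !mxE [a 0 i + _]addrC addrK [g i a * _]mulrC -mulrBr normrM.
rewrite expr2 mulrA [leRHS]mulrC ler_pM//; first exact: norm_in_box.
have [_ _ /(_ `|h| h)] := pP i; apply; last exact: norm_in_box.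
rewrite normr_gt0 h0 /= (le_trans (y := s))//; last exact: bigmin_le_cond.
rewrite [leLHS]mx_normrE; apply: bigmax_le; first exact: ltW.
by move=> [k j] _ /=; rewrite ord1.
Qed.

Lemma analytic_map_diff n m (f : 'rV[R]_n -> 'rV[R]_m) a :
  analytic_map_at f a -> differentiable f a.
Proof.
move=> fa.
have -> : f = \sum_(i < m) (fun q => f q 0 i *: delta_mx 0 i).
  by apply/funext => q; rewrite fct_sumE [LHS]row_sum_delta.
by apply: differentiable_sum => i; apply: differentiableZl; apply/analytic_diff/fa.
Qed.

Lemma analytic_cont n (f : 'rV[R]_n -> R) a : analytic_at f a -> {for a, continuous f}.
Proof. by move=> /analytic_diff/differentiable_continuous. Qed.

Lemma analytic_map_cont n m (f : 'rV[R]_n -> 'rV[R]_m) a :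
  analytic_map_at f a -> {for a, continuous f}.
Proof. by move=> /analytic_map_diff/differentiable_continuous. Qed.

Lemma analytic_map_row_mx n m k (f : 'rV[R]_n -> 'rV[R]_m) (g : 'rV[R]_n -> 'rV[R]_k) a :
  analytic_map_at f a -> analytic_map_at g a ->
  analytic_map_at (fun q => row_mx (f q) (g q)) a.
Proof.
move=> fa ga i; case: (split_ordP i) => j ->.
  by apply: analytic_ext (fa j) => q; rewrite row_mxEl.
by apply: analytic_ext (ga j) => q; rewrite row_mxEr.
Qed.

Lemma analytic_lsubmx n m k (f : 'rV[R]_n -> 'rV[R]_(m + k)) a :
  analytic_map_at f a -> analytic_map_at (fun q => lsubmx (f q)) a.
Proof. by move=> fa i; apply: analytic_ext (fa (lshift k i)) => q; rewrite mxE. Qed.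

Lemma analytic_rsubmx n m k (f : 'rV[R]_n -> 'rV[R]_(m + k)) a :
  analytic_map_at f a -> analytic_map_at (fun q => rsubmx (f q)) a.
Proof. by move=> fa i; apply: analytic_ext (fa (rshift m i)) => q; rewrite mxE. Qed.

Lemma analytic_map_id n (a : 'rV[R]_n) : analytic_map_at id a.
Proof. by move=> i; apply: analytic_coord. Qed.

Lemma analytic_map_cst n m (c : 'rV[R]_m) (a : 'rV[R]_n) : analytic_map_at (cst c) a.
Proof. by move=> i; exact: analytic_cst. Qed.

(* With F(q, s) = f(q + s v) = F(q, 0) + s G(q, s), the derivative of f along v
   is q |-> G(q, 0). *)
Lemma analytic_derive n (f : 'rV[R]_n -> R) a v :
  analytic_at f a -> analytic_at ('D_v f) a.
Proof.
move=> fa.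
pose F (y : 'rV[R]_(n + 1)) := f (lsubmx y + rsubmx y 0 0 *: v).
pose c : 'rV[R]_(n + 1) := row_mx a 0.
have /analytic_ell1[r [N [r0 [d [dN dF]]]]] : analytic_at F c.
  apply: analytic_comp; last by rewrite row_mxKl row_mxKr mxE scale0r addr0.
  move=> i; apply: (analytic_ext (f := fun q : 'rV[R]_(n + 1) =>
     q 0 (lshift 1 i) + q 0 (rshift n 0) * v 0 i)).
    by move=> q; rewrite !mxE.
  apply: analyticD; first exact: analytic_coord.
  apply: analyticM; [exact: analytic_coord | exact: analytic_cst].
pose P (al : mi (n + 1)) := (0 < al (rshift n 0%R))%N.
have [G Ga GP] := ell1_div (i := rshift n 0%R) c r0 dN (P := P) (fun _ => id).
have GA : analytic_at G c by apply/analytic_ell1; exists r, (N / r).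
have E q s : in_box r (row_mx (q - a) (s%:M : 'rV[R]_1)) ->
    f (q + s *: v) = f q + s * G (row_mx q (s%:M : 'rV[R]_1)).
  move=> hr.
  have hr0 : in_box r (row_mx (q - a) (0 : 'rV[R]_1)).
    move=> i; have := hr i; case: (split_ordP i) => j ->; first by rewrite !row_mxEl.
    by rewrite !row_mxEr => _; rewrite mxE normr0 ltW.
  have cE (u : 'rV[R]_1) : c + row_mx (q - a) u = row_mx q u.
    by rewrite add_row_mx add0r [a + _]addrC subrK.
  have FE u : F (row_mx q u) = f (q + u 0 0 *: v) by rewrite /F row_mxKl row_mxKr.
  have := dF _ hr0; rewrite cE FE mxE scale0r addr0 => h1.
  have := GP _ hr; rewrite cE row_mxEr mxE eqxx mulr1n => h2.
  have := dF _ hr; rewrite cE FE mxE eqxx mulr1n => /hasum_uniq; apply.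
  have := hasumD h1 h2; congr hasum; apply/funext => al.
  case: ifPn => [Pal|nPal].
    rewrite [X in _ * X + _](_ : _ = 0) ?mulr0 ?add0r//.
    rewrite (bigD1 (rshift n 0))//= row_mxEr mxE expr0n.
    by move: Pal; rewrite /P lt0n => /negPf ->; rewrite mul0r.
  rewrite addr0; congr (_ * _); apply: eq_bigr => i _.
  case: (split_ordP i) => j ->; first by rewrite !row_mxEl.
  by move: nPal; rewrite ord1 /P -eqn0Ngt => /eqP ->; rewrite !expr0.
have emb q : analytic_map_at (fun q : 'rV[R]_n => row_mx q (0 : 'rV[R]_1)) q.
  by apply: analytic_map_row_mx; [exact: analytic_map_id | exact: analytic_map_cst].
apply: (analytic_eq (f := fun q => G (row_mx q 0))); last first.
  exact: (analytic_comp (emb a) GA).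
have /analytic_near GAn := analytic_comp (emb a) GA.
have /near_boxP[r1 r10 Gn] := analytic_near GA.
have t0 : 0 < Num.min r r1 by rewrite lt_min r0.
apply: (near_box t0) => h ht.
have ht1 : in_box r1 (row_mx h (0 : 'rV[R]_1)).
  move=> i; case: (split_ordP i) => j ->; rewrite ?row_mxEl ?row_mxEr.
    by apply: le_trans (ht j) _; rewrite ge_min lexx orbT.
  by rewrite mxE normr0 ltW.
have {}Gn := Gn _ ht1; rewrite add_row_mx add0r in Gn.
have [C [s [s0 C0 Cs]]] := analytic_lipschitz Gn.
apply/esym/cvg_lim => //; apply/cvgrPdist_le => e e0; near=> x.
have x0 : x != 0 by near: x; exact: nbhs_dnbhs_neq.
have xb : `|x| < Num.min s (Num.min r (e / (C + 1))).
  by near: x; apply: dnbhs0_lt; rewrite !lt_min s0 r0 divr_gt0// ltr_wpDl.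
move: xb; rewrite !lt_min => /and3P[xs xr xe].
rewrite /= [x *: v + _]addrC E; last first.
  move=> i; rewrite [_ - a]addrAC subrr add0r.
  case: (split_ordP i) => j ->; rewrite ?row_mxEl ?row_mxEr.
    by apply: le_trans (ht j) _; rewrite ge_min lexx.
  by rewrite ord1 mxE eqxx mulr1n ltW.
rewrite addrAC subrr add0r scalerA mulVf// scale1r distrC.
have := Cs `|x| (row_mx 0 (x%:M)); rewrite normr_gt0 x0 (ltW xs) => /(_ isT).
rewrite add_row_mx addr0 add0r => H.
apply: le_trans (H _) _.
  move=> i; case: (split_ordP i) => j ->; rewrite ?row_mxEl ?row_mxEr.
    by rewrite mxE normr0.
  by rewrite ord1 mxE eqxx mulr1n.
move: xe; rewrite ltr_pdivlMr ?ltr_wpDl// => /ltW; apply: le_trans.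
by rewrite mulrC ler_wpM2l// lerDl.
Unshelve. all: by end_near. Qed.

End Differentiation.

(** * Differential calculus of analytic functions *)

Section Calculus.
Variable R : realType.

Lemma analytic_derivable n (f : 'rV[R]_n -> R) a v : analytic_at f a -> derivable f a v.
Proof. by move=> /analytic_diff/diff_derivable. Qed.

Lemma derive_addf n (f g : 'rV[R]_n -> R) a v : analytic_at f a -> analytic_at g a ->
  'D_v (fun q => f q + g q) a = 'D_v f a + 'D_v g a.
Proof. by move=> fa ga; apply: deriveD; apply: analytic_derivable. Qed.

Lemma derive_oppf n (f : 'rV[R]_n -> R) a v : analytic_at f a ->
  'D_v (fun q => - f q) a = - 'D_v f a.
Proof. by move=> fa; apply: deriveN; apply: analytic_derivable. Qed.

Lemma derive_mulf n (f g : 'rV[R]_n -> R) a v : analytic_at f a -> analytic_at g a ->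
  'D_v (fun q => f q * g q) a = 'D_v f a * g a + f a * 'D_v g a.
Proof.
move=> fa ga; rewrite [LHS](deriveM (analytic_derivable (v := v) fa) (analytic_derivable (v := v) ga)).
by rewrite addrC [g a *: _]mulrC.
Qed.

Lemma derive_invf n (f : 'rV[R]_n -> R) a v : f a != 0 -> analytic_at f a ->
  'D_v (fun q => (f q)^-1) a = - 'D_v f a / f a ^+ 2.
Proof.
move=> fa0 fa; rewrite [LHS](deriveV fa0 (analytic_derivable (v := v) fa)).
by rewrite mulNr mulrC -scaleNr.
Qed.

Lemma derive_cstf n (k : R) (a v : 'rV[R]_n) : 'D_v (fun=> k) a = 0.
Proof. exact: derive_cst. Qed.

Lemma derive_sumf n (I : Type) (s : seq I) (f : I -> 'rV[R]_n -> R) a v :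
  (forall i, analytic_at (f i) a) ->
  'D_v (fun q => \sum_(i <- s) f i q) a = \sum_(i <- s) 'D_v (f i) a.
Proof.
move=> fa; elim: s => [|i s IH].
  by rewrite big_nil; under eq_fun do rewrite big_nil; exact: derive_cstf.
rewrite big_cons -IH -derive_addf//; last exact: analytic_sum.
by congr ('D_v _ a); apply/funext => q; rewrite big_cons.
Qed.

Lemma derive_coord n i (a v : 'rV[R]_n) : 'D_v (fun q : 'rV[R]_n => q 0 i) a = v 0 i.
Proof.
have d : derivable (@id 'rV[R]_n) a v by exact: derivable_id.
have := derive_mx d; rewrite derive_id => /matrixP/(_ 0 i).
by rewrite !mxE.
Qed.

Lemma derive_eq n (f g : 'rV[R]_n -> R) a v :
  (\forall q \near a, f q = g q) -> 'D_v f a = 'D_v g a.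
Proof. exact: near_eq_derive. Qed.

Lemma derive_ext n (f g : 'rV[R]_n -> R) a v : f =1 g -> 'D_v f a = 'D_v g a.
Proof. by move=> /funext ->. Qed.

Lemma derive_partial n (f : 'rV[R]_n -> R) a v : differentiable f a ->
  'D_v f a = \sum_i v 0 i * 'D_('e_i) f a.
Proof.
move=> fa; rewrite deriveE// {1}(row_sum_delta v) linear_sum.
by apply: eq_bigr => i _; rewrite linearZ deriveE.
Qed.

Lemma derive_map_entry n m (g : 'rV[R]_n -> 'rV[R]_m) a v k : analytic_map_at g a ->
  ('D_v g a) 0 k = 'D_v (fun q => g q 0 k) a.
Proof.
by move=> /analytic_map_diff/(diff_derivable (v := v))/derive_mx ->; rewrite mxE.
Qed.

Lemma derive_chain n m (f : 'rV[R]_m -> R) (g : 'rV[R]_n -> 'rV[R]_m) a v :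
  analytic_map_at g a -> analytic_at f (g a) ->
  'D_v (fun q => f (g q)) a = \sum_k 'D_v (fun q => g q 0 k) a * 'D_('e_k) f (g a).
Proof.
move=> ga fga; have dg := analytic_map_diff ga; have df := analytic_diff fga.
rewrite deriveE; last exact: differentiable_comp.
rewrite diff_comp//= -!deriveE// derive_partial//.
by apply: eq_bigr => k _; rewrite derive_map_entry.
Qed.

(** Differentiating f = f(a) + sum of (q_i - a_i) g_i twice at a leaves only terms with one
    derivative on the coordinate factor and one on g_i, an expression symmetric in the two
    directions. *)
Lemma deriveC n (f : 'rV[R]_n -> R) a u v : analytic_at f a ->
  'D_u ('D_v f) a = 'D_v ('D_u f) a.
Proof.
move=> /analytic_hadamard[g [ga [r r0 fg]]].
have ca i : analytic_at (fun q : 'rV[R]_n => q 0 i - a 0 i) a.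
  by apply: analyticB; [exact: analytic_coord | exact: analytic_cst].
have dc i w q : 'D_w (fun q : 'rV[R]_n => q 0 i - a 0 i) q = w 0 i.
  rewrite derive_addf; [|exact: analytic_coord|exact: analytic_cst].
  by rewrite derive_coord derive_cstf addr0.
have fE : \forall q \near a, f q = f a + \sum_i (q 0 i - a 0 i) * g i q.
  apply: (near_box r0) => h /fg ->; congr (_ + _); apply: eq_bigr => i _.
  by rewrite mxE addrAC subrr add0r.
have gan : \forall q \near a, forall i, analytic_at (g i) q.
  by apply: (@filter_forall _ _ (fun i q => analytic_at (g i) q) (nbhs a) _) => i; apply: analytic_near.
have D w : \forall q \near a, 'D_w f q =
    \sum_i (w 0 i * g i q + (q 0 i - a 0 i) * 'D_w (g i) q).
  near=> q.
  have gq : forall i, analytic_at (g i) q by near: q.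
  have cq i : analytic_at (fun q : 'rV[R]_n => q 0 i - a 0 i) q.
    by apply: analyticB; [exact: analytic_coord | exact: analytic_cst].
  rewrite (@derive_eq _ _ (fun q => f a + \sum_i (q 0 i - a 0 i) * g i q)); last first.
    by near: q; exact: (near_join fE).
  rewrite derive_addf; [|exact: analytic_cst|]; last first.
    by apply: analytic_sum => i; apply: analyticM.
  rewrite derive_cstf add0r derive_sumf => [|i]; last exact: analyticM.
  by apply: eq_bigr => i _; rewrite derive_mulf// dc.
have DD w z : 'D_w ('D_z f) a = \sum_i (z 0 i * 'D_w (g i) a + w 0 i * 'D_z (g i) a).
  rewrite (derive_eq _ (D z)) derive_sumf => [|i]; last first.
    apply: analyticD; apply: analyticM => //; first exact: analytic_cst.
    exact: analytic_derive.
  apply: eq_bigr => i _; have gda := analytic_derive z (ga i).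
  rewrite derive_addf; [|by apply: analyticM => //; exact: analytic_cst|exact: analyticM].
  rewrite !derive_mulf//; last exact: analytic_cst.
  by rewrite dc derive_cstf subrr !mul0r add0r addr0.
by rewrite !DD; apply: eq_bigr => i _; rewrite addrC.
Unshelve. all: by end_near. Qed.

Lemma is_derive_line n (f : 'rV[R]_n -> R) y v (s : R) : derivable f (y + s *: v) v ->
  is_derive s 1 (fun t => f (y + t *: v)) ('D_v f (y + s *: v)).
Proof.
have E : (fun h : R => h^-1 *: (((fun t => f (y + t *: v)) \o shift s) (h *: 1)
    - f (y + s *: v))) =
  (fun h : R => h^-1 *: ((f \o shift (y + s *: v)) (h *: v) - f (y + s *: v))).
  apply/funext => h /=; congr (_ *: (f _ - _)).
  by rewrite [h *: 1]mulr1 scalerDl addrCA.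
move=> d; apply: DeriveDef; first by rewrite /derivable E.
by rewrite /derive E.
Qed.

Lemma affine_along n (f : 'rV[R]_n -> R) y v c :
  (forall s : R, 0 <= s <= 1 -> analytic_at f (y + s *: v) /\ 'D_v f (y + s *: v) = c) ->
  f (y + v) = f y + c.
Proof.
move=> H; pose g t := f (y + t *: v).
have gd (s : R) : 0 <= s <= 1 -> is_derive s 1 g c.
  by move=> /H[fs <-]; apply: is_derive_line; exact: analytic_derivable.
have [x||x _] := @MVT_segment R g (fun=> c) 0 1 ler01.
- by rewrite in_itv /= => /andP[x0 x1]; apply: gd; rewrite !ltW.
- apply: derivable_within_continuous => x; rewrite in_itv /= => /gd.
  by case.
- rewrite /g scale1r scale0r addr0 subr0 mulr1 => /(canRL (subrK _)) ->.
  by rewrite addrC.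
Qed.

Lemma derive_coord0 (T : R -> R) (q : 'rV[R]_2) :
  'D_('e_0) (fun q : 'rV[R]_2 => T (q 0 0)) q = T^`()%classic (q 0 0).
Proof.
rewrite /derive /derive1.
rewrite (_ : (fun h : R => _) = (fun h => h^-1 *: (T (h + q 0 0) - T (q 0 0))))//.
by apply/funext => h /=; rewrite !mxE /= mulr1.
Qed.

Lemma derive_coord1 (T : R -> R) (q : 'rV[R]_2) :
  'D_('e_1) (fun q : 'rV[R]_2 => T (q 0 0)) q = 0.
Proof.
rewrite /derive (_ : (fun h : R => _) = fun=> 0); first exact: lim_cst.
by apply/funext => h /=; rewrite !mxE /= mulr0 add0r subrr scaler0.
Qed.

End Calculus.

Opaque derive.

(** * Jets along graphs *)

Section IsD.
Variable R : realType.

(** Analyticity and the value of the derivative travel together, so a derivative is computed by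
    composing rules without separate analyticity obligations. *)
Definition isD n (v : 'rV[R]_n) (f : 'rV[R]_n -> R) a d :=
  analytic_at f a /\ 'D_v f a = d.

Variable n : nat.
Implicit Types (v a : 'rV[R]_n) (f g : 'rV[R]_n -> R) (c d e : R).

Lemma isD_of v f a : analytic_at f a -> isD v f a ('D_v f a).
Proof. by []. Qed.

Lemma isD_eq v f a d e : isD v f a d -> d = e -> isD v f a e.
Proof. by move=> + <-. Qed.

Lemma isD_cst v c a : isD v (fun=> c) a 0.
Proof. by split; [exact: analytic_cst | exact: derive_cstf]. Qed.

Lemma isD_coord v i a : isD v (fun q => q 0 i) a (v 0 i).
Proof. by split; [exact: analytic_coord | exact: derive_coord]. Qed.

Lemma isD_add v f g a d e :
  isD v f a d -> isD v g a e -> isD v (fun q => f q + g q) a (d + e).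
Proof. by move=> [fa <-] [ga <-]; split; [exact: analyticD | exact: derive_addf]. Qed.

Lemma isD_opp v f a d : isD v f a d -> isD v (fun q => - f q) a (- d).
Proof. by move=> [fa <-]; split; [exact: analyticN | exact: derive_oppf]. Qed.

Lemma isD_mul v f g a d e :
  isD v f a d -> isD v g a e -> isD v (fun q => f q * g q) a (d * g a + f a * e).
Proof. by move=> [fa <-] [ga <-]; split; [exact: analyticM | exact: derive_mulf]. Qed.

Lemma isD_inv v f a d :
  f a != 0 -> isD v f a d -> isD v (fun q => (f q)^-1) a (- d / f a ^+ 2).
Proof. by move=> f0 [fa <-]; split; [exact: analyticV | exact: derive_invf]. Qed.

Lemma isD_sqr v f a d : isD v f a d -> isD v (fun q => f q ^+ 2) a (2 * f a * d).
Proof.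
move=> fd; have [h1 h2] := isD_mul fd fd; split.
  by apply: analytic_ext h1 => q; rewrite expr2.
under eq_fun do rewrite expr2; rewrite h2; ring.
Qed.

Lemma isD_sum v (I : Type) (s : seq I) (f : I -> 'rV[R]_n -> R) a (d : I -> R) :
  (forall i, isD v (f i) a (d i)) ->
  isD v (fun q => \sum_(i <- s) f i q) a (\sum_(i <- s) d i).
Proof.
move=> fd; split; first by apply: analytic_sum => i; case: (fd i).
by rewrite derive_sumf => [|i]; [apply: eq_bigr => i _; case: (fd i) | case: (fd i)].
Qed.

End IsD.

(* [ring] and [field] compare atoms up to conversion, which diverges on derivatives. *)
Ltac gen_derive := repeat match goal with
  | |- context [@derive ?K ?V ?W ?f ?a ?v] =>
    let d := fresh "d" in generalize (@derive K V W f a v); intro d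
  | |- context [@dt ?K ?f ?q] => let d := fresh "d" in generalize (@dt K f q); intro d
  | |- context [@dx ?K ?f ?q] => let d := fresh "d" in generalize (@dx K f q); intro d
  end.

Ltac isD_tac := repeat match goal with
  | h : isD ?v ?f ?a _ |- isD ?v ?f ?a _ => exact h
  | |- isD _ (fun q => ?c) _ _ => exact (isD_cst _ c _)
  | |- isD _ (fun q => fun_of_matrix q 0 ?i) _ _ => exact (isD_coord _ i _)
  | |- isD _ (fun q => @?f q + @?g q) _ _ => refine (@isD_add _ _ _ f g _ _ _ _ _)
  | |- isD _ (fun q => - (@?f q)) _ _ => refine (@isD_opp _ _ _ f _ _ _)
  | |- isD _ (fun q => (@?f q) ^+ 2) _ _ => refine (@isD_sqr _ _ _ f _ _ _)
  | |- isD _ (fun q => @?f q * @?g q) _ _ => refine (@isD_mul _ _ _ f g _ _ _ _ _)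
  | |- isD _ (fun q => (@?f q)^-1) _ _ => refine (@isD_inv _ _ _ f _ _ _ _)
  end.

Section Jets.
Variable R : realType.
Implicit Types (o b : 'rV[R]_2 -> R).

(** Cramer's rule for the chain rule: if phi(b0, b1) = o, then [grad_t] and [grad_x] are the partial
    derivatives of phi at the image point. *)
Definition jac2 b0 b1 (q : 'rV[R]_2) : R := dt b0 q * dx b1 q - dt b1 q * dx b0 q.
Definition grad_t b0 b1 o (q : 'rV[R]_2) : R := (dx b1 q * dt o q - dt b1 q * dx o q) / jac2 b0 b1 q.
Definition grad_x b0 b1 o (q : 'rV[R]_2) : R := (dt b0 q * dx o q - dx b0 q * dt o q) / jac2 b0 b1 q.

Lemma jacobianE n m (f : 'rV[R]_n -> 'rV[R]_m) (a : 'rV[R]_n) i k :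
  analytic_map_at f a -> jacobian f a i k = 'D_('e_i) (fun q => f q 0 k) a.
Proof.
move=> fq; have := deriveEjacobian 'e_i (analytic_map_diff fq).
by rewrite -rowE => /matrixP/(_ 0 k); rewrite mxE => <-; rewrite derive_map_entry.
Qed.

Lemma sum2 (V : nmodType) (F : 'I_2 -> V) : \sum_i F i = F 0 + F 1.
Proof. by rewrite !big_ord_recl big_ord0 addr0; congr (_ + F _); apply/val_inj. Qed.

Lemma sum3 (V : nmodType) (F : 'I_3 -> V) : \sum_i F i = F 0 + F 1 + F 2.
Proof.
rewrite !big_ord_recl big_ord0 addr0 addrA.
by congr (_ + F _ + F _); apply/val_inj.
Qed.

Lemma ord2P (P : 'I_2 -> Prop) : P 0 -> P 1 -> forall i, P i.
Proof.
move=> P0 P1 [[|[|//]] p]; first by rewrite (_ : Ordinal p = 0)//; apply/val_inj.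
by rewrite (_ : Ordinal p = 1)//; apply/val_inj.
Qed.

Lemma ord3P (P : 'I_3 -> Prop) : P 0 -> P 1 -> P 2 -> forall i, P i.
Proof.
move=> P0 P1 P2 [[|[|[|//]]] p]; first by rewrite (_ : Ordinal p = 0)//; apply/val_inj.
  by rewrite (_ : Ordinal p = 1)//; apply/val_inj.
by rewrite (_ : Ordinal p = 2)//; apply/val_inj.
Qed.

Lemma jac2_unit (be : 'rV[R]_2 -> 'rV[R]_2) (q : 'rV[R]_2) : analytic_map_at be q ->
  (jacobian be q \in unitmx) =
  (jac2 (fun q => be q 0 0) (fun q => be q 0 1) q != 0).
Proof.
move=> bq; have JE i k := jacobianE i k bq.
rewrite unitmxE unitfE; congr (_ != 0); move: (jacobian be q) JE => J JE.
rewrite (expand_det_row _ 0) sum2 /cofactor !det_mx11 !mxE !JE.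
rewrite expr0 expr1 !mul1r mulN1r /jac2 /dt /dx mulrN.
rewrite (_ : lift 0 0 = 1); last by apply/val_inj.
by rewrite (_ : lift 1 0 = 0)//; apply/val_inj.
Qed.

Lemma grad_alongE n (be : 'rV[R]_2 -> 'rV[R]_2) (om : 'rV[R]_2 -> 'rV[R]_n) (q : 'rV[R]_2) k :
  let b0 := fun q => be q 0 0 in let b1 := fun q => be q 0 1 in
  analytic_map_at be q -> analytic_map_at om q -> jac2 b0 b1 q != 0 ->
  grad_along be om q 0 k = grad_t b0 b1 (fun q => om q 0 k) q /\
  grad_along be om q 1 k = grad_x b0 b1 (fun q => om q 0 k) q.
Proof.
move=> b0 b1 bq oq J0; have Ju : jacobian be q \in unitmx by rewrite jac2_unit.
set G := grad_along be om q.
have JG : jacobian be q *m G = jacobian om q by rewrite mulKVmx.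
have E i : 'D_('e_i) (fun q => om q 0 k) q = 'D_('e_i) b0 q * G 0 k + 'D_('e_i) b1 q * G 1 k.
  by rewrite -!jacobianE// -JG mxE sum2 !jacobianE.
move: J0; rewrite /grad_t /grad_x /jac2 /dt /dx !E; gen_derive.
by move: (G 0 k) (G 1 k) => G0 G1 J0; split; field.
Qed.

Lemma grad_x_eq b0 b1 o o' (q : 'rV[R]_2) :
  (\forall q' \near q, o q' = o' q') -> grad_x b0 b1 o q = grad_x b0 b1 o' q.
Proof. by move=> oo; rewrite /grad_x /dx /dt !(derive_eq _ oo). Qed.

(** The second x-derivative differentiates the first one, so Cramer's formula is needed on a
    neighbourhood of q, where the Jacobian stays nonzero. *)
Lemma jet_alongE n (be : 'rV[R]_2 -> 'rV[R]_2) (om : 'rV[R]_2 -> 'rV[R]_n) (q : 'rV[R]_2) k :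
  let b0 := fun q => be q 0 0 in let b1 := fun q => be q 0 1 in
  let o := fun q => om q 0 k in
  analytic_map_at be q -> analytic_map_at om q -> jac2 b0 b1 q != 0 ->
  [/\ jt (jet_along be om q) 0 k = grad_t b0 b1 o q,
      jx (jet_along be om q) 0 k = grad_x b0 b1 o q
    & jxx (jet_along be om q) 0 k = grad_x b0 b1 (grad_x b0 b1 o) q].
Proof.
move=> b0 b1 o bq oq J0.
have an_part f i : analytic_at f q -> analytic_at ('D_('e_i) f) q by exact: analytic_derive.
have Jan : analytic_at (jac2 b0 b1) q.
  by apply: analyticB; apply: analyticM; apply: an_part; apply: bq.
have gan l : analytic_at (grad_x b0 b1 (fun q => om q 0 l)) q.
  apply: analyticM; last exact: analyticV.
  by apply: analyticB; apply: analyticM; apply: an_part; try exact: bq; exact: oq.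
have near_g : \forall q' \near q, forall l, grad_along be om q' 1 l =
    grad_x b0 b1 (fun q => om q 0 l) q'.
  have h1 : \forall q' \near q, forall i, analytic_at (fun q => be q 0 i) q'.
    apply: (@filter_forall _ _ (fun i q' => analytic_at (fun q => be q 0 i) q') (nbhs q) _) => i.
    exact: (analytic_near (bq i)).
  have h2 : \forall q' \near q, forall i, analytic_at (fun q => om q 0 i) q'.
    apply: (@filter_forall _ _ (fun i q' => analytic_at (fun q => om q 0 i) q') (nbhs q) _) => i.
    exact: (analytic_near (oq i)).
  have h3 : \forall q' \near q, jac2 b0 b1 q' != 0.
    exact: (cvgr_neq0 (jac2 b0 b1 q) (analytic_cont Jan) J0).
  near=> q' => l.
  have h1q : analytic_map_at be q' by near: q'.
  have h2q : analytic_map_at om q' by near: q'.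
  have h3q : jac2 b0 b1 q' != 0 by near: q'.
  exact: (grad_alongE l h1q h2q h3q).2.
have FE : forall l, \forall q' \near q,
    grad_x b0 b1 (fun q => om q 0 l) q' = (row 1 (grad_along be om q')) 0 l.
  by move=> l; move: near_g; apply: filterS => q' E; rewrite mxE E.
have Fan : analytic_map_at (fun q' => row 1 (grad_along be om q')) q.
  by move=> l; apply: analytic_eq (FE l) (gan l).
have [h0 h1] := grad_alongE k bq oq J0.
have [_ h2] := grad_alongE k bq Fan J0.
have rE (M : 'M[R]_(2, n)) i : row i M 0 k = M i k by rewrite mxE.
split; [exact: etrans (rE _ _) h0 | exact: etrans (rE _ _) h1 |].
by rewrite (etrans (rE _ _) h2); apply: grad_x_eq; apply: filterS (FE k) => q' /esym.
Unshelve. all: by end_near. Qed.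

Lemma dt_coord0 (q : 'rV[R]_2) : dt (fun q : 'rV[R]_2 => q 0 0) q = 1 :> R.
Proof. by rewrite /dt derive_coord mxE. Qed.
Lemma dx_coord0 (q : 'rV[R]_2) : dx (fun q => q 0 0) q = 0 :> R.
Proof. by rewrite /dx derive_coord mxE. Qed.
Lemma dt_coord1 (q : 'rV[R]_2) : dt (fun q => q 0 1) q = 0 :> R.
Proof. by rewrite /dt derive_coord mxE. Qed.
Lemma dx_coord1 (q : 'rV[R]_2) : dx (fun q => q 0 1) q = 1 :> R.
Proof. by rewrite /dx derive_coord mxE. Qed.

Lemma jet_ofE n (f : 'rV[R]_2 -> 'rV[R]_n) (q : 'rV[R]_2) k : analytic_map_at f q ->
  let fk := fun q => f q 0 k in
  [/\ jt (jet_of f q) 0 k = dt fk q, jx (jet_of f q) 0 k = dx fk q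
    & jxx (jet_of f q) 0 k = dx (dx fk) q].
Proof.
move=> fq fk.
have J1 q' : jac2 (fun q => (id q) 0 0) (fun q => (id q) 0 1) q' = 1.
  by rewrite /jac2 dt_coord0 dx_coord1 dt_coord1 dx_coord0; ring.
have J0 : jac2 (fun q => (id q) 0 0) (fun q => (id q) 0 1) q != 0.
  by rewrite J1 oner_neq0.
have gE o : grad_x (fun q => (id q) 0 0) (fun q => (id q) 0 1) o = dx o.
  apply/funext => q'.
  by rewrite /grad_x J1 dt_coord0 dx_coord0 divr1 mul1r mul0r subr0.
have [h1 h2 h3] := jet_alongE k (@analytic_map_id R 2 q) fq J0.
split; [rewrite [LHS]h1|rewrite [LHS]h2|rewrite [LHS]h3].
- by rewrite /grad_t J1 dx_coord1 dt_coord1 divr1 mul1r mul0r subr0.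
- by have /(congr1 (fun F => F q)) := gE fk.
- rewrite [in LHS](gE fk).
  by have /(congr1 (fun F => F q)) := gE (dx fk).
Qed.

End Jets.

(** * Total derivatives along graphs, and graphs with prescribed jets *)

Section Graph.
Variable R : realType.

Lemma derive_dirD m (f : 'rV[R]_m -> R) a u v : analytic_at f a ->
  'D_(u + v) f a = 'D_u f a + 'D_v f a.
Proof. by move=> /analytic_diff fa; rewrite !deriveE// linearD. Qed.

Lemma derive_dirZ m (f : 'rV[R]_m -> R) a c v : analytic_at f a ->
  'D_(c *: v) f a = c * 'D_v f a.
Proof. by move=> /analytic_diff fa; rewrite !deriveE// linearZ. Qed.

Lemma derive2_dirD m (f : 'rV[R]_m -> R) a u v w : analytic_at f a ->
  'D_w ('D_(u + v) f) a = 'D_w ('D_u f) a + 'D_w ('D_v f) a.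
Proof.
move=> fa; rewrite -derive_addf; try exact: analytic_derive.
by apply: derive_eq; move: (analytic_near fa); apply: filterS => q; exact: derive_dirD.
Qed.

Lemma derive2_dirZ m (f : 'rV[R]_m -> R) a c v w : analytic_at f a ->
  'D_w ('D_(c *: v) f) a = c * 'D_w ('D_v f) a.
Proof.
move=> fa; have fva := analytic_derive v fa.
have -> : c * 'D_w ('D_v f) a = 'D_w (fun q => c * 'D_v f q) a.
  by rewrite derive_mulf// ?derive_cstf ?mul0r ?add0r//; exact: analytic_cst.
by apply: derive_eq; move: (analytic_near fa); apply: filterS => q; exact: derive_dirZ.
Qed.

Lemma derive2_partial m (f : 'rV[R]_m -> R) a u w : analytic_at f a ->
  'D_w ('D_u f) a = \sum_k u 0 k * 'D_w ('D_('e_k) f) a.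
Proof.
move=> fa; rewrite (@derive_eq _ _ _ (fun q => \sum_k u 0 k * 'D_('e_k) f q)); last first.
  move: (analytic_near fa); apply: filterS => q fq.
  by apply: derive_partial; exact: analytic_diff.
have fka k : analytic_at ('D_('e_k) f) a by exact: analytic_derive.
rewrite derive_sumf; last by move=> k; apply: analyticM => //; exact: analytic_cst.
apply: eq_bigr => k _; rewrite derive_mulf//; last exact: analytic_cst.
by rewrite derive_cstf mul0r add0r.
Qed.

Lemma derive2_square m (f : 'rV[R]_m -> R) a u w : analytic_at f a ->
  'D_(u + w) ('D_(u + w) f) a = 'D_u ('D_u f) a + 'D_u ('D_w f) a
    + ('D_w ('D_u f) a + 'D_w ('D_w f) a).
Proof.
move=> fa; have Da v := analytic_derive v fa.
apply: etrans (derive_dirD u w (Da (u + w))) _.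
by congr (_ + _); exact: derive2_dirD.
Qed.

(** The parallelogram identity for the quadratic form of second derivatives. *)
Lemma derive2_second_diff m (f : 'rV[R]_m -> R) a u v : analytic_at f a ->
  'D_(u + v) ('D_(u + v) f) a + 'D_(u + -1 *: v) ('D_(u + -1 *: v) f) a =
  2 * 'D_u ('D_u f) a + 2 * 'D_v ('D_v f) a.
Proof.
move=> fa; have Da w := analytic_derive w fa.
apply: etrans (congr2 +%R (derive2_square u v fa) (derive2_square u (-1 *: v) fa)) _.
have h1 := derive2_dirZ (-1) v u fa.
have h2 := derive_dirZ (-1) v (Da u).
have h3 := etrans (derive_dirZ (-1) v (Da (-1 *: v))) (congr1 ( *%R (-1)) (derive2_dirZ (-1) v v fa)).
have alg (a0 a1 a2 a3 b1 b2 b3 : R) : b1 = -1 * a1 -> b2 = -1 * a2 -> b3 = -1 * (-1 * a3) ->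
  a0 + a1 + (a2 + a3) + (a0 + b1 + (b2 + b3)) = 2 * a0 + 2 * a3 by move=> -> -> ->; ring.
exact: alg h1 h2 h3.
Qed.

Variable n : nat.
Implicit Types f : 'rV[R]_2 -> 'rV[R]_n.

Definition graph f (q : 'rV[R]_2) : 'rV[R]_(2 + n) := row_mx q (f q).
Definition dvec i f (q : 'rV[R]_2) : 'rV[R]_n := \row_k 'D_('e_i) (fun q => f q 0 k) q.
(** Direction of the i-th total derivative: if p is the i-th partial derivative of f, this is the
    tangent of the graph of f above ['e_i]. Directions [vertical] move the unknowns only. *)
Definition tangent i (p : 'rV[R]_n) : 'rV[R]_(2 + n) := row_mx 'e_i p.
Definition vertical (p : 'rV[R]_n) : 'rV[R]_(2 + n) := row_mx 0 p.

Lemma tangentD i p v : tangent i (p + v) = tangent i p + vertical v.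
Proof. by rewrite /tangent /vertical add_row_mx addr0. Qed.

Lemma verticalD p v : vertical (p + v) = vertical p + vertical v.
Proof. by rewrite /vertical add_row_mx addr0. Qed.

Lemma verticalZ c v : vertical (c *: v) = c *: vertical v.
Proof. by rewrite /vertical scale_row_mx scaler0. Qed.

Lemma vertical_sum v : vertical v = \sum_k v 0 k *: vertical 'e_k.
Proof.
rewrite {1}(row_sum_delta v).
elim: (index_enum _) => [|k s IH]; first by rewrite !big_nil /vertical row_mx0.
by rewrite !big_cons verticalD verticalZ IH.
Qed.

Lemma vertical0 : vertical 0 = 0.
Proof. by rewrite /vertical row_mx0. Qed.

Lemma row_decomp (u : 'rV[R]_(2 + n)) :
  u = lsubmx u 0 0 *: tangent 0 0 + lsubmx u 0 1 *: tangent 1 0 + vertical (rsubmx u).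
Proof.
rewrite -[LHS]hsubmxK /tangent /vertical !scale_row_mx !add_row_mx !scaler0 !add0r addr0.
by congr row_mx; rewrite [LHS]row_sum_delta sum2.
Qed.

Lemma analytic_graph f q : analytic_map_at f q -> analytic_map_at (graph f) q.
Proof. by move=> fq; apply: analytic_map_row_mx => //; exact: analytic_map_id. Qed.

Lemma derive_graph f q i k :
  'D_('e_i) (fun q => graph f q 0 k) q = tangent i (dvec i f q) 0 k.
Proof.
rewrite /tangent; case: (split_ordP k) => j ->.
  rewrite row_mxEl -(derive_coord j q 'e_i); apply: derive_ext => q'.
  by rewrite row_mxEl.
by rewrite row_mxEr mxE; apply: derive_ext => q'; rewrite row_mxEr.
Qed.

Lemma chain1 (phi : 'rV[R]_(2 + n) -> R) f q i :
  analytic_map_at f q -> analytic_at phi (graph f q) ->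
  'D_('e_i) (fun q' => phi (graph f q')) q = 'D_(tangent i (dvec i f q)) phi (graph f q).
Proof.
move=> fq phiq; rewrite derive_chain//; last exact: analytic_graph.
rewrite derive_partial; last exact: analytic_diff.
by apply: eq_bigr => k _; rewrite derive_graph.
Qed.

Lemma analytic_dvec f q i : analytic_map_at f q -> analytic_map_at (dvec i f) q.
Proof.
move=> fq k; apply: analytic_ext (analytic_derive 'e_i (fq k)) => q'.
by rewrite mxE.
Qed.

(** The second derivatives of f enter only through the last term, and linearly; the rest depends on
    the first jet. All later variations of f_tt and f_xx rest on this splitting. *)
Lemma chain2 (phi : 'rV[R]_(2 + n) -> R) f q i j :
  analytic_map_at f q -> analytic_at phi (graph f q) ->
  'D_('e_j) ('D_('e_i) (fun q' => phi (graph f q'))) q =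
    'D_(tangent j (dvec j f q)) ('D_(tangent i (dvec i f q)) phi) (graph f q) +
    'D_(vertical (dvec j (dvec i f) q)) phi (graph f q).
Proof.
move=> fq phiq; have gq := analytic_graph fq.
have phik k : analytic_at ('D_('e_k) phi) (graph f q) by exact: analytic_derive.
have Vq : analytic_map_at (fun q' => tangent i (dvec i f q')) q.
  by apply: analytic_map_row_mx; [exact: analytic_map_cst | exact: analytic_dvec].
rewrite (@derive_eq _ _ _ (fun q' => \sum_k tangent i (dvec i f q') 0 k *
   'D_('e_k) phi (graph f q'))); last first.
  have h1 : \forall q' \near q, analytic_at phi (graph f q').
    by apply: (analytic_map_cont gq); exact: analytic_near.
  have h2 : \forall q' \near q, forall k, analytic_at (fun q => f q 0 k) q'.
    apply: (@filter_forall _ _ (fun k q' => analytic_at (fun q => f q 0 k) q') (nbhs q) _) => k.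
    exact: (analytic_near (fq k)).
  near=> q'; have p1 : analytic_at phi (graph f q') by near: q'.
  have p2 : analytic_map_at f q' by near: q'.
  rewrite chain1// derive_partial//; exact: analytic_diff.
rewrite derive_sumf; last first.
  by move=> k; apply: analyticM; [exact: Vq | exact: (analytic_comp gq (phik k))].
have -> : \sum_(k < 2 + n) 'D_('e_j) (fun q' => tangent i (dvec i f q') 0 k *
    'D_('e_k) phi (graph f q')) q =
  \sum_k tangent i (dvec i f q) 0 k * 'D_(tangent j (dvec j f q)) ('D_('e_k) phi) (graph f q) +
  \sum_k vertical (dvec j (dvec i f) q) 0 k * 'D_('e_k) phi (graph f q).
  rewrite -big_split /=; apply: eq_bigr => k _.
  rewrite derive_mulf; [|exact: Vq|exact: (analytic_comp gq (phik k))].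
  rewrite addrC (chain1 (phi := 'D_('e_k) phi))//; congr (_ + _); congr (_ * _).
  rewrite /tangent /vertical; case: (split_ordP k) => l ->.
    rewrite row_mxEl mxE -[RHS](derive_cstf (('e_i : 'rV[R]_2) 0 l) q 'e_j).
    by apply: derive_ext => q'; rewrite row_mxEl.
  by rewrite row_mxEr [RHS]mxE; apply: derive_ext => q'; rewrite row_mxEr.
by rewrite -derive2_partial// -derive_partial//; exact: analytic_diff.
Unshelve. all: by end_near. Qed.

(** A graph through a given point with prescribed f_t, f_x, f_tt = r and f_xx = w, so that the jets
    of arbitrary graphs can be treated as free variables. The mixed derivative is zero, since it is
    never varied. *)
Definition jetpoly (q0 : 'rV[R]_2) (g p s r w : 'rV[R]_n) (q : 'rV[R]_2) : 'rV[R]_n :=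
  \row_k (g 0 k + p 0 k * (q 0 0 - q0 0 0) + s 0 k * (q 0 1 - q0 0 1)
   + r 0 k / 2 * (q 0 0 - q0 0 0) ^+ 2 + w 0 k / 2 * (q 0 1 - q0 0 1) ^+ 2).

Lemma jetpolyP q g p s r w : let f := jetpoly q g p s r w in
  [/\ analytic_map_at f q, f q = g, dvec 0 f q = p & dvec 1 f q = s] /\
  [/\ dvec 0 (dvec 0 f) q = r, dvec 1 (dvec 1 f) q = w,
      dvec 1 (dvec 0 f) q = 0 & dvec 0 (dvec 1 f) q = 0].
Proof.
move=> f.
have E k : (fun q' => f q' 0 k) = (fun q' : 'rV[R]_2 => g 0 k + p 0 k * (q' 0 0 - q 0 0)
    + s 0 k * (q' 0 1 - q 0 1) + r 0 k / 2 * (q' 0 0 - q 0 0) ^+ 2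
    + w 0 k / 2 * (q' 0 1 - q 0 1) ^+ 2).
  by apply/funext => q'; rewrite mxE.
have D i q' k : isD 'e_i (fun q' => f q' 0 k) q'
    (p 0 k * (i == 0)%:R + s 0 k * (i == 1)%:R + r 0 k * (q' 0 0 - q 0 0) * (i == 0)%:R
     + w 0 k * (q' 0 1 - q 0 1) * (i == 1)%:R).
  rewrite E; apply: isD_eq; first by isD_tac.
  by rewrite !mxE !(eq_sym 0 i) !(eq_sym 1 i); field.
have dE i : dvec i f = fun q' => \row_k (p 0 k * (i == 0)%:R + s 0 k * (i == 1)%:R + r 0 k * (q' 0 0 - q 0 0) * (i == 0)%:R
     + w 0 k * (q' 0 1 - q 0 1) * (i == 1)%:R).
  by apply/funext => q'; apply/rowP => k; rewrite !mxE; case: (D i q' k).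
have DD i j k : isD 'e_j (fun q' => dvec i f q' 0 k) q
   (r 0 k * (j == 0)%:R * (i == 0)%:R + w 0 k * (j == 1)%:R * (i == 1)%:R).
  rewrite dE (_ : (fun q' => _) = fun q' : 'rV[R]_2 => p 0 k * (i == 0)%:R + s 0 k * (i == 1)%:R + r 0 k * (q' 0 0 - q 0 0) * (i == 0)%:R
     + w 0 k * (q' 0 1 - q 0 1) * (i == 1)%:R); last by apply/funext => q'; rewrite mxE.
  apply: isD_eq; first by isD_tac.
  by rewrite !mxE !(eq_sym 0 j) !(eq_sym 1 j); ring.
have fin k : \row_j (r 0 j * (0 == 0 :> 'I_2)%:R) = r.
  by apply/rowP => j; rewrite mxE eqxx mulr1.
split; split.
- by move=> k; case: (D 0 q k).
- by apply/rowP => k; rewrite mxE !subrr; ring.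
- by apply/rowP => k; rewrite dE mxE !subrr /=; ring.
- by apply/rowP => k; rewrite dE mxE !subrr /=; ring.
- by apply/rowP => k; rewrite mxE (DD 0 0 k).2 /=; ring.
- by apply/rowP => k; rewrite mxE (DD 1 1 k).2 /=; ring.
- by apply/rowP => k; rewrite mxE (DD 0 1 k).2 mxE /=; ring.
- by apply/rowP => k; rewrite mxE (DD 1 0 k).2 mxE /=; ring.
Qed.

End Graph.

Opaque tangent vertical.

(** * Evolution systems *)

Section Evolution.
Variable R : realType.
Variable n : nat.
Variable E : system_class R n.
Variable H : coefs R -> 'rV[R]_2 -> 'rV[R]_n -> 'rV[R]_n -> 'I_n -> R.

Definition evolution := forall th p (j : jet R n),
  E th p j <-> forall k, jt j 0 k = cA th p * jxx j 0 k + H th p (jw j) (jx j) k.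

Implicit Types (Phi : 'rV[R]_(2 + n) -> 'rV[R]_(2 + n)) (y z : 'rV[R]_(2 + n)).

Definition maps_at Phi y (th th' : coefs R) := forall f : 'rV[R]_2 -> 'rV[R]_n,
  let q := lsubmx y in
  let beta q' := lsubmx (on_graph Phi f q') in
  let omega q' := rsubmx (on_graph Phi f q') in
  analytic_map_at f q -> f q = rsubmx y -> jacobian beta q \in unitmx ->
  (E th q (jet_of f q) <-> E th' (beta q) (jet_along beta omega q)).

Definition along Phi f (k : 'I_(2 + n)) (q : 'rV[R]_2) : R := Phi (graph f q) 0 k.

Local Notation i0 := (lshift n (0 : 'I_2)).
Local Notation i1 := (lshift n (1 : 'I_2)).

Lemma maps_atE Phi y th th' : evolution -> analytic_map_at Phi y ->
  maps_at Phi y th th' <->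
  forall f, let q := lsubmx y in analytic_map_at f q -> f q = rsubmx y ->
    let b0 := along Phi f i0 in let b1 := along Phi f i1 in
    let o k := along Phi f (rshift 2 k) in
    jac2 b0 b1 q != 0 ->
    ((forall k, dvec 0 f q 0 k = cA th q * dvec 1 (dvec 1 f) q 0 k
        + H th q (rsubmx y) (dvec 1 f q) k) <->
     (forall k, grad_t b0 b1 (o k) q = cA th' (lsubmx (Phi y)) *
        grad_x b0 b1 (grad_x b0 b1 (o k)) q
        + H th' (lsubmx (Phi y)) (rsubmx (Phi y)) (\row_k grad_x b0 b1 (o k) q) k)).
Proof.
move=> EH Py.
have key f (q := lsubmx y) (be := fun q' => lsubmx (on_graph Phi f q'))
    (om := fun q' => rsubmx (on_graph Phi f q'))
    (b0 := along Phi f i0) (b1 := along Phi f i1) (o := fun k => along Phi f (rshift 2 k)) :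
    analytic_map_at f q -> f q = rsubmx y ->
  [/\ (jacobian be q \in unitmx) = (jac2 b0 b1 q != 0),
    E th q (jet_of f q) <-> (forall k, dvec 0 f q 0 k = cA th q * dvec 1 (dvec 1 f) q 0 k
        + H th q (rsubmx y) (dvec 1 f q) k)
   & jac2 b0 b1 q != 0 -> (E th' (be q) (jet_along be om q) <->
     (forall k, grad_t b0 b1 (o k) q = cA th' (lsubmx (Phi y)) *
        grad_x b0 b1 (grad_x b0 b1 (o k)) q
        + H th' (lsubmx (Phi y)) (rsubmx (Phi y)) (\row_k grad_x b0 b1 (o k) q) k))].
  move=> fq fqy.
  have gy : graph f q = y by rewrite /graph fqy hsubmxK.
  have gan : analytic_map_at (fun q' => Phi (graph f q')) q.
    by apply: (analytic_map_comp (g := graph f) (f := Phi)); [exact: analytic_graph | rewrite gy].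
  have bean : analytic_map_at be q by exact: analytic_lsubmx.
  have oman : analytic_map_at om q by exact: analytic_rsubmx.
  have b0E : (fun q' => be q' 0 0) = b0 by apply/funext => q'; rewrite mxE.
  have b1E : (fun q' => be q' 0 1) = b1 by apply/funext => q'; rewrite mxE.
  have oE k : (fun q' => om q' 0 k) = o k by apply/funext => q'; rewrite mxE.
  split.
  - by rewrite jac2_unit// b0E b1E.
  - apply: iff_trans (EH _ _ _) _.
    have jxE : jx (jet_of f q) = dvec 1 f q.
      by apply/rowP => k; have [_ h _] := jet_ofE k fq; apply: etrans h _; rewrite mxE.
    have d11 k : dvec 1 (dvec 1 f) q 0 k = dx (dx (fun q => f q 0 k)) q.
      by rewrite mxE; apply: derive_ext => q'; rewrite mxE.
    have jE k : jt (jet_of f q) 0 k = dvec 0 f q 0 k /\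
        jxx (jet_of f q) 0 k = dvec 1 (dvec 1 f) q 0 k.
      by have [h1 _ h2] := jet_ofE k fq; split; [apply: etrans h1 _; rewrite mxE | rewrite d11; exact: h2].
    rewrite jxE; split => h k; have := h k; rewrite -fqy.
      by have [h1 h2] := jE k; move=> /(etrans (esym h1)) ->; rewrite h2.
    by have [h1 h2] := jE k; move=> hk; apply: etrans h1 _; rewrite hk -h2.
  - move=> J0; apply: iff_trans (EH _ _ _) _.
    have J0' : jac2 (fun q' => be q' 0 0) (fun q' => be q' 0 1) q != 0 by rewrite b0E b1E.
    have jxE : jx (jet_along be om q) = \row_k grad_x b0 b1 (o k) q.
      apply/rowP => k; have [_ h _] := jet_alongE k bean oman J0'.
      by apply: etrans h _; rewrite mxE b0E b1E oE.
    have -> : be q = lsubmx (Phi y) by rewrite /be /on_graph -/(graph f q) gy.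
    have jwE : jw (jet_along be om q) = rsubmx (Phi y).
      by rewrite /= /om /on_graph -/(graph f q) gy.
    rewrite jxE jwE; split => h k; have := h k;
      have [] := jet_alongE k bean oman J0'; rewrite b0E b1E oE => h1 _ h2.
      by move=> /(etrans (esym h1)) ->; rewrite h2.
    by move=> hk; apply: etrans h1 _; rewrite hk -h2.
split=> h f q.
  move=> fq fqy b0 b1 o J0; have [Ju hE hE'] := key f fq fqy.
  apply: iff_trans (iff_sym hE) (iff_trans _ (hE' J0)).
  by apply: h => //; rewrite Ju.
move=> be om fq fqy; have [Ju hE hE'] := key f fq fqy; rewrite Ju => J0.
apply: iff_trans hE (iff_trans _ (iff_sym (hE' J0))); exact: h.
Qed.

Lemma along_D Phi f q k i : analytic_map_at f q -> analytic_map_at Phi (graph f q) ->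
  'D_('e_i) (along Phi f k) q =
  'D_(tangent i (dvec i f q)) (fun y => Phi y 0 k) (graph f q).
Proof. by move=> fq Pq; apply: (chain1 (phi := fun y => Phi y 0 k)). Qed.

Lemma along_DD Phi f q k i j : analytic_map_at f q -> analytic_map_at Phi (graph f q) ->
  'D_('e_j) ('D_('e_i) (along Phi f k)) q =
    'D_(tangent j (dvec j f q)) ('D_(tangent i (dvec i f q)) (fun y => Phi y 0 k)) (graph f q) +
    'D_(vertical (dvec j (dvec i f) q)) (fun y => Phi y 0 k) (graph f q).
Proof. by move=> fq Pq; apply: (chain2 (phi := fun y => Phi y 0 k)). Qed.

Lemma along_an Phi f q k : analytic_map_at f q -> analytic_map_at Phi (graph f q) ->
  analytic_at (along Phi f k) q.
Proof.
move=> fq Pq; apply: (analytic_comp (g := graph f) (f := fun y => Phi y 0 k)).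
  exact: analytic_graph.
exact: Pq.
Qed.

Lemma grad_xxE (b0 b1 o : 'rV[R]_2 -> R) q :
  analytic_at b0 q -> analytic_at b1 q -> analytic_at o q -> jac2 b0 b1 q != 0 ->
  let J := jac2 b0 b1 q in let G := grad_x b0 b1 o q in
  let N i := 'D_('e_i) (dt b0) q * dx o q + dt b0 q * 'D_('e_i) (dx o) q
    - 'D_('e_i) (dx b0) q * dt o q - dx b0 q * 'D_('e_i) (dt o) q in
  let K i := 'D_('e_i) (dt b0) q * dx b1 q + dt b0 q * 'D_('e_i) (dx b1) q
    - 'D_('e_i) (dt b1) q * dx b0 q - dt b1 q * 'D_('e_i) (dx b0) q in
  grad_x b0 b1 (grad_x b0 b1 o) q =
    (dt b0 q * (N 1 - G * K 1) - dx b0 q * (N 0 - G * K 0)) / J ^+ 2.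
Proof.
move=> b0q b1q oq J0 J G N K.
have D i : isD 'e_i (grad_x b0 b1 o) q ((N i - G * K i) / J).
  have d0 : isD 'e_i (dt b0) q ('D_('e_i) (dt b0) q) := isD_of 'e_i (analytic_derive 'e_0 b0q).
  have d1 : isD 'e_i (dx b0) q ('D_('e_i) (dx b0) q) := isD_of 'e_i (analytic_derive 'e_1 b0q).
  have d2 : isD 'e_i (dt b1) q ('D_('e_i) (dt b1) q) := isD_of 'e_i (analytic_derive 'e_0 b1q).
  have d3 : isD 'e_i (dx b1) q ('D_('e_i) (dx b1) q) := isD_of 'e_i (analytic_derive 'e_1 b1q).
  have d4 : isD 'e_i (dt o) q ('D_('e_i) (dt o) q) := isD_of 'e_i (analytic_derive 'e_0 oq).
  have d5 : isD 'e_i (dx o) q ('D_('e_i) (dx o) q) := isD_of 'e_i (analytic_derive 'e_1 oq).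
  have := isD_mul (isD_add (isD_mul d0 d5) (isD_opp (isD_mul d1 d4)))
    (isD_inv J0 (isD_add (isD_mul d0 d3) (isD_opp (isD_mul d2 d1)))).
  move=> h; apply: isD_eq h _.
  move: J0; rewrite /N /G /K /J /grad_x /jac2; gen_derive => J0; field.
  exact: J0.
rewrite [LHS]/grad_x; rewrite /dx /dt (D 1).2 (D 0).2 -/(dx b0) -/(dt b0).
move: J0; rewrite -/J; clear D; clearbody N K G J; gen_derive.
by move=> J0; field.
Qed.

Definition shift2 (b c : 'rV[R]_2 -> R) q (r w : R) :=
  [/\ analytic_at b q, analytic_at c q, dt b q = dt c q & dx b q = dx c q] /\
  [/\ 'D_('e_0) (dt b) q = 'D_('e_0) (dt c) q + r,
      'D_('e_1) (dt b) q = 'D_('e_1) (dt c) q,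
      'D_('e_0) (dx b) q = 'D_('e_0) (dx c) q
    & 'D_('e_1) (dx b) q = 'D_('e_1) (dx c) q + w].

Definition has_jet2 (b : 'rV[R]_2 -> R) (q : 'rV[R]_2) (b0 b1 b00 b01 b10 b11 : R) :=
  [/\ analytic_at b q, dt b q = b0 & dx b q = b1] /\
  [/\ 'D_('e_0) (dt b) q = b00, 'D_('e_1) (dt b) q = b01,
      'D_('e_0) (dx b) q = b10 & 'D_('e_1) (dx b) q = b11].

Lemma has_jet2_shift b c q b0 b1 b00 b01 b10 b11 x r w :
  has_jet2 b q b0 b1 (b00 + r) b01 b10 (b11 + w) ->
  has_jet2 c q b0 b1 (b00 + x) b01 b10 (b11 + x) -> x = 0 -> shift2 b c q r w.
Proof.
move=> [[h1 h2 h3] [h4 h5 h6 h7]] [[k1 k2 k3] [k4 k5 k6 k7]] x0.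
rewrite x0 addr0 in k4; rewrite x0 addr0 in k7.
split; split; [exact: h1 | exact: k1 | rewrite h2 k2 | rewrite h3 k3 |
  rewrite h4 k4 | rewrite h5 k5 | rewrite h6 k6 | rewrite h7 k7]; reflexivity.
Qed.

(** Let phi(b0, b1) = o. Second derivatives of o are second derivatives of phi on the base
    directions plus G times those of b1 and Gt times those of b0; so the former change by r - G r1 -
    Gt r0 and w - G w1 - Gt w0. The new x-derivative is (dt b0 D_x - dx b0 D_t) / J, whence the
    squared weights. *)
Lemma grad_xx_shift (b0 b1 o c0 c1 u : 'rV[R]_2 -> R) q r0 w0 r1 w1 r w :
  shift2 b0 c0 q r0 w0 -> shift2 b1 c1 q r1 w1 -> shift2 o u q r w ->
  jac2 c0 c1 q != 0 ->
  let G := grad_x c0 c1 u q in let Gt := grad_t c0 c1 u q in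
  [/\ jac2 b0 b1 q = jac2 c0 c1 q, grad_x b0 b1 o q = G, grad_t b0 b1 o q = Gt
   & grad_x b0 b1 (grad_x b0 b1 o) q = grad_x c0 c1 (grad_x c0 c1 u) q +
     (dt c0 q ^+ 2 * (w - G * w1 - Gt * w0) + dx c0 q ^+ 2 * (r - G * r1 - Gt * r0))
      / jac2 c0 c1 q ^+ 2].
Proof.
move=> [[bq0 cq0 h1 h2] [h3 h4 h5 h6]] [[bq1 cq1 k1 k2] [k3 k4 k5 k6]].
move=> [[oq uq l1 l2] [l3 l4 l5 l6]] J0 G Gt.
have JE : jac2 b0 b1 q = jac2 c0 c1 q by rewrite /jac2 h1 h2 k1 k2.
have J0' : jac2 b0 b1 q != 0 by rewrite JE.
have X := grad_xxE bq0 bq1 oq J0'; have Y := grad_xxE cq0 cq1 uq J0.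
split; [exact: JE | | | apply: (etrans X); apply: (etrans _ (congr1 (+%R^~ _) (esym Y)))];
  rewrite {X Y}; move: J0 h1 h2 h3 h4 h5 h6 k1 k2 k3 k4 k5 k6 l1 l2 l3 l4 l5 l6;
  rewrite {JE J0'} /G /Gt /grad_x /grad_t /jac2; gen_derive;
  by intros; subst; field.
Qed.

Lemma derive_dir0 m (f : 'rV[R]_m -> R) a : analytic_at f a -> 'D_0 f a = 0.
Proof. by move=> fa; rewrite -(scale0r 0) derive_dirZ// mul0r. Qed.

Lemma along_shift Phi q g p s r w (f := jetpoly q g p s) k :
  analytic_map_at Phi (row_mx q g) ->
  [/\ dt (along Phi (f r w) k) q = 'D_(tangent 0 p) (fun y => Phi y 0 k) (row_mx q g),
      dx (along Phi (f r w) k) q = 'D_(tangent 1 s) (fun y => Phi y 0 k) (row_mx q g)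
    & shift2 (along Phi (f r w) k) (along Phi (f 0 0) k) q
      ('D_(vertical r) (fun y => Phi y 0 k) (row_mx q g))
      ('D_(vertical w) (fun y => Phi y 0 k) (row_mx q g))].
Proof.
have key r' w' : analytic_map_at Phi (row_mx q g) ->
  has_jet2 (along Phi (f r' w') k) q
    ('D_(tangent 0 p) (fun y => Phi y 0 k) (row_mx q g))
    ('D_(tangent 1 s) (fun y => Phi y 0 k) (row_mx q g))
    ('D_(tangent 0 p) ('D_(tangent 0 p) (fun y => Phi y 0 k)) (row_mx q g)
        + 'D_(vertical r') (fun y => Phi y 0 k) (row_mx q g))
    ('D_(tangent 1 s) ('D_(tangent 0 p) (fun y => Phi y 0 k)) (row_mx q g))
    ('D_(tangent 0 p) ('D_(tangent 1 s) (fun y => Phi y 0 k)) (row_mx q g))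
    ('D_(tangent 1 s) ('D_(tangent 1 s) (fun y => Phi y 0 k)) (row_mx q g)
        + 'D_(vertical w') (fun y => Phi y 0 k) (row_mx q g)).
  have := jetpolyP q g p s r' w'; rewrite -/(f r' w') /=.
  move: (f r' w') => h [[ha hg h0 h1] [h00 h11 h01 h10]] Pg.
  have Pg' : analytic_map_at Phi (graph h q) by rewrite /graph hg.
  have gE : graph h q = row_mx q g by rewrite /graph hg.
  have D i : 'D_('e_i) (along Phi h k) q = _ := along_D k i ha Pg'.
  have DD i j : 'D_('e_j) ('D_('e_i) (along Phi h k)) q = _ := along_DD k i j ha Pg'.
  have v0 : 'D_(vertical 0) (fun y => Phi y 0 k) (row_mx q g) = 0.
    by rewrite vertical0 derive_dir0//; exact: Pg.
  split; split.
  - exact: along_an.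
  - by rewrite [LHS](D 0) h0 gE.
  - by rewrite [LHS](D 1) h1 gE.
  - by rewrite [LHS](DD 0 0) h00 h0 gE.
  - by rewrite [LHS](DD 0 1) h01 h0 h1 gE v0 addr0.
  - by rewrite [LHS](DD 1 0) h10 h0 h1 gE v0 addr0.
  - by rewrite [LHS](DD 1 1) h11 h1 gE.
move=> Pg; have K := key r w Pg; have K0 := key 0 0 Pg.
have [[_ a2 a3] _] := K; split; [exact: a2 | exact: a3 |].
apply: (has_jet2_shift K K0); rewrite vertical0; apply: derive_dir0; exact: Pg.
Qed.

(** On the two tangents of a graph, with phi and psi the base components of the transformation, this
    is the Jacobian of the transformed base; it is nonzero when the image is again locally a
    graph. *)
Definition wedge (phi psi : 'rV[R]_(2 + n) -> R) y u v : R :=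
  'D_u phi y * 'D_v psi y - 'D_u psi y * 'D_v phi y.

(* Changing f_tt, resp. f_xx, by v changes phi_xx by (D_x T)^2 M v / J^2, resp.
   (D_t T)^2 M v / J^2.  The system does not see f_tt but does see f_xx. *)
Lemma maps_at_Tx Phi y th th' p s (a := 'e_0 : 'rV[R]_2) : (0 < n)%N ->
  evolution -> analytic_map_at Phi y -> maps_at Phi y th th' ->
  cA th (lsubmx y) != 0 -> cA th' (lsubmx (Phi y)) != 0 ->
  wedge (fun y => Phi y 0 i0) (fun y => Phi y 0 i1) y (tangent 0 p) (tangent 1 s) != 0 ->
  'D_(tangent 1 s) (fun y => Phi y 0 i0) y = 0.
Proof.
move=> n0 EH Py /(maps_atE th th' EH Py) M A0 A'0 W0.
set q := lsubmx y in M A0; set g := rsubmx y in M.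
have yE : row_mx q g = y by rewrite hsubmxK.
(* The value of f_xx that the source system forces for f_t = p and f_x = s. *)
pose w0 : 'rV[R]_n := \row_k ((p 0 k - H th q g s k) / cA th q).
pose f r w := jetpoly q g p s r w.
pose c k v : R := 'D_(vertical v) (fun y => Phi y 0 k) y.
pose b0t := 'D_(tangent 0 p) (fun y => Phi y 0 i0) y.
pose b0x := 'D_(tangent 1 s) (fun y => Phi y 0 i0) y.
pose J := wedge (fun y => Phi y 0 i0) (fun y => Phi y 0 i1) y (tangent 0 p) (tangent 1 s).
pose o r w k := along Phi (f r w) (rshift 2 k).
pose b r w := along Phi (f r w) i0.
pose b' r w := along Phi (f r w) i1.
pose G k := grad_x (b 0 0) (b' 0 0) (o 0 0 k) q.
pose Gt k := grad_t (b 0 0) (b' 0 0) (o 0 0 k) q.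
pose Gx k := grad_x (b 0 0) (b' 0 0) (grad_x (b 0 0) (b' 0 0) (o 0 0 k)) q.
pose m k v := c (rshift 2 k) v - G k * c i1 v - Gt k * c i0 v.
have sh r w k : [/\ dt (along Phi (f r w) k) q = 'D_(tangent 0 p) (fun y => Phi y 0 k) y,
      dx (along Phi (f r w) k) q = 'D_(tangent 1 s) (fun y => Phi y 0 k) y
    & shift2 (along Phi (f r w) k) (along Phi (f 0 0) k) q (c k r) (c k w)].
  by rewrite /c -yE; apply: along_shift; rewrite yE.
have J00 : jac2 (b 0 0) (b' 0 0) q = J.
  have [h1 h2 _] := sh 0 0 i0; have [h3 h4 _] := sh 0 0 i1.
  by rewrite /jac2 /b /b' h1 h2 h3 h4.
have JE r w k : [/\ jac2 (b r w) (b' r w) q = J, grad_x (b r w) (b' r w) (o r w k) q = G k,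
    grad_t (b r w) (b' r w) (o r w k) q = Gt k &
    grad_x (b r w) (b' r w) (grad_x (b r w) (b' r w) (o r w k)) q = Gx k
      + (b0t ^+ 2 * m k w + b0x ^+ 2 * m k r) / J ^+ 2].
  have [_ _ h0] := sh r w i0; have [_ _ h1] := sh r w i1; have [_ _ h2] := sh r w (rshift 2 k).
  have Jn : jac2 (b 0 0) (b' 0 0) q != 0 by rewrite J00.
  have [e1 e2 e3 e4] := grad_xx_shift h0 h1 h2 Jn.
  have [k1 k2 _] := sh 0 0 i0.
  split; [by rewrite [LHS]e1 | exact: e2 | exact: e3 |].
  by rewrite [LHS]e4 J00 k1 k2.
have c0 k : c k 0 = 0 by rewrite /c vertical0 derive_dir0//; exact: Py.
have Ef r w : (forall k, dvec 0 (f r w) q 0 k = cA th q * dvec 1 (dvec 1 (f r w)) q 0 k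
        + H th q g (dvec 1 (f r w) q) k) <-> w = w0.
  have [[_ _ h0 h1] [_ h2 _ _]] := jetpolyP q g p s r w.
  rewrite /f h0 h1 h2; split=> [h|-> k].
    by apply/rowP => k; rewrite mxE h addrK mulrAC mulfV ?mul1r.
  by rewrite mxE mulrCA mulfV ?mulr1 ?subrK.
have Mf r w : w = w0 <-> forall k, Gt k = cA th' (lsubmx (Phi y)) *
    (Gx k + (b0t ^+ 2 * m k w + b0x ^+ 2 * m k r) / J ^+ 2) +
   H th' (lsubmx (Phi y)) (rsubmx (Phi y)) (\row_k G k) k.
  apply: iff_trans (iff_sym (Ef r w)) _.
  have [[fan fq _ _] _] := jetpolyP q g p s r w.
  have [J1 _ _ _] := JE r w (Ordinal n0).
  have Jn : jac2 (b r w) (b' r w) q != 0 by rewrite J1; exact: W0.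
  apply: iff_trans (M (f r w) fan fq Jn) _.
  have -> : \row_k0 grad_x (b r w) (b' r w) (o r w k0) q = \row_k G k.
    by apply/rowP => k; rewrite [LHS]mxE [RHS]mxE; have [_ h _ _] := JE r w k; exact: h.
  split => hk k; have := hk k; have [_ _ e1 e2] := JE r w k.
    by move=> /(etrans (esym e1)) ->; rewrite e2.
  by move=> hkk; apply: etrans e1 _; rewrite hkk -e2.
pose v : 'rV[R]_n := const_mx 1.
have mD k u u' : m k (u + u') = m k u + m k u'.
  have cD l : c l (u + u') = c l u + c l u'.
    by rewrite /c verticalD derive_dirD//; exact: Py.
  have alg (x1 x2 y1 y2 z1 z2 g1 g2 : R) : x1 + x2 - g1 * (y1 + y2) - g2 * (z1 + z2) =
      (x1 - g1 * y1 - g2 * z1) + (x2 - g1 * y2 - g2 * z2) by ring.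
  by rewrite /m !cD; exact: alg.
suff : b0x = 0 by [].
have Jn : J != 0 by exact: W0.
move: Mf mD; clear JE J00 sh; clearbody m Gx Gt G J b0t b0x => Mf mD.
have v0 : v != 0.
  by apply/eqP => /rowP/(_ (Ordinal n0)); rewrite !mxE => /eqP; rewrite oner_eq0.
(* If [m] killed v, raising f_xx from w0 to w0 + v would preserve the target system, although w0 is
   the only solution of the source. *)
have mv : exists k, m k v != 0.
  apply: contrapT => hv.
  have {}hv k : m k v = 0 by apply: contrapT => /eqP hk; apply: hv; exists k.
  have h0 := (Mf 0 w0).1 erefl.
  have h1 : w0 + v = w0 by apply/(Mf 0) => k; rewrite mD hv addr0.
  by move/eqP: h1; rewrite -subr_eq0 addrAC subrr add0r (negPf v0).
have [k mk] := mv.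
(* Two solutions that differ only in f_tt, equal to 0 and to v: the target can accept both only if
   the weight [b0x] vanishes. *)
have h0 := (Mf 0 w0).1 erefl k.
have := (Mf v w0).1 erefl k; rewrite {1}h0 => /addIr/(mulfI A'0)/addrI.
have m0 : m k 0 = 0.
  have /eqP := mD k 0 0; rewrite addr0 -subr_eq0 opprD addrA subrr sub0r oppr_eq0.
  by move/eqP.
rewrite m0 mulr0 addr0 => /(congr1 ( *%R^~ (J ^+ 2))).
rewrite !divfK ?expf_neq0// => /eqP.
rewrite eq_sym addrC -subr_eq0 addrK mulf_eq0 (negPf mk) orbF.
by rewrite expf_eq0 /= => /eqP.
Qed.

End Evolution.

(** * The new time variable depends on t alone *)

Section Steps.
Variable R : realType.
Variable n : nat.
Variable E : system_class R n.
Variable H : coefs R -> 'rV[R]_2 -> 'rV[R]_n -> 'rV[R]_n -> 'I_n -> R.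

Implicit Types (Phi : 'rV[R]_(2 + n) -> 'rV[R]_(2 + n)) (y z : 'rV[R]_(2 + n)).

Local Notation i0 := (lshift n (0 : 'I_2)).
Local Notation i1 := (lshift n (1 : 'I_2)).

(** The vector is the image of ['e_i] under the derivative of the inverse; the chain rule for Phi o
    Psi = id gives the duality. *)
Lemma point_transformation_dual Phi z (i : 'I_(2 + n)) : point_transformation Phi z ->
  exists u, forall k, 'D_u (fun y => Phi y 0 k) z = (k == i)%:R.
Proof.
move=> [Pz [Psi Pa [gz gPz]]].
have PzE : Psi (Phi z) = z by exact: (nbhs_singleton gz).
exists (\row_l 'D_('e_i) (fun w => Psi w 0 l) (Phi z)) => k.
have h : 'D_('e_i) (fun w => Phi (Psi w) 0 k) (Phi z) = (k == i)%:R.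
  rewrite (@derive_eq _ _ _ (fun w => w 0 k)) ?derive_coord ?mxE//=.
  by apply: filterS gPz => w /= ->.
rewrite -h (derive_chain (f := fun y => Phi y 0 k))//; last by rewrite PzE; apply: Pz.
rewrite PzE derive_partial; last exact/analytic_diff/Pz.
by apply: eq_bigr => l _; rewrite mxE.
Qed.

(** The hypothesis concerns pairs of vectors with horizontal parts e_0 and e_1 only. Instances with
    one or both fibre parts set to [o] isolate the products in the expansion for arbitrary
    horizontal parts, and each is zero. *)
Lemma wedge_eq0 (P : Type) (al be : P -> R) (a0 a1 b0 b1 : R) o :
  al o = 0 -> be o = 0 ->
  (forall p s, (a0 + al p) * (b1 + be s) - (b0 + be p) * (a1 + al s) = 0) ->
  forall (x0 x1 y0 y1 : R) p s,
  (x0 * a0 + x1 * a1 + al p) * (y0 * b0 + y1 * b1 + be s) -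
  (x0 * b0 + x1 * b1 + be p) * (y0 * a0 + y1 * a1 + al s) = 0.
Proof.
move=> al0 be0 K x0 x1 y0 y1 p s.
move: (K o o) (K p o) (K s o) (K o p) (K o s) (K p s); rewrite al0 be0 !addr0.
move: {K} (al p) (al s) (be p) (be s) => ap as_ bp bs W01 ep0 es0 e0p e0s eps.
have Wp1 : ap * b1 - bp * a1 = 0.
  by transitivity ((a0 + ap) * b1 - (b0 + bp) * a1 - (a0 * b1 - b0 * a1));
    [ring | rewrite ep0 W01 subr0].
have Ws1 : as_ * b1 - bs * a1 = 0.
  by transitivity ((a0 + as_) * b1 - (b0 + bs) * a1 - (a0 * b1 - b0 * a1));
    [ring | rewrite es0 W01 subr0].
have W0p : a0 * bp - b0 * ap = 0.
  by transitivity (a0 * (b1 + bp) - b0 * (a1 + ap) - (a0 * b1 - b0 * a1));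
    [ring | rewrite e0p W01 subr0].
have W0s : a0 * bs - b0 * as_ = 0.
  by transitivity (a0 * (b1 + bs) - b0 * (a1 + as_) - (a0 * b1 - b0 * a1));
    [ring | rewrite e0s W01 subr0].
have Wps : ap * bs - bp * as_ = 0.
  transitivity ((a0 + ap) * (b1 + bs) - (b0 + bp) * (a1 + as_)
    - (a0 * b1 - b0 * a1) - (ap * b1 - bp * a1) - (a0 * bs - b0 * as_)); first by ring.
  by rewrite eps W01 Wp1 W0s !subr0.
transitivity (x0 * y1 * (a0 * b1 - b0 * a1) - x1 * y0 * (a0 * b1 - b0 * a1)
  + x0 * (a0 * bs - b0 * as_) - x1 * (as_ * b1 - bs * a1)
  - y0 * (a0 * bp - b0 * ap) + y1 * (ap * b1 - bp * a1)
  + (ap * bs - bp * as_)); first by ring.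
by rewrite W01 Wp1 Ws1 W0p W0s Wps; ring.
Qed.

(** If all these Jacobians vanished, the differentials of the two base components would be dependent
    on all pairs of vectors, against the vectors dual to them. *)
Lemma wedge_neq0 Phi z : point_transformation Phi z ->
  exists p s, wedge (fun y => Phi y 0 i0) (fun y => Phi y 0 i1) z
    (tangent 0 p) (tangent 1 s) != 0.
Proof.
move=> Pz; apply: contrapT => h0.
have [u0 hu0] := point_transformation_dual i0 Pz.
have [u1 hu1] := point_transformation_dual i1 Pz.
have [Pa _] := Pz.
pose a := fun y => Phi y 0 i0; pose b := fun y => Phi y 0 i1.
have aa : analytic_at a z by exact: Pa.
have ba : analytic_at b z by exact: Pa.
have h p s : wedge a b z (tangent 0 p) (tangent 1 s) = 0.
  by apply: contrapT => /eqP hps; apply: h0; exists p, s.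
have dec (f : 'rV[R]_(2 + n) -> R) u : analytic_at f z ->
    'D_u f z = lsubmx u 0 0 * 'D_(tangent 0 0) f z + lsubmx u 0 1 * 'D_(tangent 1 0) f z
      + 'D_(vertical (rsubmx u)) f z.
  by move=> fz; rewrite {1}(row_decomp u) !derive_dirD// !derive_dirZ.
have tan (f : 'rV[R]_(2 + n) -> R) i p : analytic_at f z ->
    'D_(tangent i p) f z = 'D_(tangent i 0) f z + 'D_(vertical p) f z.
  by move=> fz; rewrite -(derive_dirD _ _ fz) -tangentD add0r.
have v0 (f : 'rV[R]_(2 + n) -> R) : analytic_at f z -> 'D_(vertical 0) f z = 0.
  by move=> fz; rewrite vertical0 derive_dir0.
pose al v := 'D_(vertical v) a z; pose be v := 'D_(vertical v) b z.
pose a0 := 'D_(tangent 0 0) a z; pose a1 := 'D_(tangent 1 0) a z.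
pose b0 := 'D_(tangent 0 0) b z; pose b1 := 'D_(tangent 1 0) b z.
have K p s : (a0 + al p) * (b1 + be s) - (b0 + be p) * (a1 + al s) = 0.
  have := h p s; rewrite /wedge.
  by rewrite (tan a 0 p aa) (tan a 1 s aa) (tan b 0 p ba) (tan b 1 s ba).
have al0 : al 0 = 0 by exact: v0.
have be0 : be 0 = 0 by exact: v0.
have W u v : 'D_u a z * 'D_v b z - 'D_u b z * 'D_v a z = 0.
  rewrite (dec a u aa) (dec a v aa) (dec b u ba) (dec b v ba).
  exact: (wedge_eq0 al0 be0 K).
have := W u0 u1; rewrite /a /b (hu0 i0) (hu0 i1) (hu1 i0) (hu1 i1) !eqxx.
by rewrite /= mulr1 mulr0 subr0 => /eqP; rewrite oner_eq0.
Qed.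

(** The vanishing of D_x T is known only for slopes with nonzero Jacobian. One such slope is
    perturbed along the fibre to obtain the vertical derivatives, after which D_x T is the same for
    all slopes. *)
Lemma maps_at_base_t Phi y th th' : (0 < n)%N -> evolution E H ->
  point_transformation Phi y -> maps_at E Phi y th th' ->
  cA th (lsubmx y) != 0 -> cA th' (lsubmx (Phi y)) != 0 ->
  [/\ forall v, 'D_(vertical v) (fun y => Phi y 0 i0) y = 0,
      'D_(tangent 1 0) (fun y => Phi y 0 i0) y = 0,
      'D_(tangent 0 0) (fun y => Phi y 0 i0) y != 0
    & exists s, 'D_(tangent 1 s) (fun y => Phi y 0 i1) y != 0].
Proof.
move=> n0 EH Pt M A0 A'0; have [Py _] := Pt.
have [p [s W0]] := wedge_neq0 Pt.
have K := maps_at_Tx n0 EH Py M A0 A'0.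
have aa : analytic_at (fun y => Phi y 0 i0) y by exact: Py.
have ba : analytic_at (fun y => Phi y 0 i1) y by exact: Py.
have V v : 'D_(vertical v) (fun y => Phi y 0 i0) y = 0.
  have Ks := K p s W0.
  have wD e : wedge (fun y => Phi y 0 i0) (fun y => Phi y 0 i1) y
      (tangent 0 p) (tangent 1 (s + e *: v)) =
    wedge (fun y => Phi y 0 i0) (fun y => Phi y 0 i1) y (tangent 0 p) (tangent 1 s) +
    e * wedge (fun y => Phi y 0 i0) (fun y => Phi y 0 i1) y (tangent 0 p) (vertical v).
    rewrite /wedge tangentD verticalZ (derive_dirD _ _ aa) (derive_dirD _ _ ba).
    by rewrite (derive_dirZ _ _ aa) (derive_dirZ _ _ ba); gen_derive; ring.
  have De e : 'D_(tangent 1 (s + e *: v)) (fun y => Phi y 0 i0) y =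
      e * 'D_(vertical v) (fun y => Phi y 0 i0) y.
    by rewrite tangentD verticalZ (derive_dirD _ _ aa) (derive_dirZ _ _ aa) Ks add0r.
  (* The Jacobian is affine in e and nonzero at e = 0, so it is nonzero at e = 1 or at e = 2. *)
  have [w1|w1] := eqVneq (wedge (fun y => Phi y 0 i0) (fun y => Phi y 0 i1) y
      (tangent 0 p) (tangent 1 (s + 1 *: v))) 0.
    have := K p (s + 2 *: v); rewrite wD De.
    move: w1; rewrite wD mul1r; move: W0.
    move: (wedge _ _ _ _ _) (wedge _ _ _ _ _) => w1 w0 w00 w01 KK.
    have w2 : w0 + 2 * w1 != 0.
      have -> : w0 + 2 * w1 = - w0 + 2 * (w0 + w1) by ring.
      by rewrite w01 mulr0 addr0 oppr_eq0.
    have /eqP := KK w2; rewrite mulf_eq0 pnatr_eq0 /=; exact: eqP.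
  by have := K p (s + 1 *: v) w1; rewrite De mul1r.
have T1 s' : 'D_(tangent 1 s') (fun y => Phi y 0 i0) y = 0.
  have -> : s' = s + (s' - s) by rewrite addrC subrK.
  by rewrite tangentD (derive_dirD _ _ aa) V addr0; exact: K W0.
move: W0; rewrite /wedge T1 mulr0 subr0 mulf_eq0 negb_or => /andP[t0 x0].
split; [exact: V | exact: T1 | | by exists s].
apply: contraNN t0 => /eqP t0; rewrite -[p]add0r tangentD (derive_dirD _ _ aa) V addr0 t0.
exact: eqxx.
Qed.

End Steps.

(** * Transformations with time component T(t) *)

Section Reduced.
Variable R : realType.
Variable n : nat.
Variable E : system_class R n.
Variable H : coefs R -> 'rV[R]_2 -> 'rV[R]_n -> 'rV[R]_n -> 'I_n -> R.

Implicit Types (Phi : 'rV[R]_(2 + n) -> 'rV[R]_(2 + n)).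

Local Notation i0 := (lshift n (0 : 'I_2)).
Local Notation i1 := (lshift n (1 : 'I_2)).

Lemma grad_time (T : R -> R) (b0 b1 o : 'rV[R]_2 -> R) (q : 'rV[R]_2) :
  (\forall q' \near q, b0 q' = T (q' 0 0)) -> analytic_at b0 q ->
  analytic_at b1 q -> analytic_at o q -> dt b0 q != 0 -> dx b1 q != 0 ->
  let G := dx o q / dx b1 q in
  [/\ grad_t b0 b1 o q = (dt o q - dt b1 q * G) / dt b0 q, grad_x b0 b1 o q = G
    & grad_x b0 b1 (grad_x b0 b1 o) q = (dx (dx o) q - G * dx (dx b1) q) / dx b1 q ^+ 2].
Proof.
move=> b0T b0q b1q oq t0 x0 G.
have bx : \forall q' \near q, dx b0 q' = 0.
  have := near_join b0T; apply: filterS => q' h.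
  by rewrite /dx (derive_eq _ h) derive_coord1.
have gx (u : 'rV[R]_2 -> R) q' : dx b0 q' = 0 -> dt b0 q' != 0 -> dx b1 q' != 0 ->
    grad_x b0 b1 u q' = dx u q' / dx b1 q'.
  rewrite /grad_x /jac2 => ->; gen_derive => h1 h2; field.
  by rewrite h2 h1.
have bq : dx b0 q = 0 by exact: nbhs_singleton bx.
have near_gx : \forall q' \near q, grad_x b0 b1 o q' = dx o q' / dx b1 q'.
  have h1 : \forall q' \near q, dt b0 q' != 0.
    exact: (cvgr_neq0 _ (analytic_cont (analytic_derive 'e_0 b0q)) t0).
  have h2 : \forall q' \near q, dx b1 q' != 0.
    exact: (cvgr_neq0 _ (analytic_cont (analytic_derive 'e_1 b1q)) x0).
  near=> q'; apply: gx; first by near: q'.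
    by near: q'.
  by near: q'.
split; [| exact: gx |].
  rewrite /grad_t /jac2 bq /G; move: t0 x0; gen_derive => h1 h2; field.
  by rewrite h2 h1.
rewrite (gx _ q bq t0 x0).
have d1 : isD 'e_1 (dx o) q (dx (dx o) q) := isD_of 'e_1 (analytic_derive 'e_1 oq).
have d2 : isD 'e_1 (dx b1) q (dx (dx b1) q) := isD_of 'e_1 (analytic_derive 'e_1 b1q).
have [_ D] := isD_mul d1 (isD_inv x0 d2).
have -> : dx (grad_x b0 b1 o) q = 'D_('e_1) (fun q => dx o q / dx b1 q) q.
  exact: derive_eq near_gx.
rewrite D /G; move: x0; gen_derive => h; by field.
Unshelve. all: by end_near. Qed.

Section AtPoint.
Variables (Phi : 'rV[R]_(2 + n) -> 'rV[R]_(2 + n)) (y : 'rV[R]_(2 + n)) (T : R -> R).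
Hypothesis Py : analytic_map_at Phi y.
Hypothesis PT : \forall y' \near y, Phi y' 0 i0 = T (y' 0 i0).
Let q := lsubmx y.
Let g := rsubmx y.
Let ph k := fun y : 'rV[R]_(2 + n) => Phi y 0 k.
Let phy k : analytic_at (ph k) y. Proof. exact: Py. Qed.

Definition time_deriv (k : 'I_(2 + n)) p := 'D_(tangent 0 p) (ph k) y.
Definition space_deriv (k : 'I_(2 + n)) s := 'D_(tangent 1 s) (ph k) y.
Definition fibre_deriv (k : 'I_(2 + n)) v := 'D_(vertical v) (ph k) y.
Definition space_deriv2 (k : 'I_(2 + n)) s w :=
  'D_(tangent 1 s) ('D_(tangent 1 s) (ph k)) y + fibre_deriv k w.
Definition slope s (k : 'I_n) := space_deriv (rshift 2 k) s / space_deriv i1 s.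

Let Tt0 := T^`()%classic (q 0 0).

Let base_along f : analytic_map_at f q -> f q = g ->
  \forall q' \near q, along Phi f i0 q' = T (q' 0 0).
Proof.
move=> fa fg; have gy : graph f q = y by rewrite /graph fg hsubmxK.
have gc : {for q, continuous (graph f)} by apply/analytic_map_cont/analytic_graph.
have h : \forall y' \near graph f q, Phi y' 0 i0 = T (y' 0 i0) by rewrite gy.
suff : \forall q' \near q, Phi (graph f q') 0 i0 = T (graph f q' 0 i0).
  by apply: filterS => q'; rewrite /along /graph row_mxEl.
exact: (gc _ h).
Qed.

Lemma time_deriv0 p : time_deriv i0 p = Tt0.
Proof.
rewrite /time_deriv; have [[fa fg f0 f1] _] := jetpolyP q g p 0 0 0.
set f := jetpoly _ _ _ _ _ _ in fa fg f0 f1.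
have gy : graph f q = y by rewrite /graph fg hsubmxK.
have Pg : analytic_map_at Phi (graph f q) by rewrite gy.
have := along_D i0 0 fa Pg; rewrite f0 gy => <-.
rewrite /Tt0 -(derive_coord0 T q); apply: derive_eq.
exact: (base_along fa fg).
Qed.

(** With new time T(t) the new x-derivative is D_x divided by its value on the new x. Neither f_tt
    nor f_tx enters, and a graph counts only through p = f_t, s = f_x and w = f_xx. *)
Lemma maps_at_time th th' : evolution E H -> Tt0 != 0 ->
  maps_at E Phi y th th' <->
  forall p s w : 'rV[R]_n, space_deriv i1 s != 0 ->
  ((forall k, p 0 k = cA th q * w 0 k + H th q g s k) <->
   (forall k, (time_deriv (rshift 2 k) p - time_deriv i1 p * slope s k) / Tt0 =
     cA th' (lsubmx (Phi y)) *
       ((space_deriv2 (rshift 2 k) s w - slope s k * space_deriv2 i1 s w)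
         / space_deriv i1 s ^+ 2)
     + H th' (lsubmx (Phi y)) (rsubmx (Phi y)) (\row_k slope s k) k)).
Proof.
move=> EH T0.
have key f : analytic_map_at f q -> f q = g ->
    let p := dvec 0 f q in let s := dvec 1 f q in let w := dvec 1 (dvec 1 f) q in
    let b0 := along Phi f i0 in let b1 := along Phi f i1 in
    let o k := along Phi f (rshift 2 k) in
    (jac2 b0 b1 q != 0) = (space_deriv i1 s != 0) /\
    (space_deriv i1 s != 0 -> forall k,
      [/\ grad_t b0 b1 (o k) q = (time_deriv (rshift 2 k) p - time_deriv i1 p * slope s k) / Tt0,
         grad_x b0 b1 (o k) q = slope s k &
         grad_x b0 b1 (grad_x b0 b1 (o k)) q =
          (space_deriv2 (rshift 2 k) s w - slope s k * space_deriv2 i1 s w)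
         / space_deriv i1 s ^+ 2]).
  move=> fa fg p s w b0 b1 o.
  have gy : graph f q = y by rewrite /graph fg hsubmxK.
  have Pg : analytic_map_at Phi (graph f q) by rewrite gy.
  have an k : analytic_at (along Phi f k) q by exact: along_an.
  have D0 k : dt (along Phi f k) q = time_deriv k p.
    by rewrite [LHS](along_D k 0 fa Pg) gy.
  have D1 k : dx (along Phi f k) q = space_deriv k s.
    by rewrite [LHS](along_D k 1 fa Pg) gy.
  have D11 k : dx (dx (along Phi f k)) q = space_deriv2 k s w.
    by rewrite [LHS](along_DD k 1 1 fa Pg) gy.
  have b0T : \forall q' \near q, b0 q' = T (q' 0 0).
    exact: (base_along fa fg).
  have bx : dx b0 q = 0 by rewrite /dx (derive_eq _ b0T) derive_coord1.
  have bt : dt b0 q = Tt0 by rewrite /b0 D0 time_deriv0.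
  have bt0 : dt b0 q != 0 by rewrite bt.
  split.
    by rewrite /jac2 bx mulr0 subr0 bt /b1 D1 mulf_eq0 (negPf T0).
  move=> X0 k; have b1x : dx b1 q != 0 by rewrite /b1 D1.
  have [h1 h2 h3] := grad_time b0T (an i0) (an i1) (an (rshift 2 k)) bt0 b1x.
  split; [apply: etrans h1 _; rewrite /b1 !D1 !D0 time_deriv0//
    | apply: etrans h2 _; rewrite /b1 !D1// | apply: etrans h3 _; rewrite /b1 !D11 !D1//].
apply: iff_trans (maps_atE th th' EH Py) _; split=> M.
  move=> p s w X0; have [[fa fg f0 f1] [_ f11 _ _]] := jetpolyP q g p s 0 w.
  set f := jetpoly _ _ _ _ _ _ in fa fg f0 f1 f11.
  have := key f fa fg; rewrite f0 f1 f11 => /= -[J0 /(_ X0) K].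
  rewrite X0 in J0; have := M f fa fg J0; rewrite f0 f1 f11 => h.
  apply: iff_trans h _.
  have -> : \row_k grad_x (along Phi f i0) (along Phi f i1) (along Phi f (rshift 2 k)) q =
      \row_k slope s k.
    by apply/rowP => k; rewrite [LHS]mxE [RHS]mxE; have [_ h _] := K k; exact: h.
  split => hk k; have := hk k; have [e1 _ e2] := K k.
    by move=> /(etrans (esym e1)) ->; rewrite e2.
  by move=> hkk; apply: etrans e1 _; rewrite hkk -e2.
move=> f q0 fa fg b0 b1 o Jn.
have [J0 K] := key f fa fg.
have X0 : space_deriv i1 (dvec 1 f q) != 0 by rewrite -J0.
apply: iff_trans (M _ _ _ X0) _.
have -> : \row_k grad_x (along Phi f i0) (along Phi f i1) (along Phi f (rshift 2 k)) q =
    \row_k slope (dvec 1 f q) k.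
  by apply/rowP => k; rewrite [LHS]mxE [RHS]mxE; have [_ h _] := K X0 k; exact: h.
split => hk k; have := hk k; have [e1 _ e2] := K X0 k.
  by move=> hkk; apply: etrans e1 _; rewrite hkk -e2.
by move=> /(etrans (esym e1)) ->; rewrite e2.
Qed.

Lemma time_derivD k p v : time_deriv k (p + v) = time_deriv k p + fibre_deriv k v.
Proof. by rewrite /time_deriv tangentD (derive_dirD _ _ (phy k)). Qed.

Lemma space_derivD k p v : space_deriv k (p + v) = space_deriv k p + fibre_deriv k v.
Proof. by rewrite /space_deriv tangentD (derive_dirD _ _ (phy k)). Qed.

Lemma fibre_derivD k p v : fibre_deriv k (p + v) = fibre_deriv k p + fibre_deriv k v.
Proof. by rewrite /fibre_deriv verticalD (derive_dirD _ _ (phy k)). Qed.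

Lemma fibre_derivZ k c v : fibre_deriv k (c *: v) = c * fibre_deriv k v.
Proof. by rewrite /fibre_deriv verticalZ (derive_dirZ _ _ (phy k)). Qed.

Lemma fibre_deriv_0 k : fibre_deriv k 0 = 0.
Proof. by rewrite /fibre_deriv vertical0 (derive_dir0 (phy k)). Qed.

(** The jets (P, 0) and (P + A v, v) both solve the source. Subtracting the target equations leaves
    m(v) (A / T_t - A' / X_x^2) = 0, so it remains to find a component with m(v) nonzero. *)
Lemma maps_at_A th th' s : (0 < n)%N -> evolution E H -> Tt0 != 0 ->
  maps_at E Phi y th th' -> cA th q != 0 -> space_deriv i1 s != 0 ->
  cA th q * space_deriv i1 s ^+ 2 = cA th' (lsubmx (Phi y)) * Tt0.
Proof.
move=> n0 EH T0 /(maps_at_time th th' EH T0) M A0 X0.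
pose P : 'rV[R]_n := \row_k H th q g s k.
pose v : 'rV[R]_n := const_mx 1.
pose A' := cA th' (lsubmx (Phi y)).
pose K k := H th' (lsubmx (Phi y)) (rsubmx (Phi y)) (\row_k slope s k) k.
pose m k u := fibre_deriv (rshift 2 k) u - slope s k * fibre_deriv i1 u.
pose L k p w := (time_deriv (rshift 2 k) p - time_deriv i1 p * slope s k) / Tt0 -
  A' * ((space_deriv2 (rshift 2 k) s w - slope s k * space_deriv2 i1 s w)
         / space_deriv i1 s ^+ 2).
have LD k p w u u' : L k (p + u) (w + u') = L k p w + m k u / Tt0 -
    A' * (m k u' / space_deriv i1 s ^+ 2).
  rewrite /L /m !time_derivD /space_deriv2 !fibre_derivD.
  have alg (ot bt fo fb So Sb wo wb uo ub G it ix A1 : R) :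
    (ot + fo - (bt + fb) * G) * it - A1 * ((So + (wo + uo) - G * (Sb + (wb + ub))) * ix) =
    (ot - bt * G) * it - A1 * ((So + wo - G * (Sb + wb)) * ix) +
      (fo - G * fb) * it - A1 * ((uo - G * ub) * ix) by ring.
  exact: alg.
have M' (p w : 'rV[R]_n) : (forall k, p 0 k = cA th q * w 0 k + H th q g s k) <->
    (forall k, L k p w = K k).
  apply: iff_trans (M p s w X0) _; split=> h k; have := h k; rewrite /L /K /A'.
    by move=> ->; rewrite addrAC subrr add0r.
  by move=> <-; rewrite [RHS]addrC subrK.
have e1 : forall k, L k P 0 = K k by apply/M' => k; rewrite !mxE mulr0 add0r.
have e2 : forall k, L k (P + cA th q *: v) (0 + v) = K k.
  by apply/M' => k; rewrite !mxE add0r addrC.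
have mZ k c u : m k (c *: u) = c * m k u.
  by rewrite /m !fibre_derivZ mulrBr mulrCA.
have m0 k : m k 0 = 0 by rewrite /m !fibre_deriv_0 mulr0 subr0.
(* Otherwise raising f_xx alone by v would preserve the target system but, as A is nonzero, not the
   source system. *)
have [k mk] : exists k, m k v != 0.
  apply: contrapT => hv.
  have {}hv k : m k v = 0 by apply: contrapT => /eqP hk; apply: hv; exists k.
  have /M' h : forall k, L k (P + 0) (0 + v) = K k.
    by move=> k; rewrite LD hv m0 !mul0r mulr0 subr0 addr0.
  have := h (Ordinal n0); rewrite !mxE addr0 add0r mulr1 => /eqP.
  by rewrite -[X in X == _]add0r (inj_eq (addIr _)) eq_sym (negPf A0).
have := e2 k; rewrite LD e1 mZ => /eqP.
rewrite -[X in _ == X]addr0 -addrA (inj_eq (addrI _)) subr_eq0 => /eqP h.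
have X20 : space_deriv i1 s ^+ 2 != 0 by rewrite expf_neq0.
apply: (mulIf mk); apply: (mulIf (invr_neq0 T0)); apply: (mulIf (invr_neq0 X20)).
have alg (u x t a A1 : R) : a * u / t = A1 * (u / x) -> x != 0 -> t != 0 ->
    a * x * u / t / x = A1 * t * u / t / x.
  move=> hu x0 t0; transitivity (a * u / t); first by field; rewrite x0 t0.
  by rewrite hu; field; rewrite x0 t0.
exact: alg h X20 T0.
Qed.

(** If X depended on the unknowns, D_x X would be affine in s and take both values 1 and 2, while A
    (D_x X)^2 = A' T_t with the right side independent of s. *)
Lemma maps_at_base_x th th' : (0 < n)%N -> evolution E H -> Tt0 != 0 ->
  maps_at E Phi y th th' -> cA th q != 0 -> forall v, fibre_deriv i1 v = 0.
Proof.
move=> n0 EH T0 M A0 v; apply/eqP; apply: contrapT => /negP c0.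
have S l : l != 0 -> exists s, space_deriv i1 s = l.
  move=> l0; exists (0 + ((l - space_deriv i1 0) / fibre_deriv i1 v) *: v).
  by rewrite space_derivD fibre_derivZ divfK// addrC subrK.
have [s1 h1] := S 1 (oner_neq0 _); have [s2 h2] := S 2 (ltac:(by rewrite pnatr_eq0)).
have := @maps_at_A th th' s1 n0 EH T0 M A0; rewrite h1 oner_eq0 => /(_ isT).
have := @maps_at_A th th' s2 n0 EH T0 M A0; rewrite h2 pnatr_eq0 => /(_ isT) <-.
move=> /eqP; rewrite -subr_eq0 -mulrBr mulf_eq0 (negPf A0) /=.
by apply/negP; lra.
Qed.

End AtPoint.
End Reduced.

(** * The master identity *)

Section Master.
Variable R : realType.
Variable n : nat.
Variable E : system_class R n.
Variable H : coefs R -> 'rV[R]_2 -> 'rV[R]_n -> 'rV[R]_n -> 'I_n -> R.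

Local Notation i0 := (lshift n (0 : 'I_2)).
Local Notation i1 := (lshift n (1 : 'I_2)).

Variables (Phi : 'rV[R]_(2 + n) -> 'rV[R]_(2 + n)) (y : 'rV[R]_(2 + n)) (T : R -> R).
Variable X : 'rV[R]_2 -> R.
Hypothesis Py : analytic_map_at Phi y.
Hypothesis PT : \forall y' \near y, Phi y' 0 i0 = T (y' 0 i0).
Hypothesis PX : \forall y' \near y, Phi y' 0 i1 = X (lsubmx y').
Let q := lsubmx y.
Let g := rsubmx y.
Let Tt0 := T^`()%classic (q 0 0).

Lemma base_x_derivs p s w : [/\ time_deriv Phi y i1 p = dt X q,
  space_deriv Phi y i1 s = dx X q & space_deriv2 Phi y i1 s w = dx (dx X) q].
Proof.
have [[fa fg f0 f1] [_ f11 _ _]] := jetpolyP q g p s 0 w.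
set f := jetpoly _ _ _ _ _ _ in fa fg f0 f1 f11.
have gy : graph f q = y by rewrite /graph fg hsubmxK.
have Pg : analytic_map_at Phi (graph f q) by rewrite gy.
have bX : \forall q' \near q, along Phi f i1 q' = X q'.
  have gc : {for q, continuous (graph f)} by apply/analytic_map_cont/analytic_graph.
  have h : \forall y' \near graph f q, Phi y' 0 i1 = X (lsubmx y') by rewrite gy.
  suff : \forall q' \near q, Phi (graph f q') 0 i1 = X (lsubmx (graph f q')).
    by apply: filterS => q'; rewrite /along /graph row_mxKl.
  exact: (gc _ h).
have bXx : \forall q' \near q, dx (along Phi f i1) q' = dx X q'.
  by have := near_join bX; apply: filterS => q' h; exact: derive_eq.
have := along_D i1 0 fa Pg; rewrite f0 gy => e0.
have := along_D i1 1 fa Pg; rewrite f1 gy => e1.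
have := along_DD i1 1 1 fa Pg; rewrite f1 f11 gy => e2.
split.
- by apply: etrans (esym e0) _; exact: derive_eq.
- by apply: etrans (esym e1) _; exact: derive_eq.
- by apply: etrans (esym e2) _; exact: derive_eq.
Qed.

(* T_t times the transformed equation, for a solution with f_x = s: f_t is
   eliminated by the source equation, and f_xx drops out by A' T_t = A X_x^2. *)
Definition master th th' s k :=
  let G := \row_k (space_deriv Phi y (rshift 2 k) s / dx X q) in
  time_deriv Phi y (rshift 2 k) (\row_k H th q g s k) - dt X q * G 0 k =
  cA th q * (space_deriv2 Phi y (rshift 2 k) s 0 - G 0 k * dx (dx X) q)
  + Tt0 * H th' (lsubmx (Phi y)) (rsubmx (Phi y)) G k.

(** Forwards, the identity is the target system at the solution jet with f_xx = 0. Backwards, f_xx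
    cancels by the relation between A and A', and the target system says that the fibre derivative
    annihilates the defect of the source system; injectivity then makes the defect zero. *)
Lemma maps_at_master th th' : (0 < n)%N -> evolution E H -> Tt0 != 0 -> dx X q != 0 ->
  cA th q != 0 ->
  (maps_at E Phi y th th' ->
    cA th q * dx X q ^+ 2 = cA th' (lsubmx (Phi y)) * Tt0 /\
    forall s k, master th th' s k) /\
  ((forall v, (forall k, fibre_deriv Phi y (rshift 2 k) v = 0) -> v = 0) ->
    cA th q * dx X q ^+ 2 = cA th' (lsubmx (Phi y)) * Tt0 ->
    (forall s k, master th th' s k) -> maps_at E Phi y th th').
Proof.
move=> n0 EH T0 X0 A0.
have slopeE s : \row_k slope Phi y s k = \row_k (space_deriv Phi y (rshift 2 k) s / dx X q).
  by apply/rowP => k; rewrite !mxE /slope; have [_ -> _] := base_x_derivs 0 s 0.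
have slopeE1 s k : slope Phi y s k = (\row_k (space_deriv Phi y (rshift 2 k) s / dx X q)) 0 k.
  by rewrite -slopeE mxE.
have M := maps_at_time Py PT th th' EH T0.
have sX s : space_deriv Phi y i1 s = dx X q by have [_ -> _] := base_x_derivs 0 s 0.
split.
  move=> hM; have h := hM; move: hM => /M hM.
  have AE : cA th q * dx X q ^+ 2 = cA th' (lsubmx (Phi y)) * Tt0.
    have s0 : space_deriv Phi y i1 0 != 0 by rewrite sX.
    by have := maps_at_A Py PT n0 EH T0 h A0 s0; rewrite sX.
  split=> // s k.
  have s0 : space_deriv Phi y i1 s != 0 by rewrite sX.
  have [+ _] := hM (\row_k H th q g s k) s 0 s0.
  have hP j : (\row_k H th q g s k) 0 j = cA th q * (0 : 'rV[R]_n) 0 j + H th q g s j.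
    by rewrite !mxE mulr0 add0r.
  move=> /(_ hP k); rewrite slopeE slopeE1 sX /master.
  have [-> _ ->] := base_x_derivs (\row_k H th q g s k) s 0.
  set G := \row_k0 _; move: (G 0 k) (H th' _ _ _ _) => Gk K.
  have alg (ot xt G1 t A1 a oxx xxx x K1 : R) : t != 0 -> x != 0 -> a * x ^+ 2 = A1 * t ->
    (ot - xt * G1) / t = A1 * ((oxx - G1 * xxx) / x ^+ 2) + K1 ->
    ot - xt * G1 = a * (oxx - G1 * xxx) + t * K1.
    move=> t0 x0 ha hE; rewrite -[LHS](divfK t0) hE mulrDl [K1 * t]mulrC; congr (_ + _).
    by rewrite mulrAC -ha; field.
  exact: alg T0 X0 AE.
move=> inj AE hmaster; apply/M => p s w s0.
pose P : 'rV[R]_n := \row_k H th q g s k.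
(* The defect of the source system at the jet (p, s, w). *)
pose de := p - P - cA th q *: w.
have pE : p = P + (cA th q *: w + de) by rewrite /de addrCA addrA addrAC addrA; apply/rowP => k; rewrite !mxE; ring.
have Ede : (forall k, p 0 k = cA th q * w 0 k + H th q g s k) <-> de = 0.
  split=> [h|d0 k]; first by apply/rowP => k; rewrite !mxE h; ring.
  by rewrite pE d0 addr0 !mxE addrC.
have s2 k : space_deriv2 Phi y (rshift 2 k) s w =
    space_deriv2 Phi y (rshift 2 k) s 0 + fibre_deriv Phi y (rshift 2 k) w.
  by rewrite /space_deriv2 (fibre_deriv_0 Py) addr0.
have tp k : time_deriv Phi y (rshift 2 k) p = time_deriv Phi y (rshift 2 k) P +
    cA th q * fibre_deriv Phi y (rshift 2 k) w + fibre_deriv Phi y (rshift 2 k) de.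
  by rewrite {1}pE (time_derivD Py) (fibre_derivD Py) (fibre_derivZ Py) addrA.
apply: iff_trans Ede _.
have key k : ((time_deriv Phi y (rshift 2 k) p - time_deriv Phi y i1 p * slope Phi y s k) / Tt0 =
     cA th' (lsubmx (Phi y)) *
       ((space_deriv2 Phi y (rshift 2 k) s w - slope Phi y s k * space_deriv2 Phi y i1 s w)
         / space_deriv Phi y i1 s ^+ 2)
     + H th' (lsubmx (Phi y)) (rsubmx (Phi y)) (\row_k slope Phi y s k) k) <->
  fibre_deriv Phi y (rshift 2 k) de = 0.
  have := hmaster s k; rewrite /master slopeE slopeE1 sX s2 tp.
  have [-> _ ->] := base_x_derivs p s w.
  rewrite -/P; set G := \row_k0 _; move: (G 0 k) (H th' _ _ _ _) => Gk K.
  have alg (ot fw fd xt G1 t A1 a oxx xxx x K1 : R) : t != 0 -> x != 0 -> a * x ^+ 2 = A1 * t ->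
    ot - xt * G1 = a * (oxx - G1 * xxx) + t * K1 ->
    (ot + a * fw + fd - xt * G1) / t =
      A1 * ((oxx + fw - G1 * xxx) / x ^+ 2) + K1 <-> fd = 0.
    move=> t0 x0 ha hE.
    have -> : A1 = a * x ^+ 2 / t by rewrite ha mulfK.
    have -> : (ot + a * fw + fd - xt * G1) / t =
       a * x ^+ 2 / t * ((oxx + fw - G1 * xxx) / x ^+ 2) + K1 + fd / t.
      have -> : ot + a * fw + fd - xt * G1 = (ot - xt * G1) + a * fw + fd by ring.
      by rewrite hE; field; rewrite x0 t0.
    split=> [/eqP|->]; last by rewrite mul0r addr0.
    by rewrite -[X in _ == X]addr0 (inj_eq (addrI _)) mulf_eq0 invr_eq0 (negPf t0) orbF => /eqP.
  exact: alg T0 X0 AE.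
split=> [d0 k|h]; first by apply/key; rewrite d0 (fibre_deriv_0 Py).
by apply: inj => k; apply/key/h.
Qed.

(** The slopes 0, v and -v are compared. Both H and the new slope are affine in s, so all terms
    cancel except the second derivative along the tangents, where the parallelogram identity leaves
    2 A times the wanted quantity. *)
Lemma master_affine th th' v k : cA th q != 0 -> dx X q != 0 ->
  (forall th p g s v k, H th p g (s + v) k + H th p g (s - v) k = 2 * H th p g s k) ->
  (forall s k, master th th' s k) ->
  'D_(vertical v) ('D_(vertical v) (fun y => Phi y 0 (rshift 2 k))) y = 0.
Proof.
move=> A0 X0 HA M.
pose ph := fun y => Phi y 0 (rshift 2 k).
have pa : analytic_at ph y by exact: Py.
pose G s : 'rV[R]_n := \row_k (space_deriv Phi y (rshift 2 k) s / dx X q).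
pose dG : 'rV[R]_n := \row_k (fibre_deriv Phi y (rshift 2 k) v / dx X q).
have GD : G (0 + v) = G 0 + dG.
  by apply/rowP => j; rewrite !mxE (space_derivD Py) mulrDl.
have fN j u : fibre_deriv Phi y j (- u) = - fibre_deriv Phi y j u.
  by rewrite -scaleN1r (fibre_derivZ Py) mulN1r.
have GB : G (0 - v) = G 0 - dG.
  by apply/rowP => j; rewrite !mxE (space_derivD Py) fN mulrDl mulNr.
pose P s : 'rV[R]_n := \row_k H th q g s k.
have tP : time_deriv Phi y (rshift 2 k) (P (0 + v)) + time_deriv Phi y (rshift 2 k) (P (0 - v)) =
   2 * time_deriv Phi y (rshift 2 k) (P 0).
  have -> : P (0 + v) = P 0 + (P (0 + v) - P 0) by rewrite [RHS]addrC subrK.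
  have -> : P (0 - v) = P 0 - (P (0 + v) - P 0).
    apply/rowP => j; rewrite !mxE; have := HA th q g 0 v j.
    by move: (H _ _ _ _ _) (H _ _ _ _ _) (H _ _ _ _ _) => a b c h; lra.
  rewrite !(time_derivD Py) fN.
  by move: (time_deriv _ _ _ _) (fibre_deriv _ _ _ _) => a b; ring.
have S2 : space_deriv2 Phi y (rshift 2 k) (0 + v) 0 + space_deriv2 Phi y (rshift 2 k) (0 - v) 0 =
  2 * space_deriv2 Phi y (rshift 2 k) 0 0 + 2 * 'D_(vertical v) ('D_(vertical v) ph) y.
  have sd0 s : space_deriv2 Phi y (rshift 2 k) s 0 = 'D_(tangent 1 s) ('D_(tangent 1 s) ph) y.
    rewrite /space_deriv2 (fibre_deriv_0 Py); exact: addr0.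
  rewrite !sd0 (tangentD 1 0 v) (tangentD 1 0 (- v)).
  have -> : vertical (- v) = (- 1) *: vertical v by rewrite -verticalZ scaleN1r.
  exact: derive2_second_diff.
have Mk s : time_deriv Phi y (rshift 2 k) (P s) - dt X q * G s 0 k =
    cA th q * (space_deriv2 Phi y (rshift 2 k) s 0 - G s 0 k * dx (dx X) q)
    + Tt0 * H th' (lsubmx (Phi y)) (rsubmx (Phi y)) (G s) k := M s k.
have e0 := Mk 0; have e1 := Mk (0 + v); have e2 := Mk (0 - v).
rewrite GD in e1; rewrite GB in e2.
have hH := HA th' (lsubmx (Phi y)) (rsubmx (Phi y)) (G 0) dG k.
have GDk : (G 0 + dG) 0 k = G 0 0 k + dG 0 k by rewrite mxE.
have GBk : (G 0 - dG) 0 k = G 0 0 k - dG 0 k by rewrite !mxE.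
rewrite GDk in e1; rewrite GBk in e2.
have alg (t0 t1 t2 xt c d a s0 s1 s2 xx t h0 h1 h2 d2 : R) : a != 0 ->
    t1 + t2 = 2 * t0 -> s1 + s2 = 2 * s0 + 2 * d2 -> h1 + h2 = 2 * h0 ->
    t0 - xt * c = a * (s0 - c * xx) + t * h0 ->
    t1 - xt * (c + d) = a * (s1 - (c + d) * xx) + t * h1 ->
    t2 - xt * (c - d) = a * (s2 - (c - d) * xx) + t * h2 -> d2 = 0.
  move=> a0 ht hs hh f0 f1 f2.
  have : a * (2 * d2) = 0.
    have -> : 2 * d2 = s1 + s2 - 2 * s0 by rewrite hs; ring.
    transitivity ((a * (s1 - (c + d) * xx) + t * h1) + (a * (s2 - (c - d) * xx) + t * h2)
      - 2 * (a * (s0 - c * xx) + t * h0) - t * (h1 + h2 - 2 * h0)); first by ring.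
    rewrite -f0 -f1 -f2 hh; transitivity (t1 + t2 - 2 * t0); first by ring.
    by rewrite ht subrr.
  by move=> /eqP; rewrite !mulf_eq0 (negPf a0) pnatr_eq0 /= => /eqP.
exact: (alg _ _ _ _ _ _ _ _ _ _ _ _ _ _ _ _ A0 tP S2 hH e0 e1 e2).
Qed.

End Master.

(** * Integrating the conditions on the base components *)

Section Structure.
Variable R : realType.

Lemma box_path m (f : 'rV[R]_m -> R) z r c u d :
  (forall h, in_box r h -> analytic_at f (z + h)) ->
  in_box r u -> in_box r (u + d) ->
  (forall h, in_box r h -> 'D_d f (z + h) = c) -> f (z + (u + d)) = f (z + u) + c.
Proof.
move=> fa ur udr fd; rewrite addrA; apply: affine_along => s /andP[s0 s1].
have hr : in_box r (u + s *: d).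
  move=> i; have := ur i; have := udr i; rewrite !mxE => h1 h0.
  have -> : u 0 i + s * d 0 i = (1 - s) * u 0 i + s * (u 0 i + d 0 i) by ring.
  apply: le_trans (ler_normD _ _) _; rewrite !normrM (ger0_norm s0).
  rewrite (ger0_norm (_ : 0 <= 1 - s)) ?subr_ge0//.
  have -> : r = (1 - s) * r + s * r by ring.
  by apply: lerD; apply: ler_wpM2l; rewrite ?subr_ge0.
by rewrite -addrA; split; [exact: fa | exact: fd].
Qed.

Variable n : nat.
Variable E : system_class R n.
Variable H : coefs R -> 'rV[R]_2 -> 'rV[R]_n -> 'rV[R]_n -> 'I_n -> R.

Local Notation i0 := (lshift n (0 : 'I_2)).
Local Notation i1 := (lshift n (1 : 'I_2)).

Definition test_coefs (c : R) : coefs R := Coefs (fun=> 1) (fun=> 0) (fun=> c).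

Lemma admissible_test c p : admissible (test_coefs c) p.
Proof.
have ha k : analytic_at (fun _ : 'rV[R]_2 => k) p := analytic_cst k p.
by rewrite /admissible /=; split; [exact: ha | exact: ha | exact: ha | rewrite oner_neq0].
Qed.

Definition equivalence_at Phi (y : 'rV[R]_(2 + n)) := point_transformation Phi y /\
  forall th, admissible th (lsubmx y) ->
    exists2 th', admissible th' (lsubmx (Phi y)) & maps_at E Phi y th th'.

Lemma equivalence_near Phi z : equivalence E Phi z ->
  \forall y \near z, equivalence_at Phi y.
Proof.
move=> eqz; apply: filterS eqz => y [Py h]; split; first exact: Py.
move=> th tha; have [th' th'a M] := h th tha; exists th'; first exact: th'a.
exact: (nbhs_singleton M).
Qed.

Definition fibred T X (Phi : 'rV[R]_(2 + n) -> 'rV[R]_(2 + n)) (y : 'rV[R]_(2 + n)) :=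
  Phi y 0 i0 = T (y 0 i0) /\ Phi y 0 i1 = X (lsubmx y).

Lemma vertical_entry v (k : 'I_(2 + n)) :
  vertical v 0 k = (row_mx (0 : 'rV[R]_2) v) 0 k.
Proof. by []. Qed.

Lemma deltaE m (j i : 'I_m) : ('e_j : 'rV[R]_m) 0 i = (i == j)%:R.
Proof. by rewrite mxE eqxx. Qed.

(** T and X are restrictions of the base components of Phi to slices through z; the vanishing
    derivatives, constant along segments in a box, carry the values from the slices to the whole
    box. T must be settled near z before the fibre derivatives of X can be handled. *)
Lemma fibred_ex Phi z : (0 < n)%N -> evolution E H ->
  equivalence E Phi z -> exists T X, \forall y \near z,
    [/\ equivalence_at Phi y, fibred T X Phi y,
      analytic_at (fun q : 'rV[R]_2 => T (q 0 0)) (lsubmx y), analytic_at X (lsubmx y)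
      & T^`()%classic (lsubmx y 0 0) != 0 /\ dx X (lsubmx y) != 0].
Proof.
move=> n0 EH /equivalence_near eqz.
have g1 : \forall y \near z, equivalence_at Phi y /\
    [/\ forall v, 'D_(vertical v) (fun y => Phi y 0 i0) y = 0,
      'D_(tangent 1 0) (fun y => Phi y 0 i0) y = 0,
      'D_(tangent 0 0) (fun y => Phi y 0 i0) y != 0
    & exists s, 'D_(tangent 1 s) (fun y => Phi y 0 i1) y != 0].
  apply: filterS eqz => y hy; split=> //; have [Pt h] := hy.
  have [th' [_ _ _ A'] M] := h _ (admissible_test 0 (lsubmx y)).
  exact: (maps_at_base_t n0 EH Pt M (oner_neq0 R) A').
have [r r0 Hr] := near_boxP g1.
have Pan h : in_box r h -> analytic_map_at Phi (z + h).
  by move=> /Hr[[[]]].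
(* The line through z in the direction of t. *)
pose emb t : 'rV[R]_(2 + n) := z + (t - z 0 i0) *: 'e_i0.
pose T t := Phi (emb t) 0 i0.
have box1 h : in_box r h -> in_box r (h 0 i0 *: 'e_i0 : 'rV[R]_(2 + n)).
  move=> hr i; rewrite mxE deltaE; case: eqP => _; first by rewrite mulr1.
  by rewrite mulr0 normr0 ltW.
have PT h : in_box r h -> Phi (z + h) 0 i0 = T ((z + h) 0 i0).
  move=> hr; rewrite /T /emb mxE [z 0 i0 + _]addrC addrK.
  set u := h 0 i0 *: _.
  have -> : h = u + (h - u) by rewrite addrC subrK.
  rewrite -[RHS]addr0; apply: (box_path (f := fun y => Phi y 0 i0) (r := r)).
  - by move=> h' h'r; apply: Pan.
  - exact: box1.
  - by rewrite addrC subrK.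
  move=> h' h'r; have [_ [V0 X0 _ _]] := Hr _ h'r.
  have Pa : analytic_at (fun y => Phi y 0 i0) (z + h') by exact: Pan.
  rewrite (row_decomp (h - u)) !(derive_dirD _ _ Pa) !(derive_dirZ _ _ Pa) V0 X0.
  by rewrite !mxE eqxx mulr1 subrr mul0r mulr0 !addr0.
have nPT : \forall y \near z, Phi y 0 i0 = T (y 0 i0) by exact: near_box PT.
(* The unknowns are frozen at their values in z. *)
pose X (q : 'rV[R]_2) := Phi (row_mx q (rsubmx z)) 0 i1.
have Tan h : in_box r h -> analytic_at (fun q : 'rV[R]_2 => T (q 0 0)) (lsubmx (z + h)).
  move=> hr; apply: (analytic_comp (f := fun y => Phi y 0 i0)
    (g := fun q : 'rV[R]_2 => emb (q 0 0))).
    move=> k; apply: (analytic_ext (f := fun q : 'rV[R]_2 =>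
      z 0 k + (q 0 0 - z 0 i0) * ('e_i0 : 'rV[R]_(2 + n)) 0 k)).
      by move=> q; rewrite !mxE.
    apply: analyticD; first exact: analytic_cst.
    apply: analyticM; last exact: analytic_cst.
    apply: analyticB; [exact: analytic_coord | exact: analytic_cst].
  have -> : emb (lsubmx (z + h) 0 0) = z + h 0 i0 *: 'e_i0.
    by rewrite /emb !mxE [z 0 _ + _]addrC addrK.
  by apply: Pan; exact: box1.
have g2 : \forall y \near z, forall v, fibre_deriv Phi y i1 v = 0.
  near=> y; have nT : \forall y' \near y, Phi y' 0 i0 = T (y' 0 i0).
    by near: y; exact: (near_join nPT).
  have [[[Py _] h] [_ _ T0 _]] : equivalence_at Phi y /\
    [/\ forall v, 'D_(vertical v) (fun y => Phi y 0 i0) y = 0,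
      'D_(tangent 1 0) (fun y => Phi y 0 i0) y = 0,
      'D_(tangent 0 0) (fun y => Phi y 0 i0) y != 0
    & exists s, 'D_(tangent 1 s) (fun y => Phi y 0 i1) y != 0] by near: y.
  have [th' [_ _ _ A'] M] := h _ (admissible_test 0 (lsubmx y)).
  have T0' : T^`()%classic (lsubmx y 0 0) != 0.
    by rewrite -(time_deriv0 Py nT 0); exact: T0.
  exact: (maps_at_base_x Py nT n0 EH T0' M (oner_neq0 R)).
have [r' r'0 Hr'] := near_boxP g2.
pose s := Num.min r r'.
have s0 : 0 < s by rewrite lt_min r0.
have sr h : in_box s h -> in_box r h by apply: in_box_le; rewrite ge_min lexx.
have sr' h : in_box s h -> in_box r' h by apply: in_box_le; rewrite ge_min lexx orbT.
have box2 h : in_box s h -> in_box s (row_mx (lsubmx h) (0 : 'rV[R]_n)).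
  move=> hr i; case: (split_ordP i) => j ->; rewrite ?row_mxEl ?row_mxEr.
    by rewrite mxE; exact: hr.
  by rewrite mxE normr0 ltW.
have zE h : row_mx (lsubmx (z + h)) (rsubmx z) = z + row_mx (lsubmx h) 0.
  by rewrite -{3}[z]hsubmxK add_row_mx addr0 linearD.
have PX h : in_box s h -> Phi (z + h) 0 i1 = X (lsubmx (z + h)).
  move=> hr; rewrite /X zE; set u := row_mx _ _.
  have -> : h = u + vertical (rsubmx h).
    rewrite -[LHS]hsubmxK /u; apply/rowP => i; rewrite [RHS]mxE vertical_entry.
    by case: (split_ordP i) => j ->; rewrite ?row_mxEl ?row_mxEr !mxE ?addr0 ?add0r.
  rewrite -[RHS]addr0.
  have hu : u + vertical (rsubmx h) = h.
    rewrite -[RHS]hsubmxK /u; apply/rowP => i; rewrite [LHS]mxE vertical_entry.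
    by case: (split_ordP i) => j ->; rewrite ?row_mxEl ?row_mxEr !mxE ?addr0 ?add0r.
  apply: (box_path (f := fun y => Phi y 0 i1) (r := s)).
  - by move=> h' h'r; apply: Pan; exact: sr.
  - exact: box2.
  - by rewrite hu.
  by move=> h' h'r; apply: (Hr' h'); exact: sr'.
have nPX : \forall y \near z, Phi y 0 i1 = X (lsubmx y) by exact: near_box PX.
have Xan h : in_box s h -> analytic_at X (lsubmx (z + h)).
  move=> hr; apply: (analytic_comp (f := fun y => Phi y 0 i1)
    (g := fun q : 'rV[R]_2 => row_mx q (rsubmx z))).
    by apply: analytic_map_row_mx; [exact: analytic_map_id | exact: analytic_map_cst].
  by rewrite zE; apply: Pan; apply: sr; exact: box2.
exists T, X; near=> y.
have nT : \forall y' \near y, Phi y' 0 i0 = T (y' 0 i0).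
  by near: y; exact: (near_join nPT).
have nX : \forall y' \near y, Phi y' 0 i1 = X (lsubmx y').
  by near: y; exact: (near_join nPX).
have h1 : analytic_at (fun q : 'rV[R]_2 => T (q 0 0)) (lsubmx y).
  by near: y; exact: near_box Tan.
have h2 : analytic_at X (lsubmx y) by near: y; exact: near_box Xan.
have [he [_ _ T0 [s' X0]]] : equivalence_at Phi y /\
    [/\ forall v, 'D_(vertical v) (fun y => Phi y 0 i0) y = 0,
      'D_(tangent 1 0) (fun y => Phi y 0 i0) y = 0,
      'D_(tangent 0 0) (fun y => Phi y 0 i0) y != 0
    & exists s, 'D_(tangent 1 s) (fun y => Phi y 0 i1) y != 0] by near: y.
have [[Py _] _] := he.
split=> //; first by split; [exact: (nbhs_singleton nT) | exact: (nbhs_singleton nX)].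
split; first by rewrite -(time_deriv0 Py nT 0); exact: T0.
by have [_ <- _] := base_x_derivs Py nX 0 s' 0; exact: X0.
Unshelve. all: by end_near. Qed.

End Structure.

(** * Affine dependence on the unknowns *)

Section Affine.
Variable R : realType.
Variable n : nat.
Variable E : system_class R n.
Variable H : coefs R -> 'rV[R]_2 -> 'rV[R]_n -> 'rV[R]_n -> 'I_n -> R.

Local Notation i0 := (lshift n (0 : 'I_2)).
Local Notation i1 := (lshift n (1 : 'I_2)).

Definition aff (T : R -> R) (X : 'rV[R]_2 -> R) (w0 : 'rV[R]_2 -> 'rV[R]_n)
    (M : 'rV[R]_2 -> 'M[R]_n) (y : 'rV[R]_(2 + n)) : 'rV[R]_(2 + n) :=
  row_mx (base T X (lsubmx y)) (w0 (lsubmx y) + rsubmx y *m M (lsubmx y)).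

Definition aff_analytic (T : R -> R) (X : 'rV[R]_2 -> R) (w0 : 'rV[R]_2 -> 'rV[R]_n)
    (M : 'rV[R]_2 -> 'M[R]_n) (q : 'rV[R]_2) :=
  [/\ analytic_at (fun q : 'rV[R]_2 => T (q 0 0)) q, analytic_at X q,
      analytic_map_at w0 q & forall l k, analytic_at (fun q => M q l k) q].

Lemma derive_vertical (f : 'rV[R]_(2 + n) -> R) y v : analytic_at f y ->
  'D_(vertical v) f y = \sum_l v 0 l * 'D_(vertical 'e_l) f y.
Proof.
move=> fy; rewrite vertical_sum.
elim: (index_enum _) => [|k s IH]; first by rewrite !big_nil derive_dir0.
by rewrite !big_cons (derive_dirD _ _ fy) (derive_dirZ _ _ fy) IH.
Qed.

(** The zero second derivative makes the first one constant along the segment, and then f itself is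
    affine along it. *)
Lemma fibre_affine (f : 'rV[R]_(2 + n) -> R) y v :
  (forall s, 0 <= s <= 1 -> analytic_at f (y + s *: vertical v) /\
    'D_(vertical v) ('D_(vertical v) f) (y + s *: vertical v) = 0) ->
  f (y + vertical v) = f y + 'D_(vertical v) f y.
Proof.
move=> h; apply: affine_along => s s01; split; first by have [] := h s s01.
apply: etrans (affine_along (f := 'D_(vertical v) f) (v := s *: vertical v) (c := 0) _)
  (addr0 _) => s' /andP[s'0 s'1].
have ss : 0 <= s' * s <= 1.
  have /andP[s0 s1] := s01; rewrite mulr_ge0//=; apply: le_trans s1.
  by rewrite -[leRHS]mul1r ler_wpM2r.
rewrite scalerA; have [fa fd] := h _ ss; split; first exact: analytic_derive.
by rewrite (derive_dirZ _ _ (analytic_derive _ fa)) fd mulr0.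
Qed.

Lemma affine_ex Phi z : (0 < n)%N -> evolution E H ->
  (forall th p g s v k, H th p g (s + v) k + H th p g (s - v) k = 2 * H th p g s k) ->
  equivalence E Phi z -> exists T X w0 M, \forall y \near z,
    [/\ equivalence_at E Phi y, Phi y = aff T X w0 M y, aff_analytic T X w0 M (lsubmx y)
      & T^`()%classic (lsubmx y 0 0) != 0 /\ dx X (lsubmx y) != 0].
Proof.
move=> n0 EH HA eqz; have [T [X TX]] := fibred_ex n0 EH eqz.
have g1 : \forall y \near z, forall v k,
    'D_(vertical v) ('D_(vertical v) (fun y => Phi y 0 (rshift 2 k))) y = 0.
  apply: filterS (near_join TX) => y TXy v k.
  have [[[Py _] h] _ Ta Xa [T0 X0]] := nbhs_singleton TXy.
  have [th' [_ _ _ A'] M] := h _ (admissible_test 0 (lsubmx y)).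
  have nT : \forall y' \near y, Phi y' 0 i0 = T (y' 0 i0).
    by apply: filterS TXy => y' [_ []].
  have nX : \forall y' \near y, Phi y' 0 i1 = X (lsubmx y').
    by apply: filterS TXy => y' [_ []].
  have A1 : cA (test_coefs 0) (lsubmx y) != 0 by exact: (oner_neq0 R).
  have [/(_ M) [_ ms] _] := maps_at_master Py nT nX th' n0 EH T0 X0 A1.
  exact: (master_affine (th := test_coefs 0) (th' := th') Py v k A1 X0 HA ms).
have [r r0 Hr] := near_boxP g1.
have [r' r'0 Hr'] := near_boxP TX.
pose s := Num.min r r'.
have s0 : 0 < s by rewrite lt_min r0.
have sr h : in_box s h -> in_box r h by apply: in_box_le; rewrite ge_min lexx.
have sr' h : in_box s h -> in_box r' h by apply: in_box_le; rewrite ge_min lexx orbT.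
pose gz := rsubmx z.
pose M q : 'M[R]_n := \matrix_(l, k)
  'D_(vertical 'e_l) (fun y => Phi y 0 (rshift 2 k)) (row_mx q gz).
(* The fibre point 0 may lie outside the domain of the germ, so [w0] is the affine extrapolation
   from the fibre value [gz] of z. *)
pose w0 q : 'rV[R]_n := rsubmx (Phi (row_mx q gz)) - gz *m M q.
have Pan h : in_box s h -> analytic_map_at Phi (z + h).
  by move=> /sr'/Hr'[[[]]].
have zE h : row_mx (lsubmx (z + h)) gz = z + row_mx (lsubmx h) 0.
  by rewrite -{2}[z]hsubmxK add_row_mx addr0 linearD.
have box2 c (h : 'rV[R]_(2 + n)) : 0 <= c <= 1 -> in_box s h -> in_box s (row_mx (lsubmx h) (c *: rsubmx h)).
  move=> /andP[c0 c1] hr i; rewrite -[h in in_box s h]hsubmxK in hr; have := hr i.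
  case: (split_ordP i) => j ->; rewrite ?row_mxEl ?row_mxEr//.
  move=> hj; rewrite mxE normrM (ger0_norm c0); apply: le_trans hj.
  by rewrite -[leRHS]mul1r ler_wpM2r.
have box0 (h : 'rV[R]_(2 + n)) : in_box s h -> in_box s (row_mx (lsubmx h) (0 : 'rV[R]_n)).
  move=> hs; have -> : (0 : 'rV[R]_n) = 0 *: rsubmx h by rewrite scale0r.
  by apply: box2 => //; rewrite lexx ler01.
have hE (h : 'rV[R]_(2 + n)) : h = row_mx (lsubmx h) 0 + vertical (rsubmx h).
  apply/rowP => i; rewrite [RHS]mxE vertical_entry -{1}[h]hsubmxK.
  by case: (split_ordP i) => j ->; rewrite ?row_mxEl ?row_mxEr !mxE ?addr0 ?add0r.
have key h k : in_box s h -> Phi (z + h) 0 (rshift 2 k) =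
    (aff T X w0 M (z + h)) 0 (rshift 2 k).
  move=> hs; set f := fun y => Phi y 0 (rshift 2 k).
  have fy : analytic_at f (z + row_mx (lsubmx h) 0) by apply: Pan; exact: box0.
  have -> : Phi (z + h) 0 (rshift 2 k) = f (z + row_mx (lsubmx h) 0 + vertical (rsubmx h)).
    by rewrite -addrA -hE.
  rewrite fibre_affine; last first.
    move=> c c01; have cs := box2 c h c01 hs.
    have -> : z + row_mx (lsubmx h) 0 + c *: vertical (rsubmx h) =
        z + row_mx (lsubmx h) (c *: rsubmx h).
      rewrite -addrA -verticalZ; congr (_ + _); apply/rowP => i.
      rewrite [LHS]mxE vertical_entry.
      by case: (split_ordP i) => j ->; rewrite ?row_mxEl ?row_mxEr !mxE ?addr0 ?add0r.
    by split; [apply: Pan; exact: cs | exact: (Hr _ (sr _ _ cs) (rsubmx h) k)].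
  rewrite derive_vertical// /aff row_mxEr -zE.
  have -> : rsubmx (z + h) = gz + rsubmx h by rewrite linearD.
  rewrite mulmxDl /w0 addrA subrK [RHS]mxE; congr (_ + _); first by rewrite mxE.
  by rewrite [RHS]mxE; apply: eq_bigr => l _; congr (_ * _); rewrite /M mxE.
exists T, X, w0, M.
have near_aff : \forall y \near z, forall k,
    Phi y 0 (rshift 2 k) = (aff T X w0 M y) 0 (rshift 2 k).
  by apply: (near_box s0) => h hs k; exact: key.
have near_an : \forall y \near z, analytic_map_at w0 (lsubmx y) /\
    forall l k, analytic_at (fun q => M q l k) (lsubmx y).
  apply: (near_box s0) => h hs.
  have ga : analytic_map_at (fun q : 'rV[R]_2 => row_mx q gz) (lsubmx (z + h)).
    by apply: analytic_map_row_mx; [exact: analytic_map_id | exact: analytic_map_cst].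
  have Pa : analytic_map_at Phi (row_mx (lsubmx (z + h)) gz).
    by rewrite zE; apply: Pan; exact: box0.
  have Ma l k : analytic_at (fun q => M q l k) (lsubmx (z + h)).
    have := analytic_comp ga (analytic_derive (vertical 'e_l) (Pa (rshift 2 k))).
    by apply: analytic_ext => q; rewrite mxE.
  split=> // k.
  apply: (analytic_ext (f := fun q => Phi (row_mx q gz) 0 (rshift 2 k) -
     \sum_l gz 0 l * M q l k)).
    by move=> q; rewrite !mxE.
  apply: analyticB; first exact: (analytic_comp ga (Pa (rshift 2 k))).
  apply: analytic_sum => l; apply: analyticM; [exact: analytic_cst | exact: Ma].
near=> y.
have [he [hT hX] Ta Xa TX0] : [/\ equivalence_at E Phi y, fibred T X Phi y,
      analytic_at (fun q : 'rV[R]_2 => T (q 0 0)) (lsubmx y), analytic_at X (lsubmx y)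
      & T^`()%classic (lsubmx y 0 0) != 0 /\ dx X (lsubmx y) != 0] by near: y.
have [wa Ma] : analytic_map_at w0 (lsubmx y) /\
    forall l k, analytic_at (fun q => M q l k) (lsubmx y) by near: y.
have hk : forall k, Phi y 0 (rshift 2 k) = (aff T X w0 M y) 0 (rshift 2 k) by near: y.
split; [exact: he | | by split | exact: TX0].
apply/rowP => i; case: (split_ordP i) => j ->; last exact: hk.
rewrite /aff row_mxEl mxE; move: j; apply: ord2P; first by rewrite hT mxE.
exact: hX.
Unshelve. all: by end_near. Qed.

Section Derivs.
Variables (Phi : 'rV[R]_(2 + n) -> 'rV[R]_(2 + n)) (y : 'rV[R]_(2 + n)).
Variables (T : R -> R) (X : 'rV[R]_2 -> R) (w0 : 'rV[R]_2 -> 'rV[R]_n)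
    (M : 'rV[R]_2 -> 'M[R]_n).
Hypothesis Py : analytic_map_at Phi y.
Hypothesis PA : \forall y' \near y, Phi y' = aff T X w0 M y'.
Let q := lsubmx y.
Let g := rsubmx y.
Hypothesis an : aff_analytic T X w0 M q.
Let w k := fun q => w0 q 0 k.
Let m l k := fun q => M q l k.

Lemma aff_base : (\forall y' \near y, Phi y' 0 i0 = T (y' 0 i0)) /\
  (\forall y' \near y, Phi y' 0 i1 = X (lsubmx y')).
Proof.
by split; apply: filterS PA => y' ->; rewrite /aff row_mxEl mxE //= mxE.
Qed.

Lemma aff_derivs k p s :
  [/\ time_deriv Phi y (rshift 2 k) p =
        dt (w k) q + \sum_l (g 0 l * dt (m l k) q + p 0 l * m l k q),
      space_deriv Phi y (rshift 2 k) s =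
        dx (w k) q + \sum_l (g 0 l * dx (m l k) q + s 0 l * m l k q)
    & space_deriv2 Phi y (rshift 2 k) s 0 =
        dx (dx (w k)) q + \sum_l (g 0 l * dx (dx (m l k)) q + 2 * s 0 l * dx (m l k) q)].
Proof.
have [Ta Xa wa ma] := an.
have [[fa fg f0 f1] [_ f11 _ _]] := jetpolyP q g p s 0 0.
set f := jetpoly _ _ _ _ _ _ in fa fg f0 f1 f11.
have gy : graph f q = y by rewrite /graph fg hsubmxK.
have Pg : analytic_map_at Phi (graph f q) by rewrite gy.
pose F q' := w k q' + \sum_l f q' 0 l * m l k q'.
have nF : \forall q' \near q, along Phi f (rshift 2 k) q' = F q'.
  have gc : {for q, continuous (graph f)} by apply/analytic_map_cont/analytic_graph.
  have h : \forall y' \near graph f q, Phi y' = aff T X w0 M y' by rewrite gy.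
  suff : \forall q' \near q, Phi (graph f q') = aff T X w0 M (graph f q').
    apply: filterS => q' hq'; rewrite /along hq' /aff row_mxEr /graph row_mxKl row_mxKr.
    by rewrite mxE; congr (_ + _); rewrite mxE.
  exact: (gc _ h).
have DF i q' : analytic_map_at f q' -> analytic_map_at w0 q' ->
    (forall l, analytic_at (m l k) q') ->
    'D_('e_i) F q' = 'D_('e_i) (w k) q' +
    \sum_l ('D_('e_i) (fun q => f q 0 l) q' * m l k q' + f q' 0 l * 'D_('e_i) (m l k) q').
  move=> fa' wa' ma'.
  have sl l := isD_mul (isD_of 'e_i (fa' l)) (isD_of 'e_i (ma' l)).
  have := isD_add (isD_of 'e_i (wa' k)) (isD_sum (index_enum 'I_n) sl).
  by case.
have fD i l : 'D_('e_i) (fun q => f q 0 l) q = dvec i f q 0 l by rewrite mxE.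
have nDF : \forall q' \near q, dx F q' = dx (w k) q' +
    \sum_l (dx (fun q => f q 0 l) q' * m l k q' + f q' 0 l * dx (m l k) q').
  have h1 : \forall q' \near q, forall l, analytic_at (fun q => f q 0 l) q'.
    apply: (@filter_forall _ _ (fun l q' => analytic_at (fun q => f q 0 l) q') (nbhs q) _) => l.
    exact: (analytic_near (fa l)).
  have h2 : \forall q' \near q, forall l, analytic_at (fun q => w0 q 0 l) q'.
    apply: (@filter_forall _ _ (fun l q' => analytic_at (fun q => w0 q 0 l) q') (nbhs q) _) => l.
    exact: (analytic_near (wa l)).
  have h3 : \forall q' \near q, forall l, analytic_at (m l k) q'.
    apply: (@filter_forall _ _ (fun l q' => analytic_at (m l k) q') (nbhs q) _) => l.
    exact: (analytic_near (ma l k)).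
  apply: filterS (filterI (filterI h1 h2) h3) => q' [[h1' h2'] h3'].
  exact: (DF 1 q' h1' h2' h3').
have nDa : \forall q' \near q, dx (along Phi f (rshift 2 k)) q' = dx F q'.
  by apply: filterS (near_join nF) => q' h; exact: derive_eq.
have Fx i : dvec i f q 0 =1 dvec i f q 0 by [].
have e0 := along_D (rshift 2 k) 0 fa Pg; rewrite f0 gy in e0.
have e1 := along_D (rshift 2 k) 1 fa Pg; rewrite f1 gy in e1.
have e2 := along_DD (rshift 2 k) 1 1 fa Pg; rewrite f1 f11 gy in e2.
have ma' l : analytic_at (m l k) q by exact: ma.
split.
- apply: etrans (esym e0) _; apply: etrans (derive_eq _ nF) _.
  apply: etrans (DF 0 q fa wa ma') _; congr (_ + _); apply: eq_bigr => l _.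
  by rewrite fD f0 fg addrC.
- apply: etrans (esym e1) _; apply: etrans (derive_eq _ nF) _.
  apply: etrans (DF 1 q fa wa ma') _; congr (_ + _); apply: eq_bigr => l _.
  by rewrite fD f1 fg addrC.
- apply: etrans (esym e2) _; apply: etrans (derive_eq _ nDa) _.
  apply: etrans (derive_eq _ nDF) _.
  have dwa : isD 'e_1 (dx (w k)) q (dx (dx (w k)) q) := isD_of 'e_1 (analytic_derive 'e_1 (wa k)).
  have sl l := isD_add (isD_mul (isD_of 'e_1 (analytic_derive 'e_1 (fa l))) (isD_of 'e_1 (ma' l)))
    (isD_mul (isD_of 'e_1 (fa l)) (isD_of 'e_1 (analytic_derive 'e_1 (ma' l)))).
  have [_ h] := isD_add dwa (isD_sum (index_enum 'I_n) sl).
  apply: etrans h _; congr (_ + _); apply: eq_bigr => l _.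
  have -> : 'D_('e_1) ('D_('e_1) (fun q => f q 0 l)) q = 0.
    have /rowP/(_ l) := f11; rewrite !mxE => h11; apply: etrans h11.
    by apply: derive_ext => q'; rewrite mxE.
  rewrite fD f1 fg mul0r add0r.
  have alg (a b c : R) : a * b + (a * b + c) = c + 2 * a * b by ring.
  exact: alg.
Qed.

Lemma aff_fibre k v : fibre_deriv Phi y (rshift 2 k) v = \sum_l v 0 l * m l k q.
Proof.
have h := time_derivD Py (rshift 2 k) 0 v.
have [h1 _ _] := aff_derivs k (0 + v) 0; have [h0 _ _] := aff_derivs k 0 0.
apply: (addrI (time_deriv Phi y (rshift 2 k) 0)); apply: etrans (esym h) _.
rewrite h1 h0 -addrA; congr (_ + _); rewrite -big_split /=; apply: eq_bigr => l _.
by rewrite !mxE add0r mul0r addr0.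
Qed.

End Derivs.
End Affine.

(** * The master identity for affine maps *)

Section MapsAffine.
Variable R : realType.
Variable n : nat.
Variable E : system_class R n.
Variable H : coefs R -> 'rV[R]_2 -> 'rV[R]_n -> 'rV[R]_n -> 'I_n -> R.

Variables (Phi : 'rV[R]_(2 + n) -> 'rV[R]_(2 + n)) (y : 'rV[R]_(2 + n)).
Variables (T : R -> R) (X : 'rV[R]_2 -> R) (w0 : 'rV[R]_2 -> 'rV[R]_n)
    (M : 'rV[R]_2 -> 'M[R]_n).
Hypothesis Py : analytic_map_at Phi y.
Hypothesis PA : \forall y' \near y, Phi y' = aff T X w0 M y'.
Let q := lsubmx y.
Let g := rsubmx y.
Hypothesis an : aff_analytic T X w0 M q.
Let w k := fun q => w0 q 0 k.
Let m l k := fun q => M q l k.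

Definition aff_slope (s : 'rV[R]_n) : 'rV[R]_n := \row_k
  ((dx (w k) q + \sum_l (g 0 l * dx (m l k) q + s 0 l * m l k q)) / dx X q).

Definition aff_master (th th' : coefs R) (s : 'rV[R]_n) (k : 'I_n) : Prop :=
  dt (w k) q + \sum_l (g 0 l * dt (m l k) q + H th q g s l * m l k q)
    - dt X q * aff_slope s 0 k =
  cA th q * (dx (dx (w k)) q + \sum_l (g 0 l * dx (dx (m l k)) q + 2 * s 0 l * dx (m l k) q)
    - aff_slope s 0 k * dx (dx X) q)
  + Tt T q * H th' (base T X q) (w0 q + g *m M q) (aff_slope s) k.

Lemma master_aff th th' s k : master H Phi y T X th th' s k <-> aff_master th th' s k.
Proof.
have Phiy : Phi y = aff T X w0 M y := nbhs_singleton PA.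
rewrite /master /aff_master.
have -> : \row_k0 (space_deriv Phi y (rshift 2 k0) s / dx X (lsubmx y)) = aff_slope s.
  by apply/rowP => j; rewrite [LHS]mxE [RHS]mxE; have [_ -> _] := aff_derivs Py PA an j 0 s.
have [_ _ ->] := aff_derivs Py PA an k 0 s.
have [-> _ _] := aff_derivs Py PA an k (\row_k0 H th (lsubmx y) (rsubmx y) s k0) s.
rewrite Phiy /aff row_mxKl row_mxKr.
have -> : \sum_(l < n) (rsubmx y 0 l * dt (fun q => M q l k) (lsubmx y) +
     (\row_k0 H th (lsubmx y) (rsubmx y) s k0) 0 l * M (lsubmx y) l k) =
  \sum_(l < n) (g 0 l * dt (m l k) q + H th q g s l * m l k q).
  by apply: eq_bigr => l _; congr (_ + _ * _); rewrite mxE.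
by [].
Qed.

Lemma maps_aff th th' : (0 < n)%N -> evolution E H -> Tt T q != 0 -> dx X q != 0 ->
  cA th q != 0 ->
  (maps_at E Phi y th th' ->
    cA th q * dx X q ^+ 2 = cA th' (base T X q) * Tt T q /\
    forall s k, aff_master th th' s k) /\
  (M q \in unitmx ->
    cA th q * dx X q ^+ 2 = cA th' (base T X q) * Tt T q ->
    (forall s k, aff_master th th' s k) -> maps_at E Phi y th th').
Proof.
move=> n0 EH T0 X0 A0; have [nT nX] := aff_base PA.
have Phiy : lsubmx (Phi y) = base T X q.
  by rewrite (nbhs_singleton PA) /aff row_mxKl.
have [h1 h2] := maps_at_master Py nT nX th' n0 EH T0 X0 A0.
rewrite Phiy in h1 h2; split.
  by move=> /h1[hA hM]; split; [exact: hA | move=> s k; apply/master_aff; exact: hM].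
move=> Mu hA hM; apply: h2; [|exact: hA|by move=> s k; apply/master_aff; exact: hM].
move=> v hv; have : v *m M q = 0.
  by apply/rowP => k; rewrite [RHS]mxE -[RHS](hv k) (aff_fibre Py PA an) mxE.
by move=> /(congr1 (mulmx^~ (invmx (M q)))); rewrite mul0mx mulmxK.
Qed.

(** The base components ignore the unknowns, so the vectors dual to the fibre components have zero
    base part; their fibre parts are the rows of a left inverse of M. *)
Lemma aff_unit : point_transformation Phi y -> Tt T q != 0 -> dx X q != 0 -> M q \in unitmx.
Proof.
move=> Pt T0 X0; have [nT nX] := aff_base PA.
have /choice[u uP] : forall i, exists u, forall k,
    'D_u (fun y => Phi y 0 k) y = (k == rshift 2 i)%:R.
  by move=> i; exact: point_transformation_dual Pt.
suff : (\matrix_(i, l) rsubmx (u i) 0 l) *m M q = 1%:M by case/mulmx1_unit.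
apply/matrixP => i k; rewrite !mxE.
have dec j : 'D_(u i) (fun y => Phi y 0 j) y =
    lsubmx (u i) 0 0 * time_deriv Phi y j 0 + lsubmx (u i) 0 1 * space_deriv Phi y j 0
    + fibre_deriv Phi y j (rsubmx (u i)).
  have Pa : analytic_at (fun y => Phi y 0 j) y by exact: Py.
  by rewrite {1}(row_decomp (u i)) !(derive_dirD _ _ Pa) !(derive_dirZ _ _ Pa).
have [tX sX _] := base_x_derivs Py nX 0 0 0.
have fX v : fibre_deriv Phi y (lshift n 1) v = 0.
  have [h1 _ _] := base_x_derivs Py nX (0 + v) 0 0.
  have := time_derivD Py (lshift n 1) 0 v; rewrite h1 tX => /eqP.
  by rewrite -[X in X == _]addr0 (inj_eq (addrI _)) eq_sym => /eqP.
have fT v : fibre_deriv Phi y (lshift n 0) v = 0.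
  have := time_derivD Py (lshift n 0) 0 v; rewrite !(time_deriv0 Py nT) => /eqP.
  by rewrite -[X in X == _]addr0 (inj_eq (addrI _)) eq_sym => /eqP.
have sT : space_deriv Phi y (lshift n 0) 0 = 0.
  have [[fa fg f0 f1] _] := jetpolyP q g 0 0 0 0.
  set f := jetpoly _ _ _ _ _ _ in fa fg f0 f1.
  have gy : graph f q = y by rewrite /graph fg hsubmxK.
  have Pg : analytic_map_at Phi (graph f q) by rewrite gy.
  have := along_D (lshift n 0) 1 fa Pg; rewrite f1 gy => e1; apply: etrans (esym e1) _.
  rewrite -(derive_coord1 T q); apply: derive_eq.
  have gc : {for q, continuous (graph f)} by apply/analytic_map_cont/analytic_graph.
  have h : \forall y' \near graph f q,
      Phi y' 0 (lshift n (0 : 'I_2)) = T (y' 0 (lshift n (0 : 'I_2))) by rewrite gy.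
  suff : \forall q' \near q, Phi (graph f q') 0 (lshift n (0 : 'I_2)) =
      T (graph f q' 0 (lshift n (0 : 'I_2))).
    by apply: filterS => q'; rewrite /along /graph row_mxEl.
  exact: (gc _ h).
have u0 : lsubmx (u i) 0 0 = 0.
  have := uP i (lshift n 0); rewrite dec (time_deriv0 Py nT) sT fT mulr0 !addr0.
  by rewrite (_ : (_ == _) = false)// => /eqP; rewrite mulf_eq0 (negPf T0) orbF => /eqP.
have u1 : lsubmx (u i) 0 1 = 0.
  have := uP i (lshift n 1); rewrite dec u0 mul0r add0r sX fX addr0.
  by rewrite (_ : (_ == _) = false)// => /eqP; rewrite mulf_eq0 (negPf X0) orbF => /eqP.
have := uP i (rshift 2 k); rewrite dec u0 u1 !mul0r !add0r (aff_fibre Py PA an).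
rewrite (inj_eq (@rshift_inj _ _)) eq_sym => <-.
by apply: eq_bigr => l _; rewrite mxE.
Qed.

End MapsAffine.

(** * Both classes as evolution systems *)

Section Classes.
Variable R : realType.

Definition parabolic_rhs (th : coefs R) (p : 'rV[R]_2) (g s : 'rV[R]_1) (k : 'I_1) : R :=
  cB th p * s 0 0 + cC th p * g 0 0.

Lemma parabolic_evolution : evolution (@parabolic R) parabolic_rhs.
Proof.
move=> th p j; rewrite /parabolic /parabolic_rhs; split=> [h k|/(_ 0) ->]; last by ring.
rewrite ord1; apply/eqP; rewrite -subr_eq0 -[X in _ == X]h; apply/eqP; ring.
Qed.

Definition DE1_rhs (th : coefs R) (p : 'rV[R]_2) (g s : 'rV[R]_3) (k : 'I_3) : R :=
  let A := cA th p in let B := cB th p in let C := cC th p in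
  let K := 2 * s 0 0 - dx (cA th) p / A * g 0 0 - dt (cA th) p / A in
  [:: B * s 0 0 - K * (g 0 0 + B) - dx (cB th) p * g 0 0 - 2 * A * s 0 1 - dt (cB th) p;
      B * s 0 1 - K * (g 0 1 - C) + dx (cC th) p * g 0 0 + dt (cC th) p;
      B * s 0 2 - K * g 0 2 + C * g 0 2]`_k.

Lemma DE1_evolution : evolution (@DE1 R) DE1_rhs.
Proof.
move=> th p j; rewrite /DE1.
have alg (a b c r : R) : a - b - c = 0 -> a = b + c.
  by move=> h; apply/eqP; rewrite -subr_eq0 -h; apply/eqP; ring.
split=> [[h0 h1 h2]|h].
  apply: ord3P; rewrite /DE1_rhs /=; apply/eqP; rewrite -subr_eq0; apply/eqP.
  - by apply: etrans h0; gen_derive; ring.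
  - by apply: etrans h1; gen_derive; ring.
  - by apply: etrans h2; gen_derive; ring.
by split; rewrite h /DE1_rhs /=; gen_derive; ring.
Qed.

Lemma parabolic_rhs_affine (th : coefs R) p g s v k :
  parabolic_rhs th p g (s + v) k + parabolic_rhs th p g (s - v) k =
  2 * parabolic_rhs th p g s k.
Proof. by rewrite /parabolic_rhs !mxE; ring. Qed.

Lemma DE1_rhs_affine (th : coefs R) p g s v k :
  DE1_rhs th p g (s + v) k + DE1_rhs th p g (s - v) k = 2 * DE1_rhs th p g s k.
Proof.
rewrite /DE1_rhs !mxE; move: k; by apply: ord3P => /=; gen_derive; ring.
Qed.

End Classes.

(** * Parabolic equations *)

Section Nondegenerate.
Variable R : realType.

(** One fibre radius serves all q near the base point. Identities can thus be compared at several
    fibre points over the same q. *)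
Lemma near_fibre n (P : 'rV[R]_(2 + n) -> Prop) (z : 'rV[R]_(2 + n)) :
  (\forall y \near z, P y) -> exists2 r, 0 < r &
    \forall q \near lsubmx z, forall v, in_box r v -> P (row_mx q (rsubmx z + v)).
Proof.
move=> /near_boxP[r r0 Hr]; exists r => //; apply: (near_box r0) => h hr v vr.
have -> : row_mx (lsubmx z + h) (rsubmx z + v) = z + row_mx h v.
  by rewrite -{3}[z]hsubmxK add_row_mx.
apply: Hr => i; case: (split_ordP i) => j ->; first by rewrite row_mxEl; exact: hr.
by rewrite row_mxEr; exact: vr.
Qed.

Lemma near_lsubmx n (P : 'rV[R]_2 -> Prop) (z : 'rV[R]_(2 + n)) :
  (\forall q \near lsubmx z, P q) -> \forall y \near z, P (lsubmx y).
Proof.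
move=> hP; have c : {for z, continuous (fun y : 'rV[R]_(2 + n) => lsubmx y)}.
  by apply/analytic_map_cont/analytic_lsubmx; exact: analytic_map_id.
exact: (c _ hP).
Qed.

Variables (T : R -> R) (X U : 'rV[R]_2 -> R).

Lemma TtE q : Tt T q = dt (fun q => T (q 0 0)) q.
Proof. by rewrite /dt derive_coord0. Qed.

Lemma analytic_Tt q : analytic_at (fun q : 'rV[R]_2 => T (q 0 0)) q -> analytic_at (Tt T) q.
Proof.
move=> h; apply: analytic_ext (analytic_derive 'e_0 h) => p.
by rewrite TtE.
Qed.

Lemma analytic_neq0 n (f : 'rV[R]_n -> R) q : analytic_at f q -> f q != 0 ->
  \forall q' \near q, f q' != 0.
Proof.
move=> fa f0; have c : {for q, continuous f} by exact: analytic_cont.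
by have := c _ (open_nbhs_nbhs (conj (@open_neq R 0) f0)).
Qed.

Lemma nondegenerate_near p : nondegenerate_at T X U p ->
  \forall q \near p, nondegenerate_at T X U q.
Proof.
move=> [Ta Xa Ua N0].
have Na : analytic_at (fun q => Tt T q * dx X q * U q) p.
  apply: analyticM; last exact: Ua; apply: analyticM; first exact: analytic_Tt.
  exact: (analytic_derive 'e_1 Xa).
apply: filterS (filterI (filterI (analytic_near Ta) (analytic_near Xa))
  (filterI (analytic_near Ua) (analytic_neq0 Na N0))) => q [[a b] [c d]].
by split.
Qed.

Lemma nondegenerate_neq0 q : nondegenerate_at T X U q ->
  [/\ Tt T q != 0, dx X q != 0 & U q != 0].
Proof. by case=> _ _ _; rewrite !mulf_eq0 !negb_or => /andP[/andP[]]. Qed.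

Definition coefs_rel (th th' : coefs R) (q : 'rV[R]_2) :=
  [/\ cA th' (base T X q) = dx X q ^+ 2 / Tt T q * cA th q,
        cB th' (base T X q) = dx X q / Tt T q * (cB th q - 2 * (dx U q / U q) * cA th q)
                          - (dt X q - cA th q * dx (dx X) q) / Tt T q
      & cC th' (base T X q) = - (U q / Tt T q) * Lop th (fun q' => 1 / U q') q].

Lemma Lop_inv th q : analytic_at U q -> U q != 0 ->
  Lop th (fun q' => 1 / U q') q =
  - dt U q / U q ^+ 2 - cA th q * (2 * dx U q ^+ 2 / U q ^+ 3 - dx (dx U) q / U q ^+ 2)
  + cB th q * dx U q / U q ^+ 2 - cC th q / U q.
Proof.
move=> Ua U0.
have dI i q' : analytic_at U q' -> U q' != 0 ->
    'D_('e_i) (fun q' => 1 / U q') q' = - 'D_('e_i) U q' / U q' ^+ 2.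
  move=> Ua' U0'; have [_ h] := isD_mul (isD_cst 'e_i 1 q') (isD_inv U0' (isD_of 'e_i Ua')).
    by apply: etrans h _; rewrite mul0r add0r mul1r.
have nI : \forall q' \near q, dx (fun q' => 1 / U q') q' = - dx U q' * (U q')^-1 ^+ 2.
  apply: filterS (filterI (analytic_near Ua) (analytic_neq0 Ua U0)) => q' [h1 h2].
  by apply: etrans (dI 1 q' h1 h2) _; rewrite exprVn.
have D2 : dx (dx (fun q' => 1 / U q')) q = 2 * dx U q ^+ 2 / U q ^+ 3 - dx (dx U) q / U q ^+ 2.
  apply: etrans (derive_eq _ nI) _.
  have Uxa : isD 'e_1 (dx U) q (dx (dx U) q) := isD_of 'e_1 (analytic_derive 'e_1 Ua).
  have [_ h] := isD_mul (isD_opp Uxa) (isD_sqr (isD_inv U0 (isD_of 'e_1 Ua))).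
  apply: etrans h _.
  have alg (a b u : R) : u != 0 -> - a * u^-1 ^+ 2 + - b * (2 * u^-1 * (- b / u ^+ 2)) =
    2 * b ^+ 2 / u ^+ 3 - a / u ^+ 2 by move=> u0; field.
  exact: alg.
have hx : dx (fun q' => 1 / U q') q = - dx U q / U q ^+ 2 := dI 1 q Ua U0.
have ht : dt (fun q' => 1 / U q') q = - dt U q / U q ^+ 2 := dI 0 q Ua U0.
rewrite /Lop D2 ht hx.
have alg (a b c d e f u : R) : u != 0 -> - a / u ^+ 2 - b * c - d * (- e / u ^+ 2) - f * (1 / u)
   = - a / u ^+ 2 - b * c + d * e / u ^+ 2 - f / u by move=> u0; field.
exact: alg.
Qed.

End Nondegenerate.

Section Parabolic.
Variable R : realType.

Lemma dt_cst (c : R) : dt (fun=> c) = fun=> 0.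
Proof. by apply/funext => q; exact: derive_cstf. Qed.

Lemma dx_cst (c : R) : dx (fun=> c) = fun=> 0.
Proof. by apply/funext => q; exact: derive_cstf. Qed.

Lemma affine_entry n (w g : 'rV[R]_n) (M : 'M[R]_n) k :
  (w + g *m M) 0 k = w 0 k + \sum_l g 0 l * M l k.
Proof. by rewrite mxE; congr (_ + _); rewrite mxE. Qed.

Lemma parabolic_master (y : 'rV[R]_(2 + 1)) T (X : 'rV[R]_2 -> R) (w0 : 'rV[R]_2 -> 'rV[R]_1)
    (M : 'rV[R]_2 -> 'M[R]_1) th th' (s : 'rV[R]_1) k :
  let q := lsubmx y in let g := rsubmx y 0 0 in
  let w q := w0 q 0 0 in let m q := M q 0 0 in
  let S := (dx w q + (g * dx m q + s 0 0 * m q)) / dx X q in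
  aff_master (@parabolic_rhs R) y T X w0 M th th' s k <->
  dt w q + (g * dt m q + (cB th q * s 0 0 + cC th q * g) * m q) - dt X q * S =
  cA th q * (dx (dx w) q + (g * dx (dx m) q + 2 * s 0 0 * dx m q) - S * dx (dx X) q) +
  Tt T q * (cB th' (base T X q) * S + cC th' (base T X q) * (w q + g * m q)).
Proof.
move=> q g w m S; rewrite /aff_master (ord1 k) !big_ord1 /parabolic_rhs affine_entry big_ord1.
have -> : aff_slope y X w0 M s 0 0 = S by rewrite mxE big_ord1.
by [].
Qed.

Definition lift_u_mx (U : 'rV[R]_2 -> R) (q : 'rV[R]_2) : 'M[R]_1 := const_mx (U q).

Lemma lift_u_aff T X U y : lift_u T X U y = aff T X (fun=> 0) (lift_u_mx U) y.
Proof.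
rewrite /lift_u /aff add0r; congr row_mx; apply/rowP => i.
by rewrite ord1 [LHS]mxE [RHS]mxE big_ord1 [lift_u_mx _ _ _ _]mxE mulrC.
Qed.

Lemma lift_u_analytic T X U q : nondegenerate_at T X U q ->
  aff_analytic T X (fun=> 0) (lift_u_mx U) q.
Proof.
move=> [Ta Xa Ua _]; split; [exact: Ta | exact: Xa | |].
  by move=> k; exact: analytic_cst.
by move=> l k; apply: analytic_ext Ua => q'; rewrite mxE.
Qed.

Definition lift_u_inv (U : 'rV[R]_2 -> R) (q : 'rV[R]_2) : 'M[R]_1 := const_mx (U q)^-1.

Lemma lift_u_invK T X U q : nondegenerate_at T X U q ->
  lift_u_mx U q *m lift_u_inv U q = 1%:M.
Proof.
move=> /nondegenerate_neq0[_ _ U0]; apply/matrixP => l k.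
by rewrite !ord1 mxE big_ord1 !mxE mulfV.
Qed.

Lemma lift_u_unit T X U q : nondegenerate_at T X U q -> lift_u_mx U q \in unitmx.
Proof. by case/lift_u_invK/mulmx1_unit. Qed.

Lemma lift_u_master (y : 'rV[R]_(2 + 1)) T (X U : 'rV[R]_2 -> R) th th' (s : 'rV[R]_1) k :
  let q := lsubmx y in let g := rsubmx y 0 0 in
  let S := (g * dx U q + s 0 0 * U q) / dx X q in
  aff_master (@parabolic_rhs R) y T X (fun=> 0) (lift_u_mx U) th th' s k <->
  g * dt U q + (cB th q * s 0 0 + cC th q * g) * U q - dt X q * S =
  cA th q * (g * dx (dx U) q + 2 * s 0 0 * dx U q - S * dx (dx X) q) +
  Tt T q * (cB th' (base T X q) * S + cC th' (base T X q) * (g * U q)).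
Proof.
move=> q g S; have [] := parabolic_master y T X (fun=> 0) (lift_u_mx U) th th' s k.
rewrite -/q -/g.
have UE : (fun q => lift_u_mx U q 0 0) = U by apply/funext => q'; rewrite mxE.
have ZE : (fun _ : 'rV[R]_2 => (0 : 'rV[R]_1) 0 0) = fun=> 0 by apply/funext => q'; rewrite mxE.
rewrite UE ZE !dx_cst dt_cst.
have e0 : (0 : 'rV[R]_1) 0 0 = 0 by rewrite mxE.
have eU : lift_u_mx U q 0 0 = U q by rewrite mxE.
by rewrite e0 eU !add0r.
Qed.

Lemma lift_u_rel (y : 'rV[R]_(2 + 1)) T X U th th' :
  nondegenerate_at T X U (lsubmx y) -> coefs_rel T X U th th' (lsubmx y) ->
  forall s k, aff_master (@parabolic_rhs R) y T X (fun=> 0) (lift_u_mx U) th th' s k.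
Proof.
move=> nd [A' B' C'] s k; apply/lift_u_master; rewrite B' C'.
have [T0 X0 U0] := nondegenerate_neq0 nd; have [_ _ Ua _] := nd.
rewrite (Lop_inv th Ua U0).
move: T0 X0 U0; gen_derive; move: (Tt T _) (U _) => tt u T0 X0 U0.
by field; rewrite T0 X0 U0.
Qed.

(** Form of all later eliminations: the unknown x is certified by multipliers k1, k2 of two
    vanishing expressions and a nonzero factor c. Only a rational identity remains, for [ring] or
    [field]. *)
Lemma linear_solve (k1 k2 c d1 d2 x y : R) : c != 0 -> d1 = 0 -> d2 = 0 ->
  c * (x - y) = k1 * d1 + k2 * d2 -> x = y.
Proof.
move=> c0 -> -> /eqP; rewrite !mulr0 addr0 mulf_eq0 (negPf c0) subr_eq0.
by move/eqP.
Qed.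

(** B' comes from the difference of the identities at slopes 1 and 0, and then C' from the
    difference at the fibre values a and b. *)
Lemma lift_u_solve (tt xx xt xxx u ux ut uxx A B C A' B' C' a b : R) :
  let E g s := let S := (g * ux + s * u) / xx in
    g * ut + (B * s + C * g) * u - xt * S =
    A * (g * uxx + 2 * s * ux - S * xxx) + tt * (B' * S + C' * (g * u)) in
  tt != 0 -> xx != 0 -> u != 0 -> a - b != 0 -> E a 1 -> E a 0 -> E b 0 ->
  A * xx ^+ 2 = A' * tt ->
  [/\ A' = xx ^+ 2 / tt * A,
    B' = xx / tt * (B - 2 * (ux / u) * A) - (xt - A * xxx) / tt
  & C' = - (u / tt) * (- ut / u ^+ 2 - A * (2 * ux ^+ 2 / u ^+ 3 - uxx / u ^+ 2)
      + B * ux / u ^+ 2 - C / u)].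
Proof.
move=> E t0 x0 u0 ab; rewrite {}/E => /eqP; rewrite -subr_eq0 => /eqP ea1 /eqP.
rewrite -subr_eq0 => /eqP ea0 /eqP; rewrite -subr_eq0 => /eqP eb0 hA.
have c0 : - (tt * u / xx) != 0 by rewrite oppr_eq0 !mulf_neq0 ?invr_eq0.
have hB : B' = xx / tt * (B - 2 * (ux / u) * A) - (xt - A * xxx) / tt.
  by apply: (linear_solve (k1 := 1) (k2 := -1) c0 ea1 ea0); field; rewrite t0 x0 u0.
split; [by apply: (mulIf t0); rewrite -hA; field | exact: hB |].
have c1 : - (tt * u * (a - b)) != 0 by rewrite oppr_eq0 !mulf_neq0.
apply: (linear_solve (k1 := 1) (k2 := -1) c1 ea0 eb0); rewrite hB.
by field; rewrite t0 x0 u0.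
Qed.

Lemma rel_lift_u q (g1 g2 : 'rV[R]_1) T (X U : 'rV[R]_2 -> R) th th' :
  nondegenerate_at T X U q -> g1 0 0 - g2 0 0 != 0 ->
  cA th q * dx X q ^+ 2 = cA th' (base T X q) * Tt T q ->
  (forall g s k, g = g1 \/ g = g2 ->
    aff_master (@parabolic_rhs R) (row_mx q g) T X (fun=> 0) (lift_u_mx U) th th' s k) ->
  coefs_rel T X U th th' q.
Proof.
move=> nd g12 hA hM; have [T0 X0 U0] := nondegenerate_neq0 nd; have [_ _ Ua _] := nd.
have hm g s h := (lift_u_master (row_mx q g) T X U th th' s 0).1 (hM g s 0 h).
rewrite /coefs_rel (Lop_inv th Ua U0).
have e1 := hm _ (const_mx 1) (or_introl erefl); have e2 := hm _ 0 (or_introl erefl).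
have e3 := hm _ 0 (or_intror erefl).
move: e1 e2 e3; rewrite !row_mxKl !row_mxKr (mxE _ (fun _ _ => 1)) (mxE _ (fun _ _ => 0)).
move=> e1 e2 e3; exact: (lift_u_solve T0 X0 U0 g12 e1 e2 e3 hA).
Qed.

End Parabolic.

(** * From single points to germs *)

Section MapsSystem.
Variable R : realType.
Variable n : nat.
Variable E : system_class R n.
Variable H : coefs R -> 'rV[R]_2 -> 'rV[R]_n -> 'rV[R]_n -> 'I_n -> R.

Lemma analytic_base (T : R -> R) (X : 'rV[R]_2 -> R) q :
  analytic_at (fun q : 'rV[R]_2 => T (q 0 0)) q -> analytic_at X q ->
  analytic_map_at (base T X) q.
Proof.
move=> Ta Xa; apply: ord2P.
  by apply: analytic_ext Ta => q'; rewrite mxE.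
by apply: analytic_ext Xa => q'; rewrite mxE.
Qed.

Lemma aff_map_analytic T X w0 (M : 'rV[R]_2 -> 'M[R]_n) y :
  aff_analytic T X w0 M (lsubmx y) -> analytic_map_at (aff T X w0 M) y.
Proof.
move=> [Ta Xa wa Ma].
have la : analytic_map_at (fun y : 'rV[R]_(2 + n) => lsubmx y) y.
  by apply: analytic_lsubmx; exact: analytic_map_id.
have ra : analytic_map_at (fun y : 'rV[R]_(2 + n) => rsubmx y) y.
  by apply: analytic_rsubmx; exact: analytic_map_id.
apply: analytic_map_row_mx.
  exact: (analytic_map_comp la (analytic_base Ta Xa)).
move=> k; apply: (analytic_ext (f := fun y : 'rV[R]_(2 + n) =>
  w0 (lsubmx y) 0 k + \sum_l rsubmx y 0 l * M (lsubmx y) l k)).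
  by move=> y'; rewrite affine_entry.
apply: analyticD; first exact: (analytic_comp la (wa k)).
apply: analytic_sum => l; apply: analyticM; first exact: ra.
exact: (analytic_comp la (Ma l k)).
Qed.

Lemma analytic_map_eq m k (f g : 'rV[R]_m -> 'rV[R]_k) a :
  germ_eq a f g -> analytic_map_at f a -> analytic_map_at g a.
Proof.
by move=> fg fa i; apply: analytic_eq (fa i); apply: filterS fg => q ->.
Qed.

Lemma germ_eq_sym m k (f g : 'rV[R]_m -> 'rV[R]_k) a : germ_eq a f g -> germ_eq a g f.
Proof. by apply: filterS => q ->. Qed.

Lemma maps_system_aff Phi z T X w0 M th th' : (0 < n)%N -> evolution E H ->
  germ_eq z Phi (aff T X w0 M) ->
  (\forall q \near lsubmx z, [/\ aff_analytic T X w0 M q, Tt T q != 0, dx X q != 0,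
    M q \in unitmx & cA th q != 0]) ->
  maps_system E Phi z th th' <->
  \forall y \near z, let q := lsubmx y in
    cA th q * dx X q ^+ 2 = cA th' (base T X q) * Tt T q /\
    forall s k, aff_master H y T X w0 M th th' s k.
Proof.
move=> n0 EH PA /near_lsubmx nq.
have hy : \forall y \near z,
    (maps_at E Phi y th th' <-> let q := lsubmx y in
    cA th q * dx X q ^+ 2 = cA th' (base T X q) * Tt T q /\
    forall s k, aff_master H y T X w0 M th th' s k).
  apply: filterS (filterI (near_join PA) nq) => y [PAy [an T0 X0 Mu A0]].
  have Py := analytic_map_eq (germ_eq_sym PAy) (aff_map_analytic an).
  have [h1 h2] := maps_aff Py PAy an th' n0 EH T0 X0 A0.
  by split; [exact: h1 | case=> hA hM; exact: (h2 Mu hA hM)].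
by split=> h; apply: filterS (filterI hy h) => y [[h1 h2] hh]; [exact: h1 | exact: h2].
Qed.

End MapsSystem.

Section ParabolicMaps.
Variable R : realType.

Lemma parabolic_maps Phi (z : 'rV[R]_(2 + 1)) T X U th th' :
  germ_eq z Phi (lift_u T X U) -> nondegenerate_at T X U (lsubmx z) ->
  admissible th (lsubmx z) ->
  maps_system (@parabolic R) Phi z th th' <-> coefs_transformed T X U (lsubmx z) th th'.
Proof.
move=> PU nd [Aa _ _ A0]; have ndn := nondegenerate_near nd.
have PA : germ_eq z Phi (aff T X (fun=> 0) (lift_u_mx U)).
  by apply: filterS PU => y ->; exact: lift_u_aff.
have nq : \forall q \near lsubmx z, [/\ aff_analytic T X (fun=> 0) (lift_u_mx U) q,
    Tt T q != 0, dx X q != 0, lift_u_mx U q \in unitmx & cA th q != 0].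
  apply: filterS (filterI ndn (analytic_neq0 Aa A0)) => q [h hA].
  have [T0 X0 _] := nondegenerate_neq0 h.
  split; [exact: lift_u_analytic | exact: T0 | exact: X0 | exact: (lift_u_unit h) | exact: hA].
have -> := maps_system_aff th' (ltn0Sn 0) (@parabolic_evolution R) PA nq.
split=> [/near_fibre[r r0 h]|h].
  apply: filterS (filterI ndn h) => q [ndq hv].
  have v0 : in_box r (0 : 'rV[R]_1) by move=> i; rewrite mxE normr0 ltW.
  have v1 : in_box r (const_mx r : 'rV[R]_1) by move=> i; rewrite mxE gtr0_norm.
  apply: (rel_lift_u (g1 := rsubmx z + const_mx r) (g2 := rsubmx z + 0) ndq).
  - by rewrite !mxE addr0 [_ + r]addrC addrK gt_eqF.
  - by have [] := hv _ v0; rewrite row_mxKl.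
  - by move=> g s k [->|->]; [have [_ e] := hv _ v1 | have [_ e] := hv _ v0]; exact: e.
apply: filterS (filterI (near_lsubmx ndn) (near_lsubmx h)) => y [ndy rel] /=.
split; last exact: lift_u_rel.
have [-> _ _] := rel; have [T0 _ _] := nondegenerate_neq0 ndy.
by move: T0; gen_derive; move: (Tt T _) => tt t0; field.
Qed.

End ParabolicMaps.

(** * Two test sources, and the shape of parabolic equivalences *)

Section Classification.
Variable R : realType.

Definition class_data n (H : coefs R -> 'rV[R]_2 -> 'rV[R]_n -> 'rV[R]_n -> 'I_n -> R)
    T X w0 M (g0 : 'rV[R]_n) r c (th' : coefs R) (q : 'rV[R]_2) :=
  dx X q ^+ 2 = cA th' (base T X q) * Tt T q /\
  forall v, in_box r v -> forall s k,
    aff_master H (row_mx q (g0 + v)) T X w0 M (test_coefs c) th' s k.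

(** The two targets are chosen once, at z, and serve all nearby points because [maps_system] speaks
    of a neighbourhood. The resulting relations may therefore be differentiated in q. *)
Lemma equivalence_aff n (E : system_class R n) H Phi z : (0 < n)%N -> evolution E H ->
  (forall th p g s v k, H th p g (s + v) k + H th p g (s - v) k = 2 * H th p g s k) ->
  equivalence E Phi z -> exists T X w0 M (th0 th1 : coefs R) r,
    [/\ 0 < r, germ_eq z Phi (aff T X w0 M),
      admissible th0 (base T X (lsubmx z)), admissible th1 (base T X (lsubmx z))
    & \forall q \near lsubmx z,
      [/\ aff_analytic T X w0 M q, Tt T q != 0, dx X q != 0, M q \in unitmx
        & class_data H T X w0 M (rsubmx z) r 0 th0 q /\
          class_data H T X w0 M (rsubmx z) r 1 th1 q]].
Proof.
move=> n0 EH HA eqz; have [T [X [w0 [M TX]]]] := affine_ex n0 EH HA eqz.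
have [_ eqz0] := nbhs_singleton eqz.
have [th0 a0 m0] := eqz0 _ (admissible_test 0 (lsubmx z)).
have [th1 a1 m1] := eqz0 _ (admissible_test 1 (lsubmx z)).
have PA : germ_eq z Phi (aff T X w0 M) by apply: filterS TX => y [].
have bz : lsubmx (Phi z) = base T X (lsubmx z).
  by rewrite (nbhs_singleton PA) /aff row_mxKl.
rewrite bz in a0 a1.
have hn : \forall y \near z, let q := lsubmx y in
    [/\ aff_analytic T X w0 M q, Tt T q != 0, dx X q != 0, M q \in unitmx
      & (dx X q ^+ 2 = cA th0 (base T X q) * Tt T q /\
         forall s k, aff_master H y T X w0 M (test_coefs 0) th0 s k) /\
        (dx X q ^+ 2 = cA th1 (base T X q) * Tt T q /\
         forall s k, aff_master H y T X w0 M (test_coefs 1) th1 s k)].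
  apply: filterS (filterI (near_join PA) (filterI TX (filterI m0 m1))).
  move=> y [PAy [[[Pt _] _ an [T0 X0]] [m0y m1y]]] q.
  have Py := Pt.1.
  have A0 : (1 : R) != 0 := oner_neq0 R.
  have [h0 _] := maps_aff Py PAy an th0 n0 EH T0 X0 (A0 : cA (test_coefs 0) q != 0).
  have [h1 _] := maps_aff Py PAy an th1 n0 EH T0 X0 (A0 : cA (test_coefs 1) q != 0).
  have [e0 M0] := h0 m0y; have [e1 M1] := h1 m1y.
  split; [exact: an | exact: T0 | exact: X0 | exact: (aff_unit Py PAy an Pt T0 X0) |].
  split; split; [by rewrite -e0 mul1r | exact: M0 | by rewrite -e1 mul1r | exact: M1].
have [r r0 hr] := near_fibre hn; exists T, X, w0, M, th0, th1, r.
split; [exact: r0 | exact: PA | exact: a0 | exact: a1 |].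
apply: filterS hr => q hv.
have v0 : in_box r (0 : 'rV[R]_n) by move=> i; rewrite mxE normr0 ltW.
have := hv _ v0; rewrite row_mxKl => -[an T0 X0 Mu [[e0 _] [e1 _]]].
split; [exact: an | exact: T0 | exact: X0 | exact: Mu |].
split; split; [exact: e0 | | exact: e1 |] => v vr.
  by have [_ _ _ _ [[_ h] _]] := hv _ vr; exact: h.
by have [_ _ _ _ [_ [_ h]]] := hv _ vr; exact: h.
Qed.

(** The coefficient of s gives equal B' for both targets. The dependence on g gives T_t (c1 - c0) =
    1. Then the difference of the two identities reads g m = w + g m. *)
Lemma parabolic_solve (tt xx xt xxx w wx wt wxx m mx mt mxx b0 c0 b1 c1 g r : R) :
  let E b c' c g s := let S := (wx + (g * mx + s * m)) / xx in
    wt + (g * mt + (0 * s + c * g) * m) - xt * S =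
    1 * (wxx + (g * mxx + 2 * s * mx) - S * xxx) + tt * (b * S + c' * (w + g * m)) in
  tt != 0 -> xx != 0 -> m != 0 -> r != 0 ->
  (forall g', g' = g \/ g' = g + r -> forall s, E b0 c0 0 g' s /\ E b1 c1 1 g' s) -> w = 0.
Proof.
move=> E t0 x0 m0 r0 h.
pose D b c' c g s := let S := (wx + (g * mx + s * m)) / xx in
    wt + (g * mt + (0 * s + c * g) * m) - xt * S -
    (1 * (wxx + (g * mxx + 2 * s * mx) - S * xxx) + tt * (b * S + c' * (w + g * m))).
have hD g' s : g' = g \/ g' = g + r -> D b0 c0 0 g' s = 0 /\ D b1 c1 1 g' s = 0.
  by move=> /h/(_ s)[]; rewrite /E /D /= => -> ->; rewrite !subrr.
have [d00 d10] := hD g 0 (or_introl erefl); have [d01 d11] := hD g 1 (or_introl erefl).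
have [f00 f10] := hD (g + r) 0 (or_intror erefl).
have e0 : D b0 c0 0 g 1 - D b0 c0 0 g 0 = 0 by rewrite d00 d01 subrr.
have e1 : D b1 c1 1 g 1 - D b1 c1 1 g 0 = 0 by rewrite d10 d11 subrr.
have c1nz : tt * m / xx != 0 by rewrite !mulf_neq0 ?invr_eq0.
have bE : b0 = b1.
  by apply: (linear_solve (k1 := -1) (k2 := 1) c1nz e0 e1); rewrite /D; field; rewrite x0.
have e2 : D b1 c1 1 g 0 - D b0 c0 0 g 0 = 0 by rewrite d10 d00 subrr.
have e3 : D b1 c1 1 (g + r) 0 - D b0 c0 0 (g + r) 0 = 0 by rewrite f10 f00 subrr.
have rm : r * m != 0 by rewrite mulf_neq0.
have dE : tt * (c1 - c0) = 1.
  by apply: (linear_solve (k1 := 1) (k2 := -1) rm e2 e3); rewrite /D bE; ring.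
have := e2; rewrite /D bE => e; apply: (linear_solve (k1 := -1) (k2 := 0) (oner_neq0 R) e e).
have -> : c1 = c0 + tt^-1 by rewrite -[tt^-1]mulr1 -dE mulKf// addrC subrK.
by field; rewrite t0 x0.
Qed.

Lemma parabolic_class Phi (z : 'rV[R]_(2 + 1)) : equivalence (@parabolic R) Phi z ->
  exists T X U, nondegenerate_at T X U (lsubmx z) /\ germ_eq z Phi (lift_u T X U).
Proof.
move=> eqz.
have [T [X [w0 [M [th0 [th1 [r [r0 PA _ _ hq]]]]]]]] :=
  equivalence_aff (ltn0Sn 0) (@parabolic_evolution R) (@parabolic_rhs_affine R) eqz.
pose U q := M q 0 0.
have U0 q : M q \in unitmx -> U q != 0.
  by rewrite unitmxE (mx11_scalar (M q)) det_scalar1 unitfE.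
have wq : \forall q \near lsubmx z, w0 q = 0.
  apply: filterS hq => q [an T0 X0 Mu [[_ h0] [_ h1]]].
  apply/rowP => k; rewrite (ord1 k) [RHS]mxE.
  have m0 := U0 _ Mu.
  apply: (parabolic_solve (g := rsubmx z 0 0) T0 X0 m0 (lt0r_neq0 r0)) => g' hg s.
  pose v : 'rV[R]_1 := const_mx (g' - rsubmx z 0 0).
  have vr : in_box r v.
    move=> i; rewrite mxE; case: hg => ->; first by rewrite subrr normr0 ltW.
    by rewrite addrC addKr gtr0_norm.
  have gE : (rsubmx z + v) 0 0 = g' by rewrite mxE [v 0 0]mxE addrC subrK.
  have k0 := (parabolic_master _ _ _ _ _ _ _ _ _).1 (h0 v vr (const_mx s) 0).
  have k1 := (parabolic_master _ _ _ _ _ _ _ _ _).1 (h1 v vr (const_mx s) 0).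
  move: k0 k1; rewrite row_mxKl row_mxKr gE (mxE _ (fun _ _ => s)) => k0 k1.
  by split; [exact: k0 | exact: k1].
exists T, X, U; have [[Ta Xa wa Ma] T0 X0 Mu _] := nbhs_singleton hq; split.
  by split; [exact: Ta | exact: Xa | exact: Ma | rewrite !mulf_neq0// U0].
apply: filterS (filterI PA (near_lsubmx wq)) => y [-> w].
rewrite lift_u_aff /aff w; congr (row_mx _ (_ + _ *m _)).
by apply/matrixP => i j; rewrite mxE !ord1.
Qed.

End Classification.

(** * Determining equations *)

Section DE1Algebra.
Variable R : realType.
(* [tt], [xt], [xx], [xxx] stand for T_t, X_t, X_x, X_xx at a point, [w] and [m]
   for w0 and M, and the suffixes t, x, xx for derivatives. *)
Variables (tt xt xx xxx A' Ax' At' : R) (w wt wx wxx : 'I_3 -> R).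
Variables (m mt mx mxx : 'I_3 -> 'I_3 -> R).

Definition jet_slope (g0 g1 g2 s0 s1 s2 : R) k := (wx k + (g0 * mx 0 k + s0 * m 0 k
  + (g1 * mx 1 k + s1 * m 1 k) + (g2 * mx 2 k + s2 * m 2 k))) / xx.

Definition jet_value (g0 g1 g2 : R) k := w k + (g0 * m 0 k + g1 * m 1 k + g2 * m 2 k).

(* The master identity for DE1 at the source coefficients A = 1, B = 0, C = c. *)
Definition test_lhs c (g0 g1 g2 s0 s1 s2 : R) k :=
  wt k + (g0 * mt 0 k + (- (2 * s0 * g0) - 2 * s1) * m 0 k
    + (g1 * mt 1 k + - (2 * s0 * (g1 - c)) * m 1 k)
    + (g2 * mt 2 k + (- (2 * s0 * g2) + c * g2) * m 2 k))
  - xt * jet_slope g0 g1 g2 s0 s1 s2 k.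

Definition test_rhs (b bx bt c' cx ct : R) (g0 g1 g2 s0 s1 s2 : R) k :=
  let S := jet_slope g0 g1 g2 s0 s1 s2 in let G := jet_value g0 g1 g2 in
  let K := 2 * S 0 - Ax' / A' * G 0 - At' / A' in
  1 * (wxx k + (g0 * mxx 0 k + 2 * s0 * mx 0 k + (g1 * mxx 1 k + 2 * s1 * mx 1 k)
    + (g2 * mxx 2 k + 2 * s2 * mx 2 k)) - S k * xxx)
  + tt * [:: b * S 0 - K * (G 0 + b) - bx * G 0 - 2 * A' * S 1 - bt;
             b * S 1 - K * (G 1 - c') + cx * G 0 + ct;
             b * S 2 - K * G 2 + c' * G 2]`_k.

Let G := jet_value.

(* The coefficient of s_j in the master identity. *)
Definition slope_coef b c c' (j k : 'I_3) (g0 g1 g2 : R) :=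
  [:: - (2 * (g0 * m 0 k + g1 * m 1 k + g2 * m 2 k)) + 2 * c * m 1 k; - (2 * m 0 k); 0]`_j
  - xt * (m j k / xx) - (2 * mx j k - m j k / xx * xxx
    + tt * [:: b * (m j 0 / xx) - 2 * (m j 0 / xx) * (G g0 g1 g2 0 + b) - 2 * A' * (m j 1 / xx);
               b * (m j 1 / xx) - 2 * (m j 0 / xx) * (G g0 g1 g2 1 - c');
               b * (m j 2 / xx) - 2 * (m j 0 / xx) * G g0 g1 g2 2]`_k).

(** The identity is affine in s, so its coefficient of s_j is the difference of the instances s =
    e_j and s = 0. The derivatives of the target coefficients cancel in this difference. *)
Lemma slope_coefP b bx bt c c' cx ct g0 g1 g2 : xx != 0 -> A' != 0 ->
  (forall s0 s1 s2 k, test_lhs c g0 g1 g2 s0 s1 s2 k =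
    test_rhs b bx bt c' cx ct g0 g1 g2 s0 s1 s2 k) ->
  forall j k, slope_coef b c c' j k g0 g1 g2 = 0.
Proof.
move=> x0 A0 h j k.
have hD s0 s1 s2 : test_lhs c g0 g1 g2 s0 s1 s2 k -
   test_rhs b bx bt c' cx ct g0 g1 g2 s0 s1 s2 k = 0 by rewrite h subrr.
have h0 := hD 0 0 0; have h1 := hD (j == 0)%:R (j == 1)%:R (j == 2)%:R.
apply: (linear_solve (k1 := 1) (k2 := -1) (oner_neq0 R) h1 h0).
rewrite /slope_coef /G /test_lhs /test_rhs /jet_slope /jet_value.
move: j k {h hD h0 h1}; apply: ord3P; apply: ord3P => /=.
all: by field; rewrite x0 A0.
Qed.

Section Solve.
Variables (c b c' h0 h1 h2 r : R).
Hypotheses (t0 : tt != 0) (x0 : xx != 0) (r0 : 0 < r) (AE : xx ^+ 2 = A' * tt).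
Hypothesis fs : forall v0 v1 v2, `|v0| <= r -> `|v1| <= r -> `|v2| <= r ->
  forall j k, slope_coef b c c' j k (h0 + v0) (h1 + v1) (h2 + v2) = 0.

Let fs0 j k : slope_coef b c c' j k (h0 + 0) (h1 + 0) (h2 + 0) = 0.
Proof. by apply: fs; rewrite normr0 ltW. Qed.

Let rN0 : r != 0. Proof. exact: lt0r_neq0. Qed.

Let r0' : `|0 : R| <= r. Proof. by rewrite normr0 ltW. Qed.

Let rr : `|r| <= r. Proof. by rewrite gtr0_norm. Qed.

Let A'E : A' = xx ^+ 2 / tt. Proof. by rewrite AE mulfK. Qed.

(** In the first equation the coefficient of s_2 contains m20 times the transformed g^1, which
    contains g2 m20. Moving g2 by r therefore isolates the square of m20; the same happens to m10
    with g1. *)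
Lemma solve_m20 : m 2 0 = 0.
Proof.
have h := fs r0' r0' rr 2 0.
have : m 2 0 ^+ 2 = 0.
  have c0 : 2 * tt * r / xx != 0 by rewrite !mulf_neq0 ?invr_eq0// pnatr_eq0.
  apply: (linear_solve (k1 := 1) (k2 := -1) c0 h (fs0 2 0)).
  by rewrite /slope_coef /G /jet_value /=; field; rewrite x0.
by move/eqP; rewrite sqrf_eq0 => /eqP.
Qed.

Lemma solve_m10 : m 1 0 = 0.
Proof.
have h := fs r0' rr r0' 1 0.
have : m 1 0 ^+ 2 = 0.
  have c0 : 2 * tt * r / xx != 0 by rewrite !mulf_neq0 ?invr_eq0// pnatr_eq0.
  apply: (linear_solve (k1 := 1) (k2 := -1) c0 h (fs0 1 0)).
  by rewrite /slope_coef /G /jet_value /=; field; rewrite x0.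
by move/eqP; rewrite sqrf_eq0 => /eqP.
Qed.

(** Moving g0 by r in the coefficient of s_0 leaves m00 (T_t m00 - X_x) = 0 up to a nonzero factor;
    the invertibility of M will exclude m00 = 0. *)
Lemma solve_m00 : m 0 0 != 0 -> m 0 0 = xx / tt.
Proof.
move=> m0; have h := fs rr r0' r0' 0 0.
have c0 : 2 * tt * r / xx * m 0 0 != 0 by rewrite !mulf_neq0 ?invr_eq0// pnatr_eq0.
apply: (linear_solve (k1 := 1) (k2 := -1) c0 h (fs0 0 0)).
by rewrite /slope_coef /G /jet_value /=; field; rewrite x0.
Qed.

Hypotheses (m00 : m 0 0 = xx / tt) (m10 : m 1 0 = 0) (m20 : m 2 0 = 0).
Hypotheses (mx10 : mx 1 0 = 0) (mx20 : mx 2 0 = 0).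

Lemma solve_m11 : m 1 1 = 1 / tt.
Proof.
have c0 : 2 * xx != 0 by rewrite mulf_neq0// pnatr_eq0.
apply: (linear_solve (k1 := 1) (k2 := 0) c0 (fs0 1 0) (fs0 1 0)).
by rewrite /slope_coef /G /jet_value /= m10 mx10 m00 A'E; field; rewrite x0 t0.
Qed.

Lemma solve_m21 : m 2 1 = 0.
Proof.
have c0 : 2 * xx != 0 by rewrite mulf_neq0// pnatr_eq0.
apply: (linear_solve (k1 := 1) (k2 := 0) c0 (fs0 2 0) (fs0 2 0)).
by rewrite /slope_coef /G /jet_value /= m20 mx20 A'E; field; rewrite x0 t0.
Qed.

Hypotheses (m11 : m 1 1 = 1 / tt) (m21 : m 2 1 = 0).
Hypotheses (mx00 : mx 0 0 = xxx / tt) (mx11 : mx 1 1 = 0) (mx21 : mx 2 1 = 0).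

Lemma solve_b : b = - 2 * xx * m 0 1 - xt / tt + xxx / tt.
Proof.
have c0 : - 1 / xx != 0 :> R by rewrite mulf_neq0 ?invr_eq0// oppr_eq0 oner_neq0.
apply: (linear_solve (k1 := 1) (k2 := 0) c0 (fs0 1 1) (fs0 1 0)).
by rewrite /slope_coef /G /jet_value /= m10 mx11 m11 A'E; field; rewrite x0 t0.
Qed.

Lemma solve_w0 : w 0 = xt / tt.
Proof.
have c0 : 2 != 0 :> R by rewrite pnatr_eq0.
apply: (linear_solve (k1 := 1) (k2 := 0) c0 (fs0 0 0) (fs0 1 0)).
rewrite /slope_coef /G /jet_value /= m10 m20 m00 mx00 solve_b A'E.
by field; rewrite x0 t0.
Qed.

Hypotheses (m12 : m 1 2 = 0) (mx12 : mx 1 2 = 0).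

Lemma solve_m02 : m 0 2 = 0.
Proof.
have c0 : - 2 != 0 :> R by rewrite oppr_eq0 pnatr_eq0.
apply: (linear_solve (k1 := 1) (k2 := 0) c0 (fs0 1 2) (fs0 1 0)).
by rewrite /slope_coef /G /jet_value /= m10 m12 mx12; field; rewrite x0.
Qed.

Hypotheses (m02 : m 0 2 = 0) (mx02 : mx 0 2 = 0).

Lemma solve_w2 : w 2 = 0.
Proof.
have c0 : 2 != 0 :> R by rewrite pnatr_eq0.
apply: (linear_solve (k1 := 1) (k2 := 0) c0 (fs0 0 2) (fs0 1 0)).
by rewrite /slope_coef /G /jet_value /= m02 m12 mx02 m00; field; rewrite x0 t0.
Qed.

Lemma solve_m01 : m 2 2 != 0 -> m 0 1 = mx 2 2 / (tt * m 2 2).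
Proof.
move=> m22; have c0 : 2 * tt * m 2 2 != 0 :> R by rewrite !mulf_neq0// pnatr_eq0.
apply: (linear_solve (k1 := 1) (k2 := 0) c0 (fs0 2 2) (fs0 1 0)).
by rewrite /slope_coef /G /jet_value /= m20 solve_b; field; rewrite x0 t0 m22.
Qed.

Lemma solve_c : c' = c / tt - (xt * m 0 1 / xx + 2 * mx 0 1 - m 0 1 * xxx / xx
  + tt * b * m 0 1 / xx) / 2 + w 1.
Proof.
have c0 : - 2 != 0 :> R by rewrite oppr_eq0 pnatr_eq0.
apply: (linear_solve (k1 := 1) (k2 := 0) c0 (fs0 0 1) (fs0 1 0)).
by rewrite /slope_coef /G /jet_value /= m11 m21 m00; field; rewrite x0 t0.
Qed.

Variables (bx bt cx ct ttt xtx : R).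
Hypotheses (wt2 : wt 2 = 0) (wx2 : wx 2 = 0) (wxx2 : wxx 2 = 0).
Hypotheses (mt02 : mt 0 2 = 0) (mxx02 : mxx 0 2 = 0) (mt12 : mt 1 2 = 0) (mxx12 : mxx 1 2 = 0).
Hypotheses (wx0 : wx 0 = xtx / tt).
Hypotheses (mx01 : mx 0 1 = (mxx 2 2 * m 2 2 - mx 2 2 ^+ 2) / (tt * m 2 2 ^+ 2)).
Hypotheses (Ax : Ax' * xx / A' = 2 * xxx / xx).
Hypotheses (At : (At' * tt + Ax' * xt) / A' = 2 * xtx / xx - ttt / tt).

(** The coefficients of s contain w1 only in the combination w1 - C', which [solve_c] fixes. The
    missing relation is the third equation at s = 0, where A'_x and A'_t appear; after all
    substitutions it is proportional to g2. *)
Lemma solve_w1 (g0 g1 g2 : R) : m 2 2 != 0 -> g2 != 0 ->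
  (forall s0 s1 s2 k, test_lhs c g0 g1 g2 s0 s1 s2 k =
    test_rhs b bx bt c' cx ct g0 g1 g2 s0 s1 s2 k) ->
  w 1 = (ttt * m 2 2 + tt * mt 2 2) / (tt * (tt * m 2 2)).
Proof.
move=> m22 g20 /(_ 0 0 0 2)/eqP; rewrite -subr_eq0 => /eqP.
rewrite /test_lhs /test_rhs /jet_slope /jet_value /=.
have A0 : A' != 0 by rewrite A'E !mulf_neq0 ?invr_eq0 ?sqrf_eq0.
have -> : Ax' / A' = 2 * xxx / xx ^+ 2.
  by apply: (mulIf x0); rewrite mulrAC Ax; field.
have -> : At' / A' = (2 * xtx / xx - ttt / tt - 2 * xxx / xx ^+ 2 * xt) / tt.
  apply: (mulIf t0); rewrite divfK//; rewrite -At; apply/eqP.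
  rewrite -subr_eq0; apply/eqP.
  have -> : 2 * xxx / xx ^+ 2 = Ax' / A' by apply: (mulIf x0); rewrite [RHS]mulrAC Ax; field.
  by field.
rewrite wt2 wx2 wxx2 mt02 mxx02 mt12 mxx12 m02 mx02 m12 mx12 wx0 mx00 mx10 mx20 m00 m10 m20.
rewrite solve_w2 solve_w0 solve_c solve_b mx01 solve_m01// => h.
have c0 : - (tt * m 2 2 * g2) != 0 by rewrite oppr_eq0 !mulf_neq0.
apply: (linear_solve (k1 := 1) (k2 := 0) c0 h h).
by field; rewrite x0 t0 m22.
Qed.

End Solve.

(** The source C contributes 2 c m12 to the coefficient of s_0 in the third equation, where the
    target C' does not occur. Subtracting the sources c = 0 and c = 1, with equal B', leaves 2
    m12. *)
Lemma solve_m12 b c0 c1 g0 g1 g2 :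
  slope_coef b 0 c0 0 2 g0 g1 g2 = 0 -> slope_coef b 1 c1 0 2 g0 g1 g2 = 0 -> m 1 2 = 0.
Proof.
move=> e0 e1; have nz : 2 != 0 :> R by rewrite pnatr_eq0.
apply: (linear_solve (k1 := 1) (k2 := -1) nz e1 e0); rewrite /slope_coef /G /jet_value /=.
by ring.
Qed.

End DE1Algebra.

Section DE1Master.
Variable R : realType.

Lemma DE1_rhs_test c p (g s : 'rV[R]_3) k : DE1_rhs (test_coefs c) p g s k =
  [:: - (2 * s 0 0 * g 0 0) - 2 * s 0 1; - (2 * s 0 0 * (g 0 1 - c));
      - (2 * s 0 0 * g 0 2) + c * g 0 2]`_k.
Proof.
rewrite /DE1_rhs /= !dx_cst !dt_cst; move: k.
move: (s 0 0) (s 0 1) (s 0 2) (g 0 0) (g 0 1) (g 0 2) => s0 s1 s2 g0 g1 g2.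
by apply: ord3P => /=; field.
Qed.

Lemma DE1_test_master (y : 'rV[R]_(2 + 3)) T (X : 'rV[R]_2 -> R)
    (w0 : 'rV[R]_2 -> 'rV[R]_3) (M : 'rV[R]_2 -> 'M[R]_3) c th' (s : 'rV[R]_3) k :
  let q := lsubmx y in let g := rsubmx y in
  let w k q := w0 q 0 k in let m l k q := M q l k in
  aff_master (@DE1_rhs R) y T X w0 M (test_coefs c) th' s k <->
  test_lhs (dt X q) (dx X q) (fun k => dt (w k) q) (fun k => dx (w k) q)
    (fun l k => m l k q) (fun l k => dt (m l k) q) (fun l k => dx (m l k) q)
    c (g 0 0) (g 0 1) (g 0 2) (s 0 0) (s 0 1) (s 0 2) k =
  test_rhs (Tt T q) (dx X q) (dx (dx X) q) (cA th' (base T X q)) (dx (cA th') (base T X q))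
    (dt (cA th') (base T X q))
    (fun k => w k q) (fun k => dx (w k) q) (fun k => dx (dx (w k)) q)
    (fun l k => m l k q) (fun l k => dx (m l k) q) (fun l k => dx (dx (m l k)) q)
    (cB th' (base T X q)) (dx (cB th') (base T X q)) (dt (cB th') (base T X q))
    (cC th' (base T X q)) (dx (cC th') (base T X q)) (dt (cC th') (base T X q))
    (g 0 0) (g 0 1) (g 0 2) (s 0 0) (s 0 1) (s 0 2) k.
Proof.
move=> q g w m; rewrite /aff_master !sum3 !DE1_rhs_test /DE1_rhs.
have sl k' : aff_slope y X w0 M s 0 k' = jet_slope (dx X q) (fun k => dx (w k) q)
  (fun l k => m l k q) (fun l k => dx (m l k) q)
  (g 0 0) (g 0 1) (g 0 2) (s 0 0) (s 0 1) (s 0 2) k' by rewrite mxE sum3.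
rewrite !sl !affine_entry !sum3.
by [].
Qed.

End DE1Master.

(** * Calculus through the base map; [lift_g] as an affine map *)

Section BaseCalculus.
Variable R : realType.
Implicit Types (f g : 'rV[R]_2 -> R) (q : 'rV[R]_2) (T : R -> R).

Lemma dx_Tt T : dx (Tt T) = fun=> 0.
Proof. by apply/funext => q; rewrite /dx; exact: derive_coord1. Qed.

Lemma isD_dx f q : analytic_at f q -> isD 'e_1 f q (dx f q).
Proof. exact: isD_of. Qed.

Lemma isD_dt f q : analytic_at f q -> isD 'e_0 f q (dt f q).
Proof. exact: isD_of. Qed.

Lemma analytic_dx f q : analytic_at f q -> analytic_at (dx f) q.
Proof. exact: analytic_derive. Qed.

Lemma analytic_dt f q : analytic_at f q -> analytic_at (dt f) q.
Proof. exact: analytic_derive. Qed.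

Lemma dxE f q d : isD 'e_1 f q d -> dx f q = d.
Proof. by case. Qed.

Lemma dtE f q d : isD 'e_0 f q d -> dt f q = d.
Proof. by case. Qed.

Lemma dx_dt f q : analytic_at f q -> dx (dt f) q = dt (dx f) q.
Proof. by move=> fa; exact: deriveC. Qed.

Lemma near_dx (p : 'rV[R]_2) f g : (\forall q \near p, f q = g q) -> \forall q \near p, dx f q = dx g q.
Proof. by move=> /near_join; apply: filterS => q h; exact: derive_eq. Qed.

Lemma near_dt (p : 'rV[R]_2) f g : (\forall q \near p, f q = g q) -> \forall q \near p, dt f q = dt g q.
Proof. by move=> /near_join; apply: filterS => q h; exact: derive_eq. Qed.

Lemma dx_divT T f q : analytic_at (fun q : 'rV[R]_2 => T (q 0 0)) q -> Tt T q != 0 ->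
  analytic_at f q -> dx (fun q => f q / Tt T q) q = dx f q / Tt T q.
Proof.
move=> Ta T0 fa; have tD : isD 'e_1 (Tt T) q 0.
  by apply: isD_eq (isD_dx (analytic_Tt Ta)) _; rewrite dx_Tt.
apply: etrans (dxE (isD_mul (isD_dx fa) (isD_inv T0 tD))) _.
by rewrite oppr0 mul0r mulr0 addr0.
Qed.

Lemma dt_divT T f q : analytic_at (fun q : 'rV[R]_2 => T (q 0 0)) q -> Tt T q != 0 ->
  analytic_at f q ->
  dt (fun q => f q / Tt T q) q = dt f q / Tt T q - f q * dt (Tt T) q / Tt T q ^+ 2.
Proof.
move=> Ta T0 fa; have tD := isD_dt (analytic_Tt Ta).
apply: etrans (dtE (isD_mul (isD_dt fa) (isD_inv T0 tD))) _.
by rewrite mulNr mulrN mulrA.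
Qed.

Lemma isD_base i T (X : 'rV[R]_2 -> R) f q :
  analytic_at (fun q : 'rV[R]_2 => T (q 0 0)) q -> analytic_at X q ->
  analytic_at f (base T X q) ->
  isD 'e_i (fun q => f (base T X q)) q
    ('D_('e_i) (fun q => T (q 0 0)) q * dt f (base T X q)
     + 'D_('e_i) X q * dx f (base T X q)).
Proof.
move=> Ta Xa fa; have ba := analytic_base Ta Xa.
split; first exact: (analytic_comp ba fa).
apply: etrans (derive_chain 'e_i ba fa) _; rewrite sum2; congr (_ * _ + _ * _).
  by apply: derive_ext => q'; rewrite mxE.
by apply: derive_ext => q'; rewrite mxE.
Qed.

Lemma dt_base T (X : 'rV[R]_2 -> R) f q :
  analytic_at (fun q : 'rV[R]_2 => T (q 0 0)) q -> analytic_at X q ->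
  analytic_at f (base T X q) ->
  dt (fun q => f (base T X q)) q = Tt T q * dt f (base T X q) + dt X q * dx f (base T X q).
Proof.
by move=> Ta Xa fa; apply: etrans (dtE (isD_base 0 Ta Xa fa)) _; rewrite derive_coord0.
Qed.

Lemma dx_base T (X : 'rV[R]_2 -> R) f q :
  analytic_at (fun q : 'rV[R]_2 => T (q 0 0)) q -> analytic_at X q ->
  analytic_at f (base T X q) ->
  dx (fun q => f (base T X q)) q = dx X q * dx f (base T X q).
Proof.
move=> Ta Xa fa; apply: etrans (dxE (isD_base 1 Ta Xa fa)) _.
by rewrite derive_coord1 mul0r add0r.
Qed.

Lemma unitmx_col n (M : 'M[R]_n) k : M \in unitmx -> ~ (forall l, M l k = 0).
Proof.
move=> Mu h; have := mulVmx Mu => /matrixP/(_ k k); rewrite !mxE eqxx big1.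
  by move/esym/eqP; rewrite oner_eq0.
by move=> l _; rewrite h mulr0.
Qed.

Lemma class_data_test T X w0 M (g0 : 'rV[R]_3) r c th' q :
  class_data (@DE1_rhs R) T X w0 M g0 r c th' q ->
  forall v0 v1 v2, `|v0| <= r -> `|v1| <= r -> `|v2| <= r -> forall s0 s1 s2 k,
  test_lhs (dt X q) (dx X q) (fun k => dt (fun q => w0 q 0 k) q)
    (fun k => dx (fun q => w0 q 0 k) q)
    (fun l k => M q l k) (fun l k => dt (fun q => M q l k) q)
    (fun l k => dx (fun q => M q l k) q)
    c (g0 0 0 + v0) (g0 0 1 + v1) (g0 0 2 + v2) s0 s1 s2 k =
  test_rhs (Tt T q) (dx X q) (dx (dx X) q) (cA th' (base T X q)) (dx (cA th') (base T X q))
    (dt (cA th') (base T X q))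
    (fun k => w0 q 0 k) (fun k => dx (fun q => w0 q 0 k) q)
    (fun k => dx (dx (fun q => w0 q 0 k)) q)
    (fun l k => M q l k) (fun l k => dx (fun q => M q l k) q)
    (fun l k => dx (dx (fun q => M q l k)) q)
    (cB th' (base T X q)) (dx (cB th') (base T X q)) (dt (cB th') (base T X q))
    (cC th' (base T X q)) (dx (cC th') (base T X q)) (dt (cC th') (base T X q))
    (g0 0 0 + v0) (g0 0 1 + v1) (g0 0 2 + v2) s0 s1 s2 k.
Proof.
move=> [_ h] v0 v1 v2 vr0 vr1 vr2 s0 s1 s2 k.
pose v : 'rV[R]_3 := \row_i [:: v0; v1; v2]`_i.
pose s : 'rV[R]_3 := \row_i [:: s0; s1; s2]`_i.
have vr : in_box r v by apply: ord3P; rewrite mxE.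
have := (DE1_test_master _ _ _ _ _ _ _ _ _).1 (h v vr s k).
rewrite row_mxKl row_mxKr.
have -> : s 0 0 = s0 by rewrite mxE.
have -> : s 0 1 = s1 by rewrite mxE.
have -> : s 0 2 = s2 by rewrite mxE.
have -> : (g0 + v) 0 0 = g0 0 0 + v0 by rewrite mxE [v _ _]mxE.
have -> : (g0 + v) 0 1 = g0 0 1 + v1 by rewrite mxE [v _ _]mxE.
have -> : (g0 + v) 0 2 = g0 0 2 + v2 by rewrite mxE [v _ _]mxE.
exact: id.
Qed.

Definition lift_g_row T (X U : 'rV[R]_2 -> R) q : 'rV[R]_3 :=
  \row_k [:: dt X q / Tt T q; dt U q / (Tt T q * U q); 0]`_k.

Definition lift_g_mx T (X U : 'rV[R]_2 -> R) q : 'M[R]_3 :=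
  \matrix_(l, k) (nth [::] [:: [:: dx X q / Tt T q; dx U q / (Tt T q * U q); 0];
    [:: 0; 1 / Tt T q; 0]; [:: 0; 0; U q / Tt T q]] l)`_k.

Lemma lift_g_rowE T (X U : 'rV[R]_2 -> R) q k : lift_g_row T X U q 0 k =
  [:: dt X q / Tt T q; dt U q / (Tt T q * U q); 0]`_k.
Proof. by rewrite mxE. Qed.

Lemma lift_g_mxE T (X U : 'rV[R]_2 -> R) q l k : lift_g_mx T X U q l k =
  (nth [::] [:: [:: dx X q / Tt T q; dx U q / (Tt T q * U q); 0];
    [:: 0; 1 / Tt T q; 0]; [:: 0; 0; U q / Tt T q]] l)`_k.
Proof. by rewrite mxE. Qed.

Lemma lift_g_aff T X U y : lift_g T X U y = aff T X (lift_g_row T X U) (lift_g_mx T X U) y.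
Proof.
rewrite /lift_g /aff; congr row_mx; apply/rowP => k.
rewrite affine_entry sum3 !lift_g_mxE lift_g_rowE [LHS]mxE.
move: k; apply: ord3P => /=; gen_derive; ring.
Qed.

Lemma lift_g_analytic T X U q : nondegenerate_at T X U q ->
  aff_analytic T X (lift_g_row T X U) (lift_g_mx T X U) q.
Proof.
move=> nd; have [T0 X0 U0] := nondegenerate_neq0 nd; have [Ta Xa Ua _] := nd.
have TU : Tt T q * U q != 0 by rewrite mulf_neq0.
have div (f g : 'rV[R]_2 -> R) : analytic_at f q -> analytic_at g q -> g q != 0 ->
    analytic_at (fun q => f q / g q) q.
  by move=> fa ga g0; apply: analyticM fa _; exact: analyticV.
have z : analytic_at (fun _ : 'rV[R]_2 => 0 : R) q := analytic_cst 0 q.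
have tu : analytic_at (fun q => Tt T q * U q) q := analyticM (analytic_Tt Ta) Ua.
split; [exact: Ta | exact: Xa | |].
  apply: ord3P; apply: (analytic_ext (fun q => esym (lift_g_rowE _ _ _ _ _))) => /=.
  - exact: div (analytic_dt Xa) (analytic_Tt Ta) T0.
  - exact: div (analytic_dt Ua) tu TU.
  - exact: z.
apply: ord3P; apply: ord3P; apply: (analytic_ext (fun q => esym (lift_g_mxE _ _ _ _ _ _))) => /=;
  try exact: z.
- exact: div (analytic_dx Xa) (analytic_Tt Ta) T0.
- exact: div (analytic_dx Ua) tu TU.
- exact: div (analytic_cst 1 q) (analytic_Tt Ta) T0.
- exact: div Ua (analytic_Tt Ta) T0.
Qed.

Definition lift_g_inv T (X U : 'rV[R]_2 -> R) q : 'M[R]_3 := \matrix_(l, k) (nth [::] [::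
  [:: Tt T q / dx X q; - (Tt T q * dx U q / (dx X q * U q)); 0];
  [:: 0; Tt T q; 0]; [:: 0; 0; Tt T q / U q]] l)`_k.

Lemma lift_g_invK T X U q : nondegenerate_at T X U q ->
  lift_g_mx T X U q *m lift_g_inv T X U q = 1%:M.
Proof.
move=> /nondegenerate_neq0[T0 X0 U0]; apply/matrixP => l k; rewrite mxE sum3 !lift_g_mxE !mxE.
move: T0 X0 U0; gen_derive; move: (Tt T q) (U q) => t u T0 X0 U0.
move: l k; apply: ord3P; apply: ord3P => /=; by field; rewrite ?X0 ?T0 ?U0.
Qed.

Lemma lift_g_unit T X U q : nondegenerate_at T X U q -> lift_g_mx T X U q \in unitmx.
Proof. by case/lift_g_invK/mulmx1_unit. Qed.

End BaseCalculus.

(** * Elimination on a neighbourhood for the determining equations *)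

Section DE1Class.
Variable R : realType.
Variables (T : R -> R) (X : 'rV[R]_2 -> R) (w0 : 'rV[R]_2 -> 'rV[R]_3).
Variables (M : 'rV[R]_2 -> 'M[R]_3) (th0 th1 : coefs R) (gz : 'rV[R]_3) (r : R).
Variable q0 : 'rV[R]_2.
Hypothesis r0 : 0 < r.
Hypothesis th0a : admissible th0 (base T X q0).
Hypothesis hq : \forall q \near q0,
      [/\ aff_analytic T X w0 M q, Tt T q != 0, dx X q != 0, M q \in unitmx
        & class_data (@DE1_rhs R) T X w0 M gz r 0 th0 q /\
          class_data (@DE1_rhs R) T X w0 M gz r 1 th1 q].

Let w k q := w0 q 0 k.
Let m l k q := M q l k.

Let slopes c b c' q := forall v0 v1 v2, `|v0| <= r -> `|v1| <= r -> `|v2| <= r ->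
  forall j k, slope_coef (Tt T q) (dt X q) (dx X q) (dx (dx X) q) (dx X q ^+ 2 / Tt T q)
    (fun k => w k q) (fun l k => m l k q) (fun l k => dx (m l k) q) b c c' j k
    (gz 0 0 + v0) (gz 0 1 + v1) (gz 0 2 + v2) = 0.

Let slopes_near : \forall q \near q0, [/\ aff_analytic T X w0 M q, Tt T q != 0, dx X q != 0,
  M q \in unitmx & exists b0 c0 b1 c1, slopes 0 b0 c0 q /\ slopes 1 b1 c1 q].
Proof.
apply: filterS hq => q [an T0 X0 Mu [d0 d1]].
split; [exact: an | exact: T0 | exact: X0 | exact: Mu |].
have A0 : dx X q ^+ 2 / Tt T q != 0 by rewrite mulf_neq0 ?invr_eq0 ?sqrf_eq0.
have E0 : cA th0 (base T X q) = dx X q ^+ 2 / Tt T q by rewrite d0.1 mulfK.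
have E1 : cA th1 (base T X q) = dx X q ^+ 2 / Tt T q by rewrite d1.1 mulfK.
have F0 := class_data_test d0; have F1 := class_data_test d1.
rewrite E0 in F0; rewrite E1 in F1.
exists (cB th0 (base T X q)), (cC th0 (base T X q)), (cB th1 (base T X q)), (cC th1 (base T X q)).
split=> v0 v1 v2 h0 h1 h2.
  exact: slope_coefP X0 A0 (F0 v0 v1 v2 h0 h1 h2).
exact: slope_coefP X0 A0 (F1 v0 v1 v2 h0 h1 h2).
Qed.

Let AE (q : 'rV[R]_2) : Tt T q != 0 -> dx X q ^+ 2 = dx X q ^+ 2 / Tt T q * Tt T q.
Proof. by move=> h; rewrite divfK. Qed.

(** Every stage is a statement near [q0]: the entries found in one stage are differentiated in its
    companion with suffix x, and the next elimination uses both. *)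
Let stage1 : \forall q \near q0, [/\ m 0 0 q = dx X q / Tt T q, m 1 0 q = 0 & m 2 0 q = 0].
Proof.
apply: filterS slopes_near => q [an T0 X0 Mu [b0 [c0 [b1 [c1 [s0 s1]]]]]].
have e1 : m 1 0 q = 0 := solve_m10 T0 X0 r0 s0.
have e2 : m 2 0 q = 0 := solve_m20 T0 X0 r0 s0.
split; [|exact: e1|exact: e2]; apply: (solve_m00 T0 X0 r0 s0).
(* The other two entries of this column vanish, so m00 = 0 would contradict the invertibility of
   M. *)
apply/negP => /eqP e0; apply: (unitmx_col (k := 0) Mu).
by apply: ord3P; [exact: e0 | exact: e1 | exact: e2].
Qed.

Let near_dx0 f : (\forall q \near q0, f q = 0) -> \forall q \near q0, dx f q = 0 :> R.
Proof. by move=> /(near_dx (g := fun=> 0)); apply: filterS => q ->; rewrite dx_cst. Qed.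

Let near_dt0 f : (\forall q \near q0, f q = 0) -> \forall q \near q0, dt f q = 0 :> R.
Proof. by move=> /(near_dt (g := fun=> 0)); apply: filterS => q ->; rewrite dt_cst. Qed.

Let stage1x : \forall q \near q0,
  [/\ dx (m 0 0) q = dx (dx X) q / Tt T q, dx (m 1 0) q = 0 & dx (m 2 0) q = 0].
Proof.
have h0 : \forall q \near q0, m 0 0 q = dx X q / Tt T q by apply: filterS stage1 => q [].
have h1 : \forall q \near q0, m 1 0 q = 0 by apply: filterS stage1 => q [].
have h2 : \forall q \near q0, m 2 0 q = 0 by apply: filterS stage1 => q [].
apply: filterS (filterI slopes_near (filterI (near_dx h0) (filterI (near_dx0 h1) (near_dx0 h2)))).
move=> q [[[Ta Xa _ _] T0 _ _ _] [e0 [e1 e2]]]; split; [|exact: e1|exact: e2].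
rewrite e0; exact: (dx_divT Ta T0 (analytic_dx Xa)).
Qed.

Let stage2 : \forall q \near q0, m 1 1 q = 1 / Tt T q /\ m 2 1 q = 0.
Proof.
apply: filterS (filterI slopes_near (filterI stage1 stage1x)).
move=> q [[an T0 X0 Mu [b0 [c0 [b1 [c1 [s0 s1]]]]]] [[m00 m10 m20] [mx00 mx10 mx20]]].
split; first exact: (solve_m11 T0 X0 r0 (AE T0) s0 m00 m10 mx10).
exact: (solve_m21 T0 X0 r0 (AE T0) s0 m20 mx20).
Qed.

Let stage2x : \forall q \near q0, dx (m 1 1) q = 0 /\ dx (m 2 1) q = 0.
Proof.
have h0 : \forall q \near q0, m 1 1 q = 1 / Tt T q by apply: filterS stage2 => q [].
have h1 : \forall q \near q0, m 2 1 q = 0 by apply: filterS stage2 => q [].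
apply: filterS (filterI slopes_near (filterI (near_dx h0) (near_dx0 h1))).
move=> q [[[Ta Xa _ _] T0 _ _ _] [e0 e1]]; split; [|exact: e1].
by rewrite e0 (dx_divT (f := fun=> 1) Ta T0 (analytic_cst 1 q)) dx_cst mul0r.
Qed.

Let stage3 : \forall q \near q0, w 0 q = dt X q / Tt T q /\ m 1 2 q = 0.
Proof.
apply: filterS (filterI slopes_near (filterI (filterI stage1 stage1x) (filterI stage2 stage2x))).
move=> q [[an T0 X0 Mu [b0 [c0 [b1 [c1 [s0 s1]]]]]]
  [[[m00 m10 m20] [mx00 mx10 mx20]] [[m11 m21] [mx11 mx21]]]].
split; first exact: (solve_w0 T0 X0 r0 (AE T0) s0 m00 m10 m20 m11 mx00 mx11).
have B0 := solve_b T0 X0 r0 (AE T0) s0 m10 m11 mx11.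
have B1 := solve_b T0 X0 r0 (AE T0) s1 m10 m11 mx11.
have bE : b1 = b0 by rewrite B0 B1.
have n0 : `|0 : R| <= r by rewrite normr0 ltW.
have f0 := s0 0 0 0 n0 n0 n0 0 2; have f1 := s1 0 0 0 n0 n0 n0 0 2.
by rewrite bE in f1; exact: (solve_m12 f0 f1).
Qed.

Let stage3x : \forall q \near q0, dx (w 0) q = dx (dt X) q / Tt T q /\ dx (m 1 2) q = 0.
Proof.
have h0 : \forall q \near q0, w 0 q = dt X q / Tt T q by apply: filterS stage3 => q [].
have h1 : \forall q \near q0, m 1 2 q = 0 by apply: filterS stage3 => q [].
apply: filterS (filterI slopes_near (filterI (near_dx h0) (near_dx0 h1))).
move=> q [[[Ta Xa _ _] T0 _ _ _] [e0 e1]]; split; [|exact: e1].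
by rewrite e0 (dx_divT Ta T0 (analytic_dt Xa)).
Qed.

Let stage4 : \forall q \near q0, m 0 2 q = 0.
Proof.
apply: filterS (filterI slopes_near (filterI stage1 (filterI stage3 stage3x))).
move=> q [[an T0 X0 Mu [b0 [c0 [b1 [c1 [s0 s1]]]]]]
  [[m00 m10 m20] [[w0E m12] [_ mx12]]]].
exact: (solve_m02 X0 r0 s0 m10 m12 mx12).
Qed.

Let m22_neq0 : \forall q \near q0, m 2 2 q != 0.
Proof.
apply: filterS (filterI slopes_near (filterI stage3 stage4)).
move=> q [[an T0 X0 Mu _] [[_ m12] m02]]; apply/negP => /eqP m22.
by apply: (unitmx_col (k := 2) Mu); apply: ord3P; [exact: m02 | exact: m12 | exact: m22].
Qed.

Let stage5 : \forall q \near q0,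
  w 2 q = 0 /\ m 0 1 q = dx (m 2 2) q / (Tt T q * m 2 2 q).
Proof.
apply: filterS (filterI (filterI slopes_near m22_neq0) (filterI (filterI (filterI stage1 stage1x)
  (filterI stage2 stage2x)) (filterI (filterI stage3 stage3x) (filterI stage4 (near_dx0 stage4))))).
move=> q [[[an T0 X0 Mu [b0 [c0 [b1 [c1 [s0 s1]]]]]] m22]
  [[[[m00 m10 m20] [mx00 mx10 mx20]] [[m11 m21] [mx11 mx21]]]
  [[[w0E m12] [_ mx12]] [m02 mx02]]]].
split; first exact: (solve_w2 T0 X0 r0 s0 m00 m12 m02 mx02).
exact: (solve_m01 T0 X0 r0 (AE T0) s0 m10 m20 m11 mx11 m22).
Qed.

Let stage5x : \forall q \near q0, [/\ dx (w 2) q = 0, dt (w 2) q = 0, dx (dx (w 2)) q = 0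
  & dx (m 0 1) q = (dx (dx (m 2 2)) q * m 2 2 q - dx (m 2 2) q ^+ 2) / (Tt T q * m 2 2 q ^+ 2)].
Proof.
have h0 : \forall q \near q0, w 2 q = 0 by apply: filterS stage5 => q [].
have h1 : \forall q \near q0, m 0 1 q = dx (m 2 2) q / m 2 2 q / Tt T q.
  by apply: filterS stage5 => q [_ ->]; rewrite invfM mulrA mulrAC.
apply: filterS (filterI (filterI slopes_near m22_neq0) (filterI
  (filterI (near_dx0 h0) (near_dt0 h0)) (filterI (near_dx0 (near_dx0 h0)) (near_dx h1)))).
move=> q [[[[Ta Xa _ Ma] T0 _ _ _] m22] [[e0 e1] [e2 e3]]].
split; [exact: e0 | exact: e1 | exact: e2 |].
have ma : analytic_at (m 2 2) q := Ma 2 2.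
have mxD : isD 'e_1 (dx (m 2 2)) q (dx (dx (m 2 2)) q) := isD_dx (analytic_dx ma).
have h := isD_mul mxD (isD_inv m22 (isD_dx ma)).
apply: etrans e3 _; apply: etrans (dx_divT Ta T0 h.1) _; rewrite (dxE h).
have alg (a b c t : R) : c != 0 -> t != 0 ->
  (a * c^-1 + b * (- b / c ^+ 2)) / t = (a * c - b ^+ 2) / (t * c ^+ 2).
  by move=> c0 t0; field; rewrite c0 t0.
exact: alg.
Qed.

(** The relation X_x^2 = A' T_t holds at all nearby points. Its x- and t-derivatives give, by the
    chain rule through [base], the derivatives of A' that [solve_w1] needs. *)
Let near_A : \forall q \near q0,
  dx (cA th0) (base T X q) * dx X q / (dx X q ^+ 2 / Tt T q) = 2 * dx (dx X) q / dx X q /\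
  (dt (cA th0) (base T X q) * Tt T q + dx (cA th0) (base T X q) * dt X q) /
    (dx X q ^+ 2 / Tt T q) = 2 * dx (dt X) q / dx X q - dt (Tt T) q / Tt T q.
Proof.
have [A0a _ _ _] := th0a.
have hE : \forall q \near q0, cA th0 (base T X q) = dx X q ^+ 2 / Tt T q.
  by apply: filterS hq => q [_ T0 _ _ [[-> _] _]]; rewrite mulfK.
have [[Ta0 Xa0 _ _] _ _ _ _] := nbhs_singleton slopes_near.
have bc : {for q0, continuous (base T X)} by apply/analytic_map_cont/analytic_base.
have An : \forall q \near q0, analytic_at (cA th0) (base T X q).
  exact: (bc _ (analytic_near A0a)).
apply: filterS (filterI (filterI slopes_near An) (filterI (near_dx hE) (near_dt hE))).
move=> q [[[[Ta Xa _ _] T0 X0 _ _] Aq] [e0 e1]].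
have ha : analytic_at (fun q => dx X q ^+ 2) q := (isD_sqr (isD_dx (analytic_dx Xa))).1.
have hx : dx (fun q => dx X q ^+ 2) q = 2 * dx X q * dx (dx X) q :=
  dxE (isD_sqr (isD_dx (analytic_dx Xa))).
have ht : dt (fun q => dx X q ^+ 2) q = 2 * dx X q * dt (dx X) q :=
  dtE (isD_sqr (isD_dt (analytic_dx Xa))).
rewrite (dx_base Ta Xa Aq) (dx_divT Ta T0 ha) hx in e0.
rewrite (dt_base Ta Xa Aq) (dt_divT Ta T0 ha) ht in e1.
rewrite (dx_dt Xa); move: e0 e1 X0 T0; gen_derive; move: (Tt T q) => t e0 e1 X0 T0.
rewrite [X in X / _ = _ /\ _]mulrC e0 [in X in _ /\ X / _ = _]mulrC [X in _ /\ (_ + X) / _ = _]mulrC e1.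
by split; field; rewrite X0 T0.
Qed.

Let stage6 : \forall q \near q0,
  w 1 q = (dt (Tt T) q * m 2 2 q + Tt T q * dt (m 2 2) q) / (Tt T q * (Tt T q * m 2 2 q)).
Proof.
have h12 : \forall q \near q0, m 1 2 q = 0 by apply: filterS stage3 => q [].
apply: filterS (filterI (filterI (filterI hq m22_neq0) (filterI (filterI stage1 stage1x)
  (filterI stage2 stage2x))) (filterI (filterI (filterI stage3 stage3x) (filterI stage4
    (near_dx0 stage4))) (filterI (filterI stage5x near_A)
  (filterI (filterI (near_dt0 stage4) (near_dx0 (near_dx0 stage4)))
    (filterI (near_dt0 h12) (near_dx0 (near_dx0 h12))))))).
move=> q [[[[an T0 X0 Mu [d0 _]] m22] [[[m00 m10 m20] [mx00 mx10 mx20]] [[m11 m21] [mx11 mx21]]]]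
  [[[[w0E m12] [wx0 mx12]] [m02 mx02]] [[[wx2 wt2 wxx2 mx01] [Ax At]]
  [[mt02 mxx02] [mt12 mxx12]]]]].
have A0 : dx X q ^+ 2 / Tt T q != 0 by rewrite mulf_neq0 ?invr_eq0 ?sqrf_eq0.
have E0 : cA th0 (base T X q) = dx X q ^+ 2 / Tt T q by rewrite d0.1 mulfK.
have F0 := class_data_test d0; rewrite E0 in F0.
have s0 v0 v1 v2 h0 h1 h2 := slope_coefP X0 A0 (F0 v0 v1 v2 h0 h1 h2).
(* The relation for w1 carries the factor g^3; within the fibre box a point with nonzero g^3 is
   always available. *)
have [v2 v2r g20] : exists2 v2, `|v2| <= r & gz 0 2 + v2 != 0.
  have [g20|g20] := eqVneq (gz 0 2) 0.
    by exists r; rewrite ?gtr0_norm// g20 add0r lt0r_neq0.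
  by exists 0; rewrite ?addr0// normr0 ltW.
have n0 : `|0 : R| <= r by rewrite normr0 ltW.
exact: (solve_w1 T0 X0 r0 (AE T0) s0 m00 m10 m20 mx10 mx20 m11 m21 mx00 mx11 m12 mx12 m02 mx02
  wt2 wx2 wxx2 mt02 mxx02 mt12 mxx12 wx0 mx01 Ax At m22 g20 (F0 0 0 v2 n0 n0 v2r)).
Qed.

(** In [lift_g] the coefficient of g^3 is U / T_t, which dictates the choice of U. The derivatives
    of this product turn the remaining entries into those of [lift_g]. *)
Lemma DE1_coefs : let U q := Tt T q * m 2 2 q in nondegenerate_at T X U q0 /\
  \forall q \near q0, w0 q = lift_g_row T X U q /\ M q = lift_g_mx T X U q.
Proof.
move=> U; have [[Ta0 Xa0 _ Ma0] T00 X00 _ _] := nbhs_singleton slopes_near.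
split.
  split; [exact: Ta0 | exact: Xa0 | exact: analyticM (analytic_Tt Ta0) (Ma0 2 2) |].
  by rewrite !mulf_neq0// (nbhs_singleton m22_neq0).
apply: filterS (filterI (filterI (filterI slopes_near m22_neq0) (filterI stage1 stage2))
  (filterI (filterI stage3 stage4) (filterI stage5 stage6))).
move=> q [[[[[Ta Xa _ Ma] T0 X0 _ _] m22] [[m00 m10 m20] [m11 m21]]]
  [[[w0E m12] m02] [[w2E m01] w1E]]].
have Um : isD 'e_1 U q (0 * m 2 2 q + Tt T q * dx (m 2 2) q).
  by apply: isD_mul (isD_dx (Ma 2 2)); apply: isD_eq (isD_dx (analytic_Tt Ta)) _; rewrite dx_Tt.
have Ut : dt U q = dt (Tt T) q * m 2 2 q + Tt T q * dt (m 2 2) q :=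
  dtE (isD_mul (isD_dt (analytic_Tt Ta)) (isD_dt (Ma 2 2))).
split.
  apply/rowP => k; rewrite lift_g_rowE Ut; move: k.
  by apply: ord3P; [exact: w0E | exact: w1E | exact: w2E].
have m01' : m 0 1 q = dx U q / (Tt T q * U q).
  rewrite (dxE Um) m01 mul0r add0r /U.
  have alg (a t c : R) : t != 0 -> c != 0 -> a / (t * c) = t * a / (t * (t * c)).
    by move=> t0 c0; field; rewrite t0 c0.
  exact: alg.
have m22' : m 2 2 q = U q / Tt T q by rewrite /U [Tt T q * _]mulrC mulfK.
apply/matrixP => l k; rewrite lift_g_mxE; move: l k; apply: ord3P; apply: ord3P.
- exact: m00.
- exact: m01'.
- exact: m02.
- exact: m10.
- exact: m11.
- exact: m12.
- exact: m20.
- exact: m21.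
- exact: m22'.
Qed.

End DE1Class.

Section DE1Classification.
Variable R : realType.

Lemma DE1_class Phi (z : 'rV[R]_(2 + 3)) : equivalence (@DE1 R) Phi z ->
  exists T X U, nondegenerate_at T X U (lsubmx z) /\ germ_eq z Phi (lift_g T X U).
Proof.
move=> eqz.
have [T [X [w0 [M [th0 [th1 [r [r0 PA a0 _ hq]]]]]]]] :=
  equivalence_aff (ltn0Sn 2) (@DE1_evolution R) (@DE1_rhs_affine R) eqz.
have [nd wM] := DE1_coefs r0 a0 hq.
exists T, X, (fun q => Tt T q * M q 2 2); split; first exact: nd.
apply: filterS (filterI PA (near_lsubmx wM)) => y [-> [w m]].
by rewrite lift_g_aff /aff w m.
Qed.

End DE1Classification.

(** * The master identity of [lift_g] as an identity between numbers *)

Section LiftAlgebra.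
Variable R : realType.

Definition DE1_poly (A B C Ax At Bx Bt Cx Ct : R) (g s : 'I_3 -> R) (k : 'I_3) : R :=
  let K := 2 * s 0 - Ax / A * g 0 - At / A in
  [:: B * s 0 - K * (g 0 + B) - Bx * g 0 - 2 * A * s 1 - Bt;
      B * s 1 - K * (g 1 - C) + Cx * g 0 + Ct;
      B * s 2 - K * g 2 + C * g 2]`_k.

Variables (tt th xx xt xxx xtt xtx xxxx xtxx u p px pxx rho rhox rhot rhoxx : R).
Variables (A B C Ax At Bx Bt Cx Ct : R).

(* [p], [rho] stand for U_x / U and U_t / U, and [th] for T_tt / T_t; the subscripts x, t of the
   other variables are derivatives. *)
Let w := nth 0 [:: xt / tt; rho / tt; 0].
Let wt := nth 0 [:: xtt / tt - xt * th / tt; rhot / tt - rho * th / tt; 0].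
Let wx := nth 0 [:: xtx / tt; rhox / tt; 0].
Let wxx := nth 0 [:: xtxx / tt; rhoxx / tt; 0].
Let m l := nth 0 (nth [::] [:: [:: xx / tt; p / tt; 0]; [:: 0; 1 / tt; 0]; [:: 0; 0; u / tt]] l).
Let mt l := nth 0 (nth [::] [:: [:: xtx / tt - xx * th / tt; rhox / tt - p * th / tt; 0];
  [:: 0; - th / tt; 0]; [:: 0; 0; rho * u / tt - u * th / tt]] l).
Let mx l := nth 0 (nth [::] [:: [:: xxx / tt; px / tt; 0]; [:: 0; 0; 0];
  [:: 0; 0; p * u / tt]] l).
Let mxx l := nth 0 (nth [::] [:: [:: xxxx / tt; pxx / tt; 0]; [:: 0; 0; 0];
  [:: 0; 0; (px + p ^+ 2) * u / tt]] l).

Definition lift_slope (g s : 'I_3 -> R) (k : 'I_3) :=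
  (wx k + (g 0 * mx 0 k + s 0 * m 0 k + (g 1 * mx 1 k + s 1 * m 1 k)
    + (g 2 * mx 2 k + s 2 * m 2 k))) / xx.

Definition lift_value (g : 'I_3 -> R) (k : 'I_3) :=
  w k + (g 0 * m 0 k + g 1 * m 1 k + g 2 * m 2 k).

Definition lift_lhs (g s : 'I_3 -> R) (k : 'I_3) :=
  let H := DE1_poly A B C Ax At Bx Bt Cx Ct g s in
  wt k + (g 0 * mt 0 k + H 0 * m 0 k + (g 1 * mt 1 k + H 1 * m 1 k)
    + (g 2 * mt 2 k + H 2 * m 2 k)) - xt * lift_slope g s k.

Definition lift_rhs A' B' C' Ax' At' Bx' Bt' Cx' Ct' (g s : 'I_3 -> R) (k : 'I_3) :=
  A * (wxx k + (g 0 * mxx 0 k + 2 * s 0 * mx 0 k + (g 1 * mxx 1 k + 2 * s 1 * mx 1 k)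
    + (g 2 * mxx 2 k + 2 * s 2 * mx 2 k)) - lift_slope g s k * xxx)
  + tt * DE1_poly A' B' C' Ax' At' Bx' Bt' Cx' Ct' (lift_value g) (lift_slope g s) k.

(** [lA], [lB], [lC] are the transformed coefficients at the image point. The suffixes x and t
    denote derivatives of their pullbacks by [base], so the derivatives of A' itself are [lAx / xx]
    and [(lAt - xt * (lAx / xx)) / tt]. The terms with [th] come from differentiating 1 / T_t. *)
Definition lA := xx ^+ 2 / tt * A.
Definition lAx := (2 * xx * xxx * A + xx ^+ 2 * Ax) / tt.
Definition lAt := (2 * xx * xtx * A + xx ^+ 2 * At) / tt - th * lA.
Definition lB := xx / tt * (B - 2 * p * A) - (xt - A * xxx) / tt.
Definition lBx := (xxx * (B - 2 * p * A) + xx * (Bx - 2 * px * A - 2 * p * Ax)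
  - (xtx - Ax * xxx - A * xxxx)) / tt.
Definition lBt := (xtx * (B - 2 * p * A) + xx * (Bt - 2 * rhox * A - 2 * p * At)
  - (xtt - At * xxx - A * xtxx)) / tt - th * lB.
Definition lC := (rho + A * (p ^+ 2 - px) - B * p + C) / tt.
Definition lCx := (rhox + Ax * (p ^+ 2 - px) + A * (2 * p * px - pxx)
  - Bx * p - B * px + Cx) / tt.
Definition lCt := (rhot + At * (p ^+ 2 - px) + A * (2 * p * rhox - rhoxx)
  - Bt * p - B * rhox + Ct) / tt - th * lC.

Hypotheses (t0 : tt != 0) (x0 : xx != 0).

Lemma lift_holds g s k : A != 0 ->
  lift_lhs g s k = lift_rhs lA lB lC (lAx / xx) ((lAt - xt * (lAx / xx)) / tt)
    (lBx / xx) ((lBt - xt * (lBx / xx)) / tt) (lCx / xx) ((lCt - xt * (lCx / xx)) / tt) g s k.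
Proof.
move=> A0; rewrite /lift_lhs /lift_rhs /lift_value /lift_slope /DE1_poly.
rewrite /lAt /lBt /lCt /lAx /lBx /lCx /lA /lB /lC.
move: (g 0) (g 1) (g 2) (s 0) (s 1) (s 2) => g0 g1 g2 s0 s1 s2.
move: k; apply: ord3P; rewrite /= /w /wt /wx /wxx /m /mt /mx /mxx /=.
by field; rewrite A0 x0 t0.
by field; rewrite A0 x0 t0.
by field; rewrite A0 x0 t0.
Qed.

Lemma lift_holds_eq A' B' C' Ax' At' Bx' Bt' Cx' Ct' g s k : A != 0 ->
  A' = lA -> B' = lB -> C' = lC ->
  Ax' = lAx / xx -> At' = (lAt - xt * (lAx / xx)) / tt ->
  Bx' = lBx / xx -> Bt' = (lBt - xt * (lBx / xx)) / tt ->
  Cx' = lCx / xx -> Ct' = (lCt - xt * (lCx / xx)) / tt ->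
  lift_lhs g s k = lift_rhs A' B' C' Ax' At' Bx' Bt' Cx' Ct' g s k.
Proof. by move=> A0 -> -> -> -> -> -> -> -> ->; exact: lift_holds. Qed.

(** In the second equation, the coefficient of s_1 determines B' and then that of s_0 determines C'.
    The derivatives of the target coefficients cancel in the differences between two slopes, so
    nothing need be known of them. *)
Lemma lift_solve A' B' C' Ax' At' Bx' Bt' Cx' Ct' g : A != 0 ->
  xx ^+ 2 * A = A' * tt ->
  (forall s k, lift_lhs g s k = lift_rhs A' B' C' Ax' At' Bx' Bt' Cx' Ct' g s k) ->
  B' = lB /\ C' = lC.
Proof.
move=> A0 AE h; have hD s k : lift_lhs g s k -
  lift_rhs A' B' C' Ax' At' Bx' Bt' Cx' Ct' g s k = 0 by rewrite h subrr.
have A'E : A' = lA by rewrite /lA -[LHS](mulfK t0) -AE mulrAC.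
have A'0 : lA != 0 by rewrite /lA !mulf_neq0 ?invr_eq0 ?sqrf_eq0.
have h0 := hD (fun=> 0) 1; have h1 := hD (fun i => (i == 1)%:R) 1.
have h2 := hD (fun i => (i == 0)%:R) 1; rewrite A'E in h0 h1 h2.
have c0 : - 1 / xx != 0 :> R by rewrite mulf_neq0 ?invr_eq0// oppr_eq0 oner_neq0.
have BE : B' = lB.
  apply: (linear_solve (k1 := 1) (k2 := -1) c0 h1 h0).
  move: A'0; rewrite /lB /lA /lift_lhs /lift_rhs /lift_value /lift_slope /DE1_poly.
  move: (g 0) (g 1) (g 2) => g0 g1 g2.
  by rewrite /= /w /wt /wx /wxx /m /mt /mx /mxx /= => A'0; field; rewrite A0 x0 t0.
split; first exact: BE; have c1 : - 2 != 0 :> R by rewrite oppr_eq0 pnatr_eq0.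
apply: (linear_solve (k1 := 1) (k2 := -1) c1 h2 h0).
move: A'0; rewrite BE /lC /lB /lA /lift_lhs /lift_rhs /lift_value /lift_slope /DE1_poly.
move: (g 0) (g 1) (g 2) => g0 g1 g2.
by rewrite /= /w /wt /wx /wxx /m /mt /mx /mxx /= => A'0; field; rewrite A0 x0 t0.
Qed.

End LiftAlgebra.

(** * Logarithmic derivatives of U *)

Section LiftMaster.
Variable R : realType.
Variables (T : R -> R) (X U : 'rV[R]_2 -> R) (q : 'rV[R]_2).
Hypothesis nd : nondegenerate_at T X U q.

(** In terms of U_x / U and U_t / U the entries of [lift_g] and the new C are polynomial in the
    derivatives of U up to the factor 1 / T_t; the denominators U disappear from the long
    identities. *)
Definition log_dx q := dx U q / U q.
Definition log_dt q := dt U q / U q.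

Lemma div_dt f : analytic_at f q -> dt (fun q => f q / Tt T q) q =
  dt f q / Tt T q - f q * (dt (Tt T) q / Tt T q) / Tt T q.
Proof.
move=> fa; have [Ta _ _ _] := nd; have [T0 _ _] := nondegenerate_neq0 nd.
rewrite (dt_divT Ta T0 fa).
have alg (a b t c : R) : t != 0 -> a - b * c / t ^+ 2 = a - b * (c / t) / t.
  by move=> t0; field.
exact: alg.
Qed.

Lemma div_dx f : analytic_at f q -> dx (fun q => f q / Tt T q) q = dx f q / Tt T q.
Proof.
by move=> fa; have [Ta _ _ _] := nd; have [T0 _ _] := nondegenerate_neq0 nd; exact: dx_divT.
Qed.

Lemma div_dxx f : analytic_at f q ->
  dx (dx (fun q => f q / Tt T q)) q = dx (dx f) q / Tt T q.
Proof.
move=> fa; have [Ta _ _ _] := nd; have [T0 _ _] := nondegenerate_neq0 nd.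
have h : \forall q' \near q, dx (fun q => f q / Tt T q) q' = dx f q' / Tt T q'.
  apply: filterS (filterI (nondegenerate_near nd) (analytic_near fa)) => q' [nd' fa'].
  have [Ta' _ _ _] := nd'; have [T0' _ _] := nondegenerate_neq0 nd'.
  exact: dx_divT.
rewrite (derive_eq 'e_1 h : dx (dx _) q = dx _ q).
exact: (dx_divT Ta T0 (analytic_dx fa)).
Qed.

Lemma analytic_log_dx : analytic_at log_dx q.
Proof.
have [_ _ Ua _] := nd; have [_ _ U0] := nondegenerate_neq0 nd.
by apply: analyticM (analytic_dx Ua) _; exact: analyticV.
Qed.

Lemma analytic_log_dt : analytic_at log_dt q.
Proof.
have [_ _ Ua _] := nd; have [_ _ U0] := nondegenerate_neq0 nd.
by apply: analyticM (analytic_dt Ua) _; exact: analyticV.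
Qed.

Lemma dx_log : dx U q = log_dx q * U q.
Proof. by have [_ _ U0] := nondegenerate_neq0 nd; rewrite divfK. Qed.

Lemma dt_log : dt U q = log_dt q * U q.
Proof. by have [_ _ U0] := nondegenerate_neq0 nd; rewrite divfK. Qed.

Lemma dx_log_dx : dx log_dx q = dx (dx U) q / U q - log_dx q ^+ 2.
Proof.
have [_ _ Ua _] := nd; have [_ _ U0] := nondegenerate_neq0 nd.
apply: etrans (dxE (isD_mul (isD_dx (analytic_dx Ua)) (isD_inv U0 (isD_dx Ua)))) _.
rewrite /log_dx; have alg (a b c : R) : c != 0 ->
  a * c^-1 + b * (- b / c ^+ 2) = a / c - (b / c) ^+ 2 by move=> c0; field.
exact: alg.
Qed.

Lemma dt_log_dx : dt log_dx q = dx log_dt q.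
Proof.
have [_ _ Ua _] := nd; have [_ _ U0] := nondegenerate_neq0 nd.
apply: etrans (dtE (isD_mul (isD_dt (analytic_dx Ua)) (isD_inv U0 (isD_dt Ua)))) _.
apply/esym; apply: etrans (dxE (isD_mul (isD_dx (analytic_dt Ua)) (isD_inv U0 (isD_dx Ua)))) _.
rewrite (dx_dt Ua); have alg (a b c d : R) : d != 0 ->
  a * d^-1 + b * (- c / d ^+ 2) = a * d^-1 + c * (- b / d ^+ 2) by move=> d0; field.
exact: alg.
Qed.

Lemma dxx_log : dx (dx U) q = (dx log_dx q + log_dx q ^+ 2) * U q.
Proof.
by have [_ _ U0] := nondegenerate_neq0 nd; rewrite dx_log_dx subrK divfK.
Qed.

End LiftMaster.

Section LiftMasterIff.
Variable R : realType.
Variables (T : R -> R) (X U : 'rV[R]_2 -> R) (y : 'rV[R]_(2 + 3)).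
Let q := lsubmx y.
Let g := rsubmx y.
Hypothesis nd : nondegenerate_at T X U q.
Let p := log_dx U.
Let rho := log_dt U.

Let rowE k : (fun q => lift_g_row T X U q 0 k) =
  (fun q => (nth (fun=> 0) [:: dt X; rho; fun=> 0] k) q / Tt T q).
Proof.
apply/funext => q'; rewrite lift_g_rowE; move: k; apply: ord3P => /=.
- by [].
- by rewrite /rho /log_dt invfM mulrA mulrAC.
- by rewrite mul0r.
Qed.

Let mxE' l k : (fun q => lift_g_mx T X U q l k) =
  (fun q => (nth (fun=> 0) (nth [::] [:: [:: dx X; p; fun=> 0]; [:: fun=> 0; fun=> 1; fun=> 0];
    [:: fun=> 0; fun=> 0; U]] l) k) q / Tt T q).
Proof.
apply/funext => q'; rewrite lift_g_mxE; move: l k; apply: ord3P; apply: ord3P => /=.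
all: rewrite ?mul0r //.
by rewrite /p /log_dx invfM mulrA mulrAC.
Qed.

Let rowa (k : 'I_3) : analytic_at (nth (fun=> 0) [:: dt X; rho; fun=> 0] k) q.
Proof.
have [_ Xa _ _] := nd; elim/ord3P: k.
- exact: analytic_dt.
- exact: analytic_log_dt nd.
- exact: analytic_cst.
Qed.

Let mxa (l k : 'I_3) : analytic_at (nth (fun=> 0) (nth [::] [:: [:: dx X; p; fun=> 0];
  [:: fun=> 0; fun=> 1; fun=> 0]; [:: fun=> 0; fun=> 0; U]] l) k) q.
Proof.
have [_ Xa Ua _] := nd; elim/ord3P: l; elim/ord3P: k; try exact: analytic_cst.
- exact: analytic_dx.
- exact: analytic_log_dx nd.
- exact: Ua.
Qed.

Lemma lift_g_master th th' (s : 'rV[R]_3) k :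
  aff_master (@DE1_rhs R) y T X (lift_g_row T X U) (lift_g_mx T X U) th th' s k <->
  let G i := g 0 i in let S i := s 0 i in let tt := Tt T q in let bq := base T X q in
  let dxa f := dx f q in let dta f := dt f q in
  lift_lhs tt (dta (Tt T) / tt) (dx X q) (dt X q) (dx (dx X) q) (dta (dt X)) (dx (dt X) q)
    (U q) (p q) (dx p q) (rho q) (dx rho q) (dt rho q)
    (cA th q) (cB th q) (cC th q) (dx (cA th) q) (dt (cA th) q) (dx (cB th) q) (dt (cB th) q)
    (dx (cC th) q) (dt (cC th) q) G S k =
  lift_rhs tt (dx X q) (dt X q) (dx (dx X) q) (dx (dt X) q) (dx (dx (dx X)) q)
    (dx (dx (dt X)) q) (U q) (p q) (dx p q) (dx (dx p) q) (rho q) (dx rho q)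
    (dx (dx rho) q) (cA th q) (cA th' bq) (cB th' bq) (cC th' bq) (dx (cA th') bq)
    (dt (cA th') bq) (dx (cB th') bq) (dt (cB th') bq)
    (dx (cC th') bq) (dt (cC th') bq) G S k.
Proof.
pose W j q := lift_g_row T X U q 0 j; pose m l j q := lift_g_mx T X U q l j.
have [T0 X0 U0] := nondegenerate_neq0 nd.
have W0 j : W j q = nth 0 [:: dt X q / Tt T q; rho q / Tt T q; 0] j.
  by rewrite /W (congr1 (fun f => f q) (rowE j)); elim/ord3P: j => //=; rewrite mul0r.
have Wt j : dt (W j) q = nth 0 [:: dt (dt X) q / Tt T q - dt X q * (dt (Tt T) q / Tt T q) / Tt T q;
    dt rho q / Tt T q - rho q * (dt (Tt T) q / Tt T q) / Tt T q; 0] j.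
  rewrite /W (rowE j) (div_dt nd (rowa j)); elim/ord3P: j => //=.
  by rewrite dt_cst !mul0r subrr.
have Wx j : dx (W j) q = nth 0 [:: dx (dt X) q / Tt T q; dx rho q / Tt T q; 0] j.
  rewrite /W (rowE j) (div_dx nd (rowa j)); elim/ord3P: j => //=.
  by rewrite dx_cst mul0r.
have Wxx j : dx (dx (W j)) q = nth 0 [:: dx (dx (dt X)) q / Tt T q; dx (dx rho) q / Tt T q; 0] j.
  rewrite /W (rowE j) (div_dxx nd (rowa j)); elim/ord3P: j => //=.
  by rewrite !dx_cst mul0r.
have m0 l j : m l j q = nth 0 (nth [::] [:: [:: dx X q / Tt T q; p q / Tt T q; 0];
    [:: 0; 1 / Tt T q; 0]; [:: 0; 0; U q / Tt T q]] l) j.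
  rewrite /m (congr1 (fun f => f q) (mxE' l j)).
  by elim/ord3P: l; elim/ord3P: j => //=; rewrite mul0r.
have mt l j : dt (m l j) q = nth 0 (nth [::] [::
    [:: dx (dt X) q / Tt T q - dx X q * (dt (Tt T) q / Tt T q) / Tt T q;
       dx rho q / Tt T q - p q * (dt (Tt T) q / Tt T q) / Tt T q; 0];
    [:: 0; - (dt (Tt T) q / Tt T q) / Tt T q; 0];
    [:: 0; 0; rho q * U q / Tt T q - U q * (dt (Tt T) q / Tt T q) / Tt T q]] l) j.
  rewrite /m (mxE' l j) (div_dt nd (mxa l j)).
  have [_ Xa _ _] := nd.
  have z (a b : R) : dt (fun _ : 'rV[R]_2 => 0 : R) q / a - 0 * b / a = 0.
    by rewrite dt_cst !mul0r subrr.
  have z1 (a b : R) : dt (fun _ : 'rV[R]_2 => 1 : R) q / a - 1 * b / a = - b / a.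
    by rewrite dt_cst mul0r mul1r sub0r mulNr.
  elim/ord3P: l; elim/ord3P: j => /=.
  - by rewrite (dx_dt Xa).
  - by rewrite (dt_log_dx nd).
  - exact: z.
  - exact: z.
  - exact: z1.
  - exact: z.
  - exact: z.
  - exact: z.
  - by rewrite (dt_log nd).
have mx l j : dx (m l j) q = nth 0 (nth [::] [::
    [:: dx (dx X) q / Tt T q; dx p q / Tt T q; 0]; [:: 0; 0; 0];
    [:: 0; 0; p q * U q / Tt T q]] l) j.
  rewrite /m (mxE' l j) (div_dx nd (mxa l j)).
  have z c (a : R) : dx (fun _ : 'rV[R]_2 => c : R) q / a = 0 by rewrite dx_cst mul0r.
  elim/ord3P: l; elim/ord3P: j => /=.
  - exact: erefl.
  - exact: erefl.
  - exact: z.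
  - exact: z.
  - exact: z.
  - exact: z.
  - exact: z.
  - exact: z.
  - by rewrite (dx_log nd).
have mxx l j : dx (dx (m l j)) q = nth 0 (nth [::] [::
    [:: dx (dx (dx X)) q / Tt T q; dx (dx p) q / Tt T q; 0]; [:: 0; 0; 0];
    [:: 0; 0; (dx p q + p q ^+ 2) * U q / Tt T q]] l) j.
  rewrite /m (mxE' l j) (div_dxx nd (mxa l j)).
  have z c (a : R) : dx (dx (fun _ : 'rV[R]_2 => c : R)) q / a = 0.
    by rewrite !dx_cst mul0r.
  elim/ord3P: l; elim/ord3P: j => /=.
  - exact: erefl.
  - exact: erefl.
  - exact: z.
  - exact: z.
  - exact: z.
  - exact: z.
  - exact: z.
  - exact: z.
  - by rewrite (dxx_log nd).
have sl j : aff_slope y X (lift_g_row T X U) (lift_g_mx T X U) s 0 j =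
  lift_slope (Tt T q) (dx X q) (dx (dx X) q) (dx (dt X) q) (U q) (p q) (dx p q) (dx rho q)
    (fun i => g 0 i) (fun i => s 0 i) j.
  apply: etrans (mxE _ _ _ _) _; rewrite sum3 /lift_slope.
  congr ((_ + _) / _); first exact: Wx.
  by congr (_ * _ + _ * _ + (_ * _ + _ * _) + (_ * _ + _ * _));
    [exact: (mx 0 j) | exact: (m0 0 j) | exact: (mx 1 j) | exact: (m0 1 j)
    | exact: (mx 2 j) | exact: (m0 2 j)].
have val j : (lift_g_row T X U q + g *m lift_g_mx T X U q) 0 j =
  lift_value (Tt T q) (dx X q) (dt X q) (U q) (p q) (rho q) (fun i => g 0 i) j.
  rewrite affine_entry sum3 /lift_value; congr (_ + (_ * _ + _ * _ + _ * _)).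
  - exact: (W0 j).
  - exact: (m0 0 j).
  - exact: (m0 1 j).
  - exact: (m0 2 j).
have rhsE tc bq (v : 'rV[R]_3) c j : DE1_rhs tc bq v c j = DE1_poly (cA tc bq) (cB tc bq)
    (cC tc bq) (dx (cA tc) bq) (dt (cA tc) bq) (dx (cB tc) bq) (dt (cB tc) bq)
    (dx (cC tc) bq) (dt (cC tc) bq) (fun i => v 0 i) (fun i => c 0 i) j by [].
have polyE A B C Ax At Bx Bt Cx Ct (v v' c c' : 'I_3 -> R) : v =1 v' -> c =1 c' ->
    DE1_poly A B C Ax At Bx Bt Cx Ct v c =1 DE1_poly A B C Ax At Bx Bt Cx Ct v' c'.
  by move=> /funext -> /funext ->.
rewrite /aff_master !sum3 (rhsE th') (polyE _ _ _ _ _ _ _ _ _ _ _ _ _ val sl) !rhsE sl.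
have alg (a a' b b' c c' : R) : a = a' -> b = b' -> c = c' -> a - b = c <-> a' - b' = c'.
  by move=> -> -> ->.
apply: alg.
- congr (_ + (_ * _ + _ * _ + (_ * _ + _ * _) + (_ * _ + _ * _))).
  + exact: (Wt k).
  + exact: (mt 0 k).
  + exact: (m0 0 k).
  + exact: (mt 1 k).
  + exact: (m0 1 k).
  + exact: (mt 2 k).
  + exact: (m0 2 k).
- exact: erefl.
- congr (_ * (_ + (_ * _ + _ * _ + (_ * _ + _ * _) + (_ * _ + _ * _)) - _) + _).
  + exact: (Wxx k).
  + exact: (mxx 0 k).
  + exact: (mx 0 k).
  + exact: (mxx 1 k).
  + exact: (mx 1 k).
  + exact: (mxx 2 k).
  + exact: (mx 2 k).
Qed.


End LiftMasterIff.

(** * The transformation law read off from the determining equations *)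

Section DE1Maps.
Variable R : realType.
Variables (T : R -> R) (X U : 'rV[R]_2 -> R) (th th' : coefs R).

(** T_t times the transformed coefficients, as functions of the source point. Separating the factor
    1 / T_t, constant in x, lets one quotient rule serve all three. *)
Definition new_A q := dx X q ^+ 2 * cA th q.
Definition new_B q := dx X q * (cB th q - 2 * log_dx U q * cA th q)
  - (dt X q - cA th q * dx (dx X) q).
Definition new_C q := log_dt U q + cA th q * (log_dx U q ^+ 2 - dx (log_dx U) q)
  - cB th q * log_dx U q + cC th q.

Lemma coefs_relE q : nondegenerate_at T X U q -> coefs_rel T X U th th' q <->
  [/\ cA th' (base T X q) = new_A q / Tt T q, cB th' (base T X q) = new_B q / Tt T q
    & cC th' (base T X q) = new_C q / Tt T q].
Proof.
move=> nd; have [T0 X0 U0] := nondegenerate_neq0 nd; have [_ _ Ua _] := nd.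
rewrite /coefs_rel (Lop_inv th Ua U0).
have -> : dx X q ^+ 2 / Tt T q * cA th q = new_A q / Tt T q by rewrite mulrAC.
have -> : dx X q / Tt T q * (cB th q - 2 * (dx U q / U q) * cA th q) -
   (dt X q - cA th q * dx (dx X) q) / Tt T q = new_B q / Tt T q.
  by rewrite /new_B [RHS]mulrBl; congr (_ - _); exact: mulrAC.
suff -> : - (U q / Tt T q) * (- dt U q / U q ^+ 2 -
   cA th q * (2 * dx U q ^+ 2 / U q ^+ 3 - dx (dx U) q / U q ^+ 2) +
   cB th q * dx U q / U q ^+ 2 - cC th q / U q) = new_C q / Tt T q by [].
rewrite /new_C (dx_log_dx nd) /log_dx /log_dt.
have alg (t u ut ux uxx A B C : R) : t != 0 -> u != 0 ->
  - (u / t) * (- ut / u ^+ 2 - A * (2 * ux ^+ 2 / u ^+ 3 - uxx / u ^+ 2) + B * ux / u ^+ 2 - C / u)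
  = (ut / u + A * ((ux / u) ^+ 2 - (uxx / u - (ux / u) ^+ 2)) - B * (ux / u) + C) / t.
  by move=> t0 u0; field; rewrite t0 u0.
exact: alg.
Qed.

Section Derivatives.
Variable q : 'rV[R]_2.
Hypothesis nd : nondegenerate_at T X U q.
Hypothesis tha : admissible th q.
Let p := log_dx U.
Let rho := log_dt U.

Let Aa : analytic_at (cA th) q. Proof. by case: tha. Qed.
Let Ba : analytic_at (cB th) q. Proof. by case: tha. Qed.
Let Ca : analytic_at (cC th) q. Proof. by case: tha. Qed.
Let Xa : analytic_at X q. Proof. by case: nd. Qed.
Let pa : analytic_at p q. Proof. exact: analytic_log_dx nd. Qed.
Let ra : analytic_at rho q. Proof. exact: analytic_log_dt nd. Qed.

Lemma isD_new_A v : isD v new_A q (2 * dx X q * 'D_v (dx X) q * cA th q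
  + dx X q ^+ 2 * 'D_v (cA th) q).
Proof. exact: isD_mul (isD_sqr (isD_of v (analytic_dx Xa))) (isD_of v Aa). Qed.

Lemma isD_new_B v : isD v new_B q
  ('D_v (dx X) q * (cB th q - 2 * p q * cA th q)
   + dx X q * ('D_v (cB th) q - 2 * 'D_v p q * cA th q - 2 * p q * 'D_v (cA th) q)
   - ('D_v (dt X) q - 'D_v (cA th) q * dx (dx X) q - cA th q * 'D_v (dx (dx X)) q)).
Proof.
have h1 := isD_mul (isD_mul (isD_cst v 2 q) (isD_of v pa)) (isD_of v Aa).
have h2 := isD_mul (isD_of v (analytic_dx Xa)) (isD_add (isD_of v Ba) (isD_opp h1)).
have h3 := isD_mul (isD_of v Aa) (isD_of v (analytic_dx (analytic_dx Xa))).
have h := isD_add h2 (isD_opp (isD_add (isD_of v (analytic_dt Xa)) (isD_opp h3))).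
apply: isD_eq h _; rewrite -/p.
have alg (a b c d e f g h i j k P A : R) :
  a * (b - 2 * P * A) + c * (d + - ((0 * P + 2 * e) * A + 2 * P * f)) +
  - (g + - (f * h + A * i)) =
  a * (b - 2 * P * A) + c * (d - 2 * e * A - 2 * P * f) - (g - f * h - A * i) by ring.
exact: (alg _ _ _ _ _ _ _ _ _ 0 0).
Qed.

Lemma isD_new_C v : isD v new_C q
  ('D_v rho q + 'D_v (cA th) q * (p q ^+ 2 - dx p q) + cA th q * (2 * p q * 'D_v p q - 'D_v (dx p) q)
   - 'D_v (cB th) q * p q - cB th q * 'D_v p q + 'D_v (cC th) q).
Proof.
have h1 := isD_add (isD_sqr (isD_of v pa)) (isD_opp (isD_of v (analytic_dx pa))).
have h2 := isD_add (isD_of v ra) (isD_mul (isD_of v Aa) h1).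
have h3 := isD_add h2 (isD_opp (isD_mul (isD_of v Ba) (isD_of v pa))).
apply: isD_eq (isD_add h3 (isD_of v Ca)) _; rewrite -/p.
have alg (a b c d e f g h : R) :
  a + (b + c) + - (d + e) + f = a + b + c - d - e + f by ring.
exact: (alg _ _ _ _ _ _ 0 0).
Qed.

End Derivatives.

(** The chain rule through [base] is a triangular system for the derivatives of c at the image
    point: its x-equation gives the x-derivative, and then its t-equation gives the t-derivative. *)
Lemma new_derivs q f c : nondegenerate_at T X U q ->
  analytic_at c (base T X q) -> analytic_at f q ->
  (\forall q' \near q, c (base T X q') = f q' / Tt T q') ->
  dx c (base T X q) = dx f q / Tt T q / dx X q /\
  dt c (base T X q) = (dt f q / Tt T q - dt (Tt T) q / Tt T q * (f q / Tt T q)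
    - dt X q * (dx f q / Tt T q / dx X q)) / Tt T q.
Proof.
move=> nd ca fa cE; have [T0 X0 U0] := nondegenerate_neq0 nd; have [Ta Xa _ _] := nd.
have ex : dx X q * dx c (base T X q) = dx f q / Tt T q.
  apply: etrans (esym (dx_base Ta Xa ca)) _; apply: etrans (derive_eq 'e_1 cE) _.
  exact: (div_dx nd fa).
have et : Tt T q * dt c (base T X q) + dt X q * dx c (base T X q) =
    dt f q / Tt T q - f q * (dt (Tt T) q / Tt T q) / Tt T q.
  apply: etrans (esym (dt_base Ta Xa ca)) _; apply: etrans (derive_eq 'e_0 cE) _.
  exact: (div_dt nd fa).
have e1 : dx c (base T X q) = dx f q / Tt T q / dx X q by rewrite -ex mulrC mulKf.
split; first exact: e1.
apply: (mulfI T0); rewrite -e1 [RHS]mulrC divfK//; apply: (addIr (dt X q * dx c (base T X q))).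
by rewrite subrK et; congr (_ - _); rewrite [RHS]mulrA; congr (_ * _); exact: mulrC.
Qed.

(** The target system contains first derivatives of A', B', C', so the law is used on a
    neighbourhood and differentiated. The values obtained are those for which the algebraic identity
    [lift_holds] was verified. *)
Lemma DE1_lift_rel (y : 'rV[R]_(2 + 3)) : let q := lsubmx y in
  nondegenerate_at T X U q -> admissible th q -> admissible th' (base T X q) ->
  coefs_transformed T X U q th th' ->
  forall s k, aff_master (@DE1_rhs R) y T X (lift_g_row T X U) (lift_g_mx T X U) th th' s k.
Proof.
move=> q nd tha tha' ct s k; apply/(lift_g_master nd) => /=.
have [T0 X0 U0] := nondegenerate_neq0 nd; have [_ Xa Ua _] := nd.
have rel : \forall q' \near q, [/\ cA th' (base T X q') = new_A q' / Tt T q',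
    cB th' (base T X q') = new_B q' / Tt T q' & cC th' (base T X q') = new_C q' / Tt T q'].
  by apply: filterS (filterI (nondegenerate_near nd) ct) => q' [nd'] /(coefs_relE nd').
have [Aq Bq Cq] := nbhs_singleton rel; have [A'a B'a C'a _] := tha'; have [_ _ _ A0] := tha.
have relA : \forall q' \near q, cA th' (base T X q') = new_A q' / Tt T q'.
  by apply: filterS rel => q' [].
have relB : \forall q' \near q, cB th' (base T X q') = new_B q' / Tt T q'.
  by apply: filterS rel => q' [].
have relC : \forall q' \near q, cC th' (base T X q') = new_C q' / Tt T q'.
  by apply: filterS rel => q' [].
have [ax at'] := new_derivs nd A'a (isD_new_A nd tha 'e_1).1 relA.
have [bx bt] := new_derivs nd B'a (isD_new_B nd tha 'e_1).1 relB.
have [cx ct'] := new_derivs nd C'a (isD_new_C nd tha 'e_1).1 relC.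
(* Differentiating the law in t produces t-derivatives of x-derivatives, whereas the algebraic
   identity has them in the other order; [c1] to [c4] interchange them. *)
have c1 : dt (dx X) q = dx (dt X) q by rewrite (dx_dt Xa).
have c2 : dt (dx (dx X)) q = dx (dx (dt X)) q.
  rewrite -(dx_dt (analytic_dx Xa)); apply: derive_eq.
  by apply: filterS (analytic_near Xa) => q' Xa'; exact: esym (dx_dt Xa').
have c3 : dt (log_dx U) q = dx (log_dt U) q := dt_log_dx nd.
have c4 : dt (dx (log_dx U)) q = dx (dx (log_dt U)) q.
  rewrite -(dx_dt (analytic_log_dx nd)); apply: derive_eq.
  by apply: filterS (nondegenerate_near nd) => q' nd'; exact: dt_log_dx nd'.
have dAx : dx new_A q = _ := dxE (isD_new_A nd tha 'e_1).
have dBx : dx new_B q = _ := dxE (isD_new_B nd tha 'e_1).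
have dCx : dx new_C q = _ := dxE (isD_new_C nd tha 'e_1).
have dAt := dtE (isD_new_A nd tha 'e_0).
have dBt := dtE (isD_new_B nd tha 'e_0).
have dCt := dtE (isD_new_C nd tha 'e_0).
have eA : lA (Tt T q) (dx X q) (cA th q) = new_A q / Tt T q by exact: mulrAC.
have eB : lB (Tt T q) (dx X q) (dt X q) (dx (dx X) q) (log_dx U q) (cA th q) (cB th q) =
    new_B q / Tt T q.
  by rewrite /lB /new_B [RHS]mulrBl; congr (_ - _); exact: mulrAC.
have eC : lC (Tt T q) (log_dx U q) (dx (log_dx U) q) (log_dt U q) (cA th q) (cB th q) (cC th q)
   = new_C q / Tt T q by [].
have tA (a b c : R) : a = b -> 2 * dx X q * a * cA th q + dx X q ^+ 2 * c =
  2 * dx X q * b * cA th q + dx X q ^+ 2 * c by move=> ->.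
have fAt := etrans dAt (tA _ _ _ c1).
have tB (a a' b b' c c' P x r z w v A B : R) : a = a' -> b = b' -> c = c' ->
  a * P + x * (r - 2 * b * A - B) - (z - w - v * c) =
  a' * P + x * (r - 2 * b' * A - B) - (z - w - v * c') by move=> -> -> ->.
have fBt := etrans dBt (tB _ _ _ _ _ _ _ _ _ _ _ _ _ _ c1 c3 c2).
have tC (a a' b b' x r z w v u : R) : a = a' -> b = b' ->
  x + r + z * (w * a - b) - v - u * a = x + r + z * (w * a' - b') - v - u * a' by move=> -> ->.
have fCt := etrans dCt (congr1 (fun x => x + dt (cC th) q) (tC _ _ _ _ _ _ _ _ _ _ c3 c4)).
have comb (n n' d d' h v l t x c : R) : n = n' -> d = d' -> l = v / t ->
  (n / t - h * (v / t) - x * (d / t / c)) / t = (n' / t - h * l - x * (d' / t / c)) / t.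
  by move=> -> -> ->.
apply: lift_holds_eq.
- exact: T0.
- exact: X0.
- exact: A0.
- exact: etrans Aq (esym eA).
- exact: etrans Bq (esym eB).
- exact: etrans Cq (esym eC).
- exact: etrans ax (congr1 (fun a => a / Tt T q / dx X q) dAx).
- exact: etrans at' (comb _ _ _ _ _ _ _ _ _ _ fAt dAx eA).
- exact: etrans bx (congr1 (fun a => a / Tt T q / dx X q) dBx).
- exact: etrans bt (comb _ _ _ _ _ _ _ _ _ _ fBt dBx eB).
- exact: etrans cx (congr1 (fun a => a / Tt T q / dx X q) dCx).
- exact: etrans ct' (comb _ _ _ _ _ _ _ _ _ _ fCt dCx eC).
Qed.

(** To obtain the law, one fibre point over each q is enough, because the free slopes already
    separate B' and C'. The converse is [DE1_lift_rel] at every nearby point. *)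
Lemma DE1_maps Phi (z : 'rV[R]_(2 + 3)) :
  germ_eq z Phi (lift_g T X U) -> nondegenerate_at T X U (lsubmx z) ->
  admissible th (lsubmx z) -> admissible th' (base T X (lsubmx z)) ->
  maps_system (@DE1 R) Phi z th th' <-> coefs_transformed T X U (lsubmx z) th th'.
Proof.
move=> PU nd tha tha'; have ndn := nondegenerate_near nd.
have near_adm (tc : coefs R) p : admissible tc p -> \forall q \near p, admissible tc q.
  move=> [Aa Ba Ca A0]; apply: filterS (filterI (filterI (analytic_near Aa) (analytic_near Ba))
    (filterI (analytic_near Ca) (analytic_neq0 Aa A0))) => q [[a b] [c d]].
  by split; [exact: a | exact: b | exact: c | exact: d].
have [Ta Xa _ _] := nd.
have bc : {for lsubmx z, continuous (base T X)} by apply/analytic_map_cont/analytic_base.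
have adn' : \forall q \near lsubmx z, admissible th' (base T X q) := bc _ (near_adm _ _ tha').
have adn := near_adm _ _ tha.
have PA : germ_eq z Phi (aff T X (lift_g_row T X U) (lift_g_mx T X U)).
  by apply: filterS PU => y ->; exact: lift_g_aff.
have nq : \forall q \near lsubmx z, [/\ aff_analytic T X (lift_g_row T X U) (lift_g_mx T X U) q,
    Tt T q != 0, dx X q != 0, lift_g_mx T X U q \in unitmx & cA th q != 0].
  apply: filterS (filterI ndn adn) => q [h [_ _ _ hA]].
  have [T0 X0 _] := nondegenerate_neq0 h.
  split; [exact: lift_g_analytic | exact: T0 | exact: X0 | exact: (lift_g_unit h) | exact: hA].
have -> := maps_system_aff th' (ltn0Sn 2) (@DE1_evolution R) PA nq.
split=> [/near_fibre[r r0 h]|h].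
  apply: filterS (filterI (filterI ndn adn) h) => q [[ndq adq] hv].
  have v0 : in_box r (0 : 'rV[R]_3) by move=> i; rewrite mxE normr0 ltW.
  have [T0 X0 U0] := nondegenerate_neq0 ndq; have [_ _ _ A0] := adq.
  have := hv _ v0; set y := row_mx q _; have yq : lsubmx y = q by rewrite row_mxKl.
  rewrite yq => -[hA hM].
  have ndy : nondegenerate_at T X U (lsubmx y) by rewrite yq.
  apply/(coefs_relE ndq).
  have key (s : 'I_3 -> R) k := (lift_g_master ndy th th' (\row_i s i) k).1 (hM _ k).
  move: key; rewrite /= yq => key.
  have sE (s : 'I_3 -> R) : (fun i => (\row_i s i) 0 i) = s by apply/funext => i; rewrite mxE.
  have AE : dx X q ^+ 2 * cA th q = cA th' (base T X q) * Tt T q by rewrite -hA mulrC.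
  have [] := lift_solve T0 X0 A0 AE (g := fun i => rsubmx y 0 i)
    (fun s k => etrans (etrans (congr1 (fun s => lift_lhs _ _ _ _ _ _ _ _ _ _ _ _ _ _ _ _ _ _ _ _ _ _ _ s k) (esym (sE s))) (key s k)) (congr1 (fun s => lift_rhs _ _ _ _ _ _ _ _ _ _ _ _ _ _ _ _ _ _ _ _ _ _ _ _ _ s k) (sE s))).
  move=> -> ->; split; [by rewrite /new_A AE mulfK | | by []].
  by rewrite /lB /new_B [RHS]mulrBl; congr (_ - _); exact: mulrAC.
have ct : coefs_transformed T X U (lsubmx z) th th' by exact: h.
apply: filterS (filterI (filterI (near_lsubmx ndn) (near_lsubmx (filterI adn adn')))
  (near_lsubmx (near_join ct))) => y [[ndy [ady ady']] cty] /=.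
split; last exact: DE1_lift_rel.
have [-> _ _] := nbhs_singleton cty; have [T0 _ _] := nondegenerate_neq0 ndy.
by move: T0; gen_derive; move: (Tt T _) => tt t0; field.
Qed.

End DE1Maps.

(** * The two pseudogroups *)

Section PointTransformation.
Variable R : realType.

Lemma point_transformation_germ n (Phi Phi' : 'rV[R]_(2 + n) -> 'rV[R]_(2 + n)) z :
  germ_eq z Phi Phi' -> point_transformation Phi z -> point_transformation Phi' z.
Proof.
move=> e [Pa [Psi Psia [l r]]]; have ez : Phi z = Phi' z := nbhs_singleton e.
split; first exact: analytic_map_eq e Pa.
exists Psi; first by rewrite -ez.
split; first by apply: filterS (filterI e l) => y [/= <-].
rewrite -ez; have PsiPhi : Psi (Phi z) = z := nbhs_singleton l.
have c : {for Phi z, continuous Psi} := analytic_map_cont Psia.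
have e' : \forall y \near Psi (Phi z), Phi y = Phi' y by rewrite PsiPhi.
by apply: filterS (filterI r (c _ e')) => y [h2 h1]; apply: etrans (esym h1) h2.
Qed.

Lemma analytic_map_near m n (f : 'rV[R]_m -> 'rV[R]_n) a : analytic_map_at f a ->
  \forall b \near a, analytic_map_at f b.
Proof.
move=> fa; apply: (@filter_forall _ _ (fun k b => analytic_at (fun q => f q 0 k) b) (nbhs a) _) => k.
exact: analytic_near (fa k).
Qed.

Definition base_iso (T : R -> R) (X : 'rV[R]_2 -> R) p :=
  exists2 S : 'rV[R]_2 -> 'rV[R]_2, analytic_map_at S (base T X p) &
    (\forall q \near p, S (base T X q) = q) /\
    (\forall b \near base T X p, base T X (S b) = b).

Lemma base_iso_near (T : R -> R) (X : 'rV[R]_2 -> R) p : analytic_map_at (base T X) p ->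
  base_iso T X p -> \forall q \near p, base_iso T X q.
Proof.
move=> ba [S Sa [l r]]; have c : {for p, continuous (base T X)} := analytic_map_cont ba.
have n1 : \forall q \near p, analytic_map_at S (base T X q) := c _ (analytic_map_near Sa).
have n2 : \forall q \near p, \forall b \near base T X q, base T X (S b) = b := c _ (near_join r).
apply: filterS (filterI n1 (filterI (near_join l) n2)) => q [h1 [h2 h3]].
by exists S; [exact: h1 | split; [exact: h2 | exact: h3]].
Qed.

Section Aff.
Variables (n : nat) (T : R -> R) (X : 'rV[R]_2 -> R) (w0 : 'rV[R]_2 -> 'rV[R]_n).
Variables (M N : 'rV[R]_2 -> 'M[R]_n) (z : 'rV[R]_(2 + n)).
Let p := lsubmx z.
Hypothesis an : aff_analytic T X w0 M p.
Hypothesis Na : forall l k, analytic_at (fun q => N q l k) p.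
Hypothesis MN : \forall q \near p, M q *m N q = 1%:M.

Let solve (v : 'rV[R]_n) q := (v - w0 q) *m N q.

Let solve_analytic m (v : 'rV[R]_m -> 'rV[R]_n) (s : 'rV[R]_m -> 'rV[R]_2) b : s b = p ->
  analytic_map_at v b -> analytic_map_at s b -> analytic_map_at (fun b => solve (v b) (s b)) b.
Proof.
move=> sb va sa k; have [_ _ wa _] := an.
apply: (analytic_ext (f := fun b => \sum_l (v b 0 l - w0 (s b) 0 l) * N (s b) l k)).
  by move=> b'; rewrite mxE; apply: eq_bigr => l _; rewrite !mxE.
apply: analytic_sum => l; apply: analyticM; last first.
  by apply: (analytic_comp (f := fun q => N q l k) sa); rewrite sb; exact: Na.
apply: analyticB; first exact: va.
by apply: (analytic_comp (f := fun q => w0 q 0 l) sa); rewrite sb; exact: wa.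
Qed.

(** The inverse [Psi] is restricted to the slice with fibre value [v1], and its base part is taken.
    As base components do not involve the unknowns, this inverts [base]. *)
Lemma aff_base_iso : point_transformation (aff T X w0 M) z -> base_iso T X p.
Proof.
move=> [_ [Psi Psia [l r]]]; set v1 := rsubmx (aff T X w0 M z).
have zE : aff T X w0 M z = row_mx (base T X p) v1.
  by rewrite -[LHS]hsubmxK; congr row_mx; rewrite /aff row_mxKl.
have emba : analytic_map_at (fun b : 'rV[R]_2 => row_mx b v1) (base T X p).
  by apply: analytic_map_row_mx; [exact: analytic_map_id | exact: analytic_map_cst].
exists (fun b => lsubmx (Psi (row_mx b v1))).
  apply: analytic_lsubmx; apply: (analytic_map_comp emba); rewrite -zE; exact: Psia.
split.
  (* This section through z is carried by the map into the slice where [Psi] was restricted. *)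
  have ya : analytic_map_at (fun q => row_mx q (solve v1 q)) p.
    apply: analytic_map_row_mx; first exact: analytic_map_id.
    by apply: (solve_analytic (v := fun=> v1) (s := id)) => //;
      [exact: analytic_map_cst | exact: analytic_map_id].
  have yp : row_mx p (solve v1 p) = z.
    rewrite /solve /v1 /aff row_mxKr addrC addKr -mulmxA (nbhs_singleton MN) mulmx1.
    exact: hsubmxK.
  have yc : {for p, continuous (fun q => row_mx q (solve v1 q))} := analytic_map_cont ya.
  have l' : \forall y \near row_mx p (solve v1 p), Psi (aff T X w0 M y) = y by rewrite yp.
  have l'' : \forall q \near p, Psi (aff T X w0 M (row_mx q (solve v1 q))) =
    row_mx q (solve v1 q) := yc _ l'.
  apply: filterS (filterI MN l'') => q [MNq].
  have -> : aff T X w0 M (row_mx q (solve v1 q)) = row_mx (base T X q) v1.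
    rewrite /aff row_mxKl row_mxKr /solve -mulmxA (mulmx1C MNq) mulmx1.
    by rewrite [w0 q + _]addrC subrK.
  by move=> ->; rewrite row_mxKl.
have r' : \forall y \near row_mx (base T X p) v1, aff T X w0 M (Psi y) = y by rewrite -zE.
have c : {for base T X p, continuous (fun b : 'rV[R]_2 => row_mx b v1)} := analytic_map_cont emba.
have r'' : \forall b \near base T X p, aff T X w0 M (Psi (row_mx b v1)) = row_mx b v1 := c _ r'.
apply: filterS r'' => b /(congr1 lsubmx).
by rewrite [aff _ _ _ _ _]/aff !row_mxKl.
Qed.

Lemma aff_point_transformation : base_iso T X p -> point_transformation (aff T X w0 M) z.
Proof.
move=> [S Sa [l r]]; split; first exact: aff_map_analytic.
have zE : lsubmx (aff T X w0 M z) = base T X p by rewrite /aff row_mxKl.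
have Sp : S (base T X p) = p := nbhs_singleton l.
exists (fun y => row_mx (S (lsubmx y)) (solve (rsubmx y) (S (lsubmx y)))).
  have la : analytic_map_at (fun y : 'rV[R]_(2 + n) => lsubmx y) (aff T X w0 M z).
    by apply: analytic_lsubmx; exact: analytic_map_id.
  have ra : analytic_map_at (fun y : 'rV[R]_(2 + n) => rsubmx y) (aff T X w0 M z).
    by apply: analytic_rsubmx; exact: analytic_map_id.
  have Sla : analytic_map_at (fun y : 'rV[R]_(2 + n) => S (lsubmx y)) (aff T X w0 M z).
    by apply: (analytic_map_comp la); rewrite zE.
  by apply: analytic_map_row_mx; [exact: Sla | apply: solve_analytic; rewrite ?zE].
split.
  apply: filterS (filterI (near_lsubmx l) (near_lsubmx MN)) => y [Sy MNy] /=.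
  rewrite /aff row_mxKl row_mxKr Sy /solve addrC addKr -mulmxA MNy mulmx1.
  exact: hsubmxK.
have Sc : {for base T X p, continuous S} := analytic_map_cont Sa.
have MN' : \forall q \near S (base T X p), M q *m N q = 1%:M by rewrite Sp.
have nb : \forall b \near base T X p, base T X (S b) = b /\ M (S b) *m N (S b) = 1%:M.
  exact: filterI r (Sc _ MN').
rewrite -zE in nb; apply: filterS (near_lsubmx nb) => y [by1 MNy] /=.
rewrite /aff row_mxKl row_mxKr by1 /solve -mulmxA (mulmx1C MNy) mulmx1 addrC subrK.
exact: hsubmxK.
Qed.

End Aff.
End PointTransformation.

(** * Canonical lifts as equivalence transformations *)

Section CanonicalEquivalences.
Variable R : realType.
Variables (T : R -> R) (X U : 'rV[R]_2 -> R).

Lemma lift_u_inv_analytic q : nondegenerate_at T X U q ->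
  forall l k, analytic_at (fun q => lift_u_inv U q l k) q.
Proof.
move=> nd l k; have [_ _ U0] := nondegenerate_neq0 nd; have [_ _ Ua _] := nd.
apply: (analytic_ext (f := fun q => (U q)^-1)); first by move=> q'; rewrite mxE.
exact: analyticV.
Qed.

Lemma lift_g_inv_analytic q : nondegenerate_at T X U q ->
  forall l k, analytic_at (fun q => lift_g_inv T X U q l k) q.
Proof.
move=> nd; have [T0 X0 U0] := nondegenerate_neq0 nd; have [Ta Xa Ua _] := nd.
have Tta := analytic_Tt Ta; have Xxa := analytic_dx Xa; have Uxa := analytic_dx Ua.
have XU : dx X q * U q != 0 by apply: mulf_neq0.
have z : analytic_at (fun _ : 'rV[R]_2 => 0 : R) q := analytic_cst 0 q.
have E l k (q' : 'rV[R]_2) : (nth [::] [::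
  [:: Tt T q' / dx X q'; - (Tt T q' * dx U q' / (dx X q' * U q')); 0];
  [:: 0; Tt T q'; 0]; [:: 0; 0; Tt T q' / U q']] (l : 'I_3))`_(k : 'I_3) = lift_g_inv T X U q' l k.
  by rewrite mxE.
apply: ord3P; apply: ord3P; apply: (analytic_ext (E _ _)) => /=.
- exact: analyticM Tta (analyticV X0 Xxa).
- exact: analyticN (analyticM (analyticM Tta Uxa) (analyticV XU (analyticM Xxa Ua))).
- exact: z.
- exact: z.
- exact: Tta.
- exact: z.
- exact: z.
- exact: z.
- exact: analyticM Tta (analyticV U0 Ua).
Qed.

Definition canonical_at p := nondegenerate_at T X U p /\ base_iso T X p.

Lemma nondegenerate_base p : nondegenerate_at T X U p -> analytic_map_at (base T X) p.
Proof. by move=> [Ta Xa _ _]; exact: analytic_base. Qed.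

Lemma canonical_near p : canonical_at p -> \forall q \near p, canonical_at q.
Proof.
move=> [nd iso]; apply: filterS (filterI (nondegenerate_near nd)
  (base_iso_near (nondegenerate_base nd) iso)) => q [h1 h2].
by split; [exact: h1 | exact: h2].
Qed.

Let lift_uE : lift_u T X U = aff T X (fun=> 0) (lift_u_mx U).
Proof. by apply/funext => y; exact: lift_u_aff. Qed.

Let lift_gE : lift_g T X U = aff T X (lift_g_row T X U) (lift_g_mx T X U).
Proof. by apply/funext => y; exact: lift_g_aff. Qed.

Lemma lift_u_iso Phi (z : 'rV[R]_(2 + 1)) : nondegenerate_at T X U (lsubmx z) ->
  germ_eq z Phi (lift_u T X U) ->
  (point_transformation Phi z <-> base_iso T X (lsubmx z)).
Proof.
move=> nd e.
have K : \forall q \near lsubmx z, lift_u_mx U q *m lift_u_inv U q = 1%:M.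
  by apply: filterS (nondegenerate_near nd) => q; exact: lift_u_invK.
have an := lift_u_analytic nd; have Na := lift_u_inv_analytic nd.
rewrite lift_uE in e; split=> h.
  exact: aff_base_iso an Na K (point_transformation_germ e h).
exact: point_transformation_germ (germ_eq_sym e) (aff_point_transformation an Na K h).
Qed.

Lemma lift_g_iso Phi (z : 'rV[R]_(2 + 3)) : nondegenerate_at T X U (lsubmx z) ->
  germ_eq z Phi (lift_g T X U) ->
  (point_transformation Phi z <-> base_iso T X (lsubmx z)).
Proof.
move=> nd e.
have K : \forall q \near lsubmx z, lift_g_mx T X U q *m lift_g_inv T X U q = 1%:M.
  by apply: filterS (nondegenerate_near nd) => q; exact: lift_g_invK.
have an := lift_g_analytic nd; have Na := lift_g_inv_analytic nd.
rewrite lift_gE in e; split=> h.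
  exact: aff_base_iso an Na K (point_transformation_germ e h).
exact: point_transformation_germ (germ_eq_sym e) (aff_point_transformation an Na K h).
Qed.

(** The law prescribes the new coefficients at [base T X q] in terms of q; composition with the
    analytic local inverse S makes them functions of the image point. *)
Lemma transformed_ex p th : canonical_at p -> admissible th p ->
  exists2 th', admissible th' (base T X p) & coefs_transformed T X U p th th'.
Proof.
move=> [nd [S Sa [l _]]] tha; have [T0 X0 U0] := nondegenerate_neq0 nd.
have Sp : S (base T X p) = p := nbhs_singleton l; have [Ta _ _ _] := nd.
pose push f b := f (S b) / Tt T (S b).
have pusha f : analytic_at f p -> analytic_at (push f) (base T X p).
  move=> fa; apply: analyticM; first by apply: (analytic_comp Sa); rewrite Sp.
  apply: (analytic_comp (f := fun q => (Tt T q)^-1) Sa); rewrite Sp.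
  exact: analyticV T0 (analytic_Tt Ta).
exists (Coefs (push (new_A X th)) (push (new_B X U th)) (push (new_C U th))).
  split.
  - exact: pusha (isD_new_A nd tha 'e_1).1.
  - exact: pusha (isD_new_B nd tha 'e_1).1.
  - exact: pusha (isD_new_C nd tha 'e_1).1.
  have [_ _ _ A0] := tha.
  by rewrite /= /push Sp /new_A !mulf_neq0 ?invr_eq0 ?sqrf_eq0.
apply: filterS (filterI (nondegenerate_near nd) l) => q [ndq Sq].
by apply/(coefs_relE _ _ ndq); rewrite /= /push Sq.
Qed.

Lemma canonical_parabolic Phi (z : 'rV[R]_(2 + 1)) : canonical_at (lsubmx z) ->
  germ_eq z Phi (lift_u T X U) -> equivalence (@parabolic R) Phi z.
Proof.
move=> /canonical_near/near_lsubmx cz e.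
apply: filterS (filterI cz (near_join e)) => y [[nd iso] ey].
split; first exact/(lift_u_iso nd ey).
move=> th tha; have [th' tha' ct] := transformed_ex (conj nd iso) tha.
exists th'; last exact/(parabolic_maps th' ey nd tha).
by rewrite (nbhs_singleton ey) /lift_u row_mxKl.
Qed.

Lemma canonical_DE1 Phi (z : 'rV[R]_(2 + 3)) : canonical_at (lsubmx z) ->
  germ_eq z Phi (lift_g T X U) -> equivalence (@DE1 R) Phi z.
Proof.
move=> /canonical_near/near_lsubmx cz e.
apply: filterS (filterI cz (near_join e)) => y [[nd iso] ey].
split; first exact/(lift_g_iso nd ey).
move=> th tha; have [th' tha' ct] := transformed_ex (conj nd iso) tha.
exists th'; last exact/(DE1_maps ey nd tha tha').
by rewrite (nbhs_singleton ey) /lift_g row_mxKl.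
Qed.

End CanonicalEquivalences.

Section Canonical.
Variable R : realType.

Lemma parabolic_canonical Phi (z : 'rV[R]_(2 + 1)) : equivalence (@parabolic R) Phi z ->
  exists T X U, canonical_at T X U (lsubmx z) /\ germ_eq z Phi (lift_u T X U).
Proof.
move=> eqz; have [T [X [U [nd e]]]] := parabolic_class eqz.
have [Pt _] := nbhs_singleton eqz.
exists T, X, U; split; last exact: e.
by split; [exact: nd | exact: (lift_u_iso nd e).1 Pt].
Qed.

Lemma DE1_canonical Phi (z : 'rV[R]_(2 + 3)) : equivalence (@DE1 R) Phi z ->
  exists T X U, canonical_at T X U (lsubmx z) /\ germ_eq z Phi (lift_g T X U).
Proof.
move=> eqz; have [T [X [U [nd e]]]] := DE1_class eqz.
have [Pt _] := nbhs_singleton eqz.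
exists T, X, U; split; last exact: e.
by split; [exact: nd | exact: (lift_g_iso nd e).1 Pt].
Qed.

End Canonical.

(** * Germs and composition of the triples (T, X, U) *)

Section Germs.
Variable R : realType.
Implicit Types (T : R -> R) (X U : 'rV[R]_2 -> R).

Lemma base0 T X q : base T X q 0 0 = T (q 0 0). Proof. by rewrite mxE. Qed.
Lemma base1 T X q : base T X q 0 1 = X q. Proof. by rewrite mxE. Qed.

Definition same_germ (p : 'rV[R]_2) T X U T' X' U' :=
  \forall q \near p, base T X q = base T' X' q /\ U q = U' q.

(** U is the linear part of the lift in the unknown, so it is recovered by subtracting the values at
    two fibre points over the same q; this works also when the first of them is zero. *)
Lemma lift_u_germ (z : 'rV[R]_(2 + 1)) T X U T' X' U' :
  germ_eq z (lift_u T X U) (lift_u T' X' U') <-> same_germ (lsubmx z) T X U T' X' U'.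
Proof.
split=> [/near_fibre[r r0]|].
  apply: filterS => q h.
  have h0 := h 0; have h1 := h (const_mx r).
  have v0 : in_box r (0 : 'rV[R]_1) by move=> i; rewrite mxE normr0 ltW.
  have v1 : in_box r (const_mx r : 'rV[R]_1) by move=> i; rewrite mxE gtr0_norm.
  move: (h0 v0) (h1 v1); rewrite /lift_u !row_mxKl !row_mxKr.
  move=> /eq_row_mx[e /rowP/(_ 0) e0] /eq_row_mx[_ /rowP/(_ 0) e1]; split; first exact: e.
  have E c (v : 'rV[R]_1) : (c *: (rsubmx z + v)) 0 0 = c * rsubmx z 0 0 + c * v 0 0.
    by rewrite mxE [(_ + _ : 'rV[R]_1) 0 0]mxE mulrDr.
  move: e0 e1; rewrite !E (mxE _ (fun _ _ => 0)) (mxE _ (fun _ _ => r)) !mulr0 !addr0.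
  by move=> -> /addrI; exact: (mulIf (lt0r_neq0 r0)).
move=> /near_lsubmx; apply: filterS => y [e eU].
by rewrite /lift_u e eU.
Qed.

Lemma same_germ_derivs p T X U T' X' U' : same_germ p T X U T' X' U' ->
  \forall q \near p, [/\ Tt T q = Tt T' q, dx X q = dx X' q, dt X q = dt X' q,
    dx U q = dx U' q & dt U q = dt U' q].
Proof.
move=> e.
have eT : \forall q \near p, T ((q : 'rV[R]_2) 0 0) = T' (q 0 0).
  by apply: filterS e => q [h _]; rewrite -(base0 T X) h base0.
have eX : \forall q \near p, X q = X' q.
  by apply: filterS e => q [h _]; rewrite -(base1 T X) h base1.
have eU : \forall q \near p, U q = U' q by apply: filterS e => q [].
apply: filterS (filterI (filterI (near_dt eT) (near_dx eX))
  (filterI (near_dt eX) (filterI (near_dx eU) (near_dt eU)))).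
by move=> q [[h1 h2] [h3 [h4 h5]]]; split=> //; rewrite !TtE.
Qed.

(** The third component yields U / T_t. The germ of T is already known from the base, hence so is
    T_t, and U follows. In the other direction, equality on a neighbourhood gives equality of the
    derivatives that occur in [lift_g]. *)
Lemma lift_g_germ (z : 'rV[R]_(2 + 3)) T X U T' X' U' :
  nondegenerate_at T X U (lsubmx z) ->
  germ_eq z (lift_g T X U) (lift_g T' X' U') <-> same_germ (lsubmx z) T X U T' X' U'.
Proof.
move=> nd; split=> [/near_fibre[r r0 h]|].
  have hb : \forall q \near lsubmx z, base T X q = base T' X' q /\ U q / Tt T q = U' q / Tt T' q.
    apply: filterS h => q h.
    (* Moving g^3 alone isolates the factor U / T_t. *)
    pose v : 'rV[R]_3 := \row_i [:: 0; 0; r]`_i.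
    have v0 : in_box r (0 : 'rV[R]_3) by move=> i; rewrite mxE normr0 ltW.
    have v1 : in_box r v.
      by apply: ord3P; rewrite mxE /= ?normr0 ?gtr0_norm// ltW.
    move: (h 0 v0) (h v v1); rewrite /lift_g !row_mxKl !row_mxKr.
    move=> /eq_row_mx[e /rowP/(_ 2)]; rewrite [LHS]mxE [RHS]mxE /= addr0 => e0.
    move=> /eq_row_mx[_ /rowP/(_ 2)]; rewrite [LHS]mxE [RHS]mxE /= => e1.
    split; first exact: e.
    have vE : (rsubmx z + v) 0 2 = rsubmx z 0 2 + r by rewrite mxE [v _ _]mxE.
    move: e1; rewrite vE !mulrDr e0 => /addrI; exact: (mulIf (lt0r_neq0 r0)).
  have eT : \forall q \near lsubmx z, T ((q : 'rV[R]_2) 0 0) = T' (q 0 0).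
    by apply: filterS hb => q [e _]; rewrite -(base0 T X) e base0.
  apply: filterS (filterI (nondegenerate_near nd) (filterI (near_dt eT) hb)).
  move=> q [/nondegenerate_neq0[T0 _ _] [eTt [e eU]]]; split; first exact: e.
  move: eU; rewrite -!TtE in eTt; rewrite -eTt; apply: mulIf.
  by rewrite invr_eq0.
move=> e; apply: filterS (filterI (near_lsubmx e) (near_lsubmx (same_germ_derivs e))).
move=> y [[eb eU] [eT eXx eXt eUx eUt]].
by rewrite /lift_g eb eU eT eXx eXt eUx eUt.
Qed.

Section Composition.
Variables (T1 T2 : R -> R) (X1 U1 X2 U2 : 'rV[R]_2 -> R).

Definition comp_T t := T2 (T1 t).
Definition comp_X q := X2 (base T1 X1 q).
Definition comp_U q := U2 (base T1 X1 q) * U1 q.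

Lemma base_comp q : base comp_T comp_X q = base T2 X2 (base T1 X1 q).
Proof. by apply/rowP; apply: ord2P; rewrite ?base0 ?base1. Qed.

Lemma lift_u_comp y : lift_u T2 X2 U2 (lift_u T1 X1 U1 y) = lift_u comp_T comp_X comp_U y.
Proof. by rewrite /lift_u !row_mxKl !row_mxKr base_comp scalerA. Qed.

Section At.
Variable p : 'rV[R]_2.
Hypothesis nd1 : nondegenerate_at T1 X1 U1 p.
Hypothesis nd2 : nondegenerate_at T2 X2 U2 (base T1 X1 p).

Let Ta : analytic_at (fun q : 'rV[R]_2 => T1 (q 0 0)) p. Proof. by case: nd1. Qed.
Let Xa : analytic_at X1 p. Proof. by case: nd1. Qed.
Let Ua : analytic_at U1 p. Proof. by case: nd1. Qed.
Let X2a : analytic_at X2 (base T1 X1 p). Proof. by case: nd2. Qed.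
Let U2a : analytic_at U2 (base T1 X1 p). Proof. by case: nd2. Qed.

Lemma Tt_comp : Tt comp_T p = Tt T2 (base T1 X1 p) * Tt T1 p.
Proof.
have [T2a _ _ _] := nd2; rewrite TtE.
have e : dt (fun q => comp_T (q 0 0)) p = dt (fun q => T2 (base T1 X1 q 0 0)) p.
  by apply: derive_ext => q; rewrite base0.
rewrite e (dt_base Ta Xa T2a) -TtE.
have -> : dx (fun q => T2 (q 0 0)) (base T1 X1 p) = 0 := derive_coord1 _ _.
by rewrite mulr0 addr0 mulrC.
Qed.

Lemma dx_comp_U : dx comp_U p =
  dx X1 p * dx U2 (base T1 X1 p) * U1 p + U2 (base T1 X1 p) * dx U1 p.
Proof.
rewrite (dxE (isD_mul (isD_of 'e_1 (isD_base 1 Ta Xa U2a).1) (isD_dx Ua))).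
by congr (_ * _ + _); exact: (dx_base Ta Xa U2a).
Qed.

Lemma dt_comp_U : dt comp_U p = (Tt T1 p * dt U2 (base T1 X1 p)
  + dt X1 p * dx U2 (base T1 X1 p)) * U1 p + U2 (base T1 X1 p) * dt U1 p.
Proof.
rewrite (dtE (isD_mul (isD_of 'e_0 (isD_base 0 Ta Xa U2a).1) (isD_dt Ua))).
by congr (_ * _ + _); exact: (dt_base Ta Xa U2a).
Qed.

Lemma nondegenerate_comp : nondegenerate_at comp_T comp_X comp_U p.
Proof.
have [T10 X10 U10] := nondegenerate_neq0 nd1; have [T20 X20 U20] := nondegenerate_neq0 nd2.
have [T2a _ _ _] := nd2; split.
- apply: analytic_ext (isD_base 0 Ta Xa T2a).1 => q.
  by rewrite base0.
- exact: (isD_base 0 Ta Xa X2a).1.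
- exact: analyticM (isD_base 0 Ta Xa U2a).1 Ua.
- have -> : dx comp_X p = _ := dx_base Ta Xa X2a.
  by rewrite Tt_comp !mulf_neq0.
Qed.

Lemma lift_g_comp_at y : lsubmx y = p ->
  lift_g T2 X2 U2 (lift_g T1 X1 U1 y) = lift_g comp_T comp_X comp_U y.
Proof.
move=> yp; have [T10 X10 U10] := nondegenerate_neq0 nd1.
have [T20 X20 U20] := nondegenerate_neq0 nd2.
rewrite /lift_g !row_mxKl !row_mxKr yp base_comp; congr row_mx.
have -> : dx comp_X p = _ := dx_base Ta Xa X2a.
have -> : dt comp_X p = _ := dt_base Ta Xa X2a.
rewrite Tt_comp dx_comp_U dt_comp_U /comp_U.
have r0 (a b c : R) : (\row_(i < 3) [:: a; b; c]`_i) 0 0 = a by rewrite mxE.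
have r1 (a b c : R) : (\row_(i < 3) [:: a; b; c]`_i) 0 1 = b by rewrite mxE.
have r2 (a b c : R) : (\row_(i < 3) [:: a; b; c]`_i) 0 2 = c by rewrite mxE.
apply/rowP => k; rewrite [LHS]mxE [RHS]mxE r0 r1 r2 {r0 r1 r2}.
move: T10 X10 U10 T20 X20 U20; gen_derive.
move: (rsubmx y 0 0) (rsubmx y 0 1) (rsubmx y 0 2) (base T1 X1 p) => g0 g1 g2 b.
move: (Tt T1 p) (Tt T2 b) (U1 p) (U2 b) => t1 t2 u1 u2 T10 X10 U10 T20 X20 U20.
move: k; apply: ord3P => /=; field; rewrite ?T10 ?T20 ?U10 ?U20 ?X10 ?X20 //.
Qed.

Lemma canonical_comp : base_iso T1 X1 p -> base_iso T2 X2 (base T1 X1 p) ->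
  canonical_at comp_T comp_X comp_U p.
Proof.
move=> [S1 S1a [l1 r1]] [S2 S2a [l2 r2]]; split; first exact: nondegenerate_comp.
have bE : base comp_T comp_X p = base T2 X2 (base T1 X1 p) := base_comp p.
have b1c : {for p, continuous (base T1 X1)} := analytic_map_cont (nondegenerate_base nd1).
have S2c : {for base T2 X2 (base T1 X1 p), continuous S2} := analytic_map_cont S2a.
have S2b : S2 (base T2 X2 (base T1 X1 p)) = base T1 X1 p := nbhs_singleton l2.
exists (S1 \o S2).
  by rewrite bE; apply: (analytic_map_comp S2a); rewrite S2b.
have l2' : \forall q \near p, S2 (base T2 X2 (base T1 X1 q)) = base T1 X1 q := b1c _ l2.
split; first by apply: filterS (filterI l1 l2') => q [e1 e2]; rewrite base_comp /= e2.
rewrite -S2b in r1.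
have r1' : \forall b \near base T2 X2 (base T1 X1 p), base T1 X1 (S1 (S2 b)) = S2 b := S2c _ r1.
by rewrite bE; apply: filterS (filterI r1' r2) => b [e1 e2]; rewrite base_comp /= e1.
Qed.

End At.

Lemma lift_g_comp (z : 'rV[R]_(2 + 3)) : nondegenerate_at T1 X1 U1 (lsubmx z) ->
  nondegenerate_at T2 X2 U2 (base T1 X1 (lsubmx z)) ->
  germ_eq z (lift_g T2 X2 U2 \o lift_g T1 X1 U1) (lift_g comp_T comp_X comp_U).
Proof.
move=> nd1 nd2; have c : {for lsubmx z, continuous (base T1 X1)} :=
  analytic_map_cont (nondegenerate_base nd1).
have nd2' : \forall q \near lsubmx z, nondegenerate_at T2 X2 U2 (base T1 X1 q) :=
  c _ (nondegenerate_near nd2).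
apply: filterS (near_lsubmx (filterI (nondegenerate_near nd1) nd2')) => y [h1 h2].
exact: (lift_g_comp_at h1 h2 (erefl (lsubmx y))).
Qed.

End Composition.

Lemma germ_eq_comp m n k (f f' : 'rV[R]_n -> 'rV[R]_k) (g g' : 'rV[R]_m -> 'rV[R]_n) a :
  analytic_map_at g' a -> germ_eq a g g' -> germ_eq (g' a) f f' -> germ_eq a (f \o g) (f' \o g').
Proof.
move=> ga eg ef; have c : {for a, continuous g'} := analytic_map_cont ga.
have ef' : \forall b \near a, f (g' b) = f' (g' b) := c _ ef.
by apply: filterS (filterI eg ef') => b [e1 e2]; rewrite /= e1.
Qed.

End Germs.

(** * The isomorphism *)

Section Kappa.
Variable R : realType.

Definition lift_data := ((R -> R) * ('rV[R]_2 -> R) * ('rV[R]_2 -> R))%type.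

Definition is_lift (z : 'rV[R]_(2 + 1)) Phi (d : lift_data) :=
  nondegenerate_at d.1.1 d.1.2 d.2 (lsubmx z) /\ germ_eq z Phi (lift_u d.1.1 d.1.2 d.2).

(** A triple is chosen for each germ of lift form; outside such germs the value [id] is
    arbitrary. *)
Definition kappa z Phi : 'rV[R]_(2 + 3) -> 'rV[R]_(2 + 3) :=
  if pselect (exists d, is_lift z Phi d) is left h then
    let d := projT1 (cid h) in lift_g d.1.1 d.1.2 d.2 else id.

(** The choice is immaterial: two triples with the same [lift_u] have the same germ, and [lift_g]
    depends only on that germ. *)
Lemma kappaP z (z1 : 'rV[R]_(2 + 3)) Phi T X U : same_base z z1 ->
  nondegenerate_at T X U (lsubmx z) -> germ_eq z Phi (lift_u T X U) ->
  germ_eq z1 (kappa z Phi) (lift_g T X U).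
Proof.
move=> zz1 nd e; rewrite /kappa; case: pselect => [h|[]]; last by exists (T, X, U).
case: cid => -[[T' X'] U'] [/= nd' e']; rewrite zz1 in nd nd'.
apply/(lift_g_germ _ _ _ nd'); rewrite -zz1; apply/lift_u_germ.
by apply: filterS (filterI e e') => y [<- <-].
Qed.

End Kappa.

Section Iso.
Variable R : realType.

Lemma lift_u_base T X U (y : 'rV[R]_(2 + 1)) : lsubmx (lift_u T X U y) = base T X (lsubmx y).
Proof. by rewrite /lift_u row_mxKl. Qed.

Lemma lift_g_base T X U (y : 'rV[R]_(2 + 3)) : lsubmx (lift_g T X U y) = base T X (lsubmx y).
Proof. by rewrite /lift_g row_mxKl. Qed.

Lemma kappa_germ z (z1 : 'rV[R]_(2 + 3)) Phi Psi T X U T' X' U' : same_base z z1 ->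
  nondegenerate_at T X U (lsubmx z) -> germ_eq z Phi (lift_u T X U) ->
  nondegenerate_at T' X' U' (lsubmx z) -> germ_eq z Psi (lift_u T' X' U') ->
  germ_eq z Phi Psi <-> germ_eq z1 (kappa z Phi) (kappa z Psi).
Proof.
move=> zz1 nd e nd' e'; have k := kappaP zz1 nd e; have k' := kappaP zz1 nd' e'.
have nd1 := nd; rewrite zz1 in nd1.
have [g1 g2] := lift_u_germ z T X U T' X' U'.
have [h1 h2] := lift_g_germ T' X' U' nd1; rewrite -zz1 in h1 h2.
split=> h.
  have : germ_eq z1 (lift_g T X U) (lift_g T' X' U').
    by apply/h2/g1; apply: filterS (filterI h (filterI e e')) => y [a [<- <-]].
  by move=> h'; apply: filterS (filterI h' (filterI k k')) => y [a [-> ->]].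
have : germ_eq z (lift_u T X U) (lift_u T' X' U').
  by apply/g2/h1; apply: filterS (filterI h (filterI k k')) => y [a [<- <-]].
by move=> h'; apply: filterS (filterI h' (filterI e e')) => y [a [-> ->]].
Qed.

(** Membership and surjectivity hold because the same condition [canonical_at] on the triple
    characterizes both kinds of lifts. Compatibility with products holds because [lift_u] and
    [lift_g] turn composition into the same operation on triples. *)
Lemma kappa_iso :
  pseudogroup_iso (equivalence (@parabolic R)) (equivalence (@DE1 R)) (@kappa R).
Proof.
split.
- move=> z z1 Phi zz1 /parabolic_canonical[T [X [U [c e]]]].
  have k := kappaP zz1 c.1 e; rewrite zz1 in c; exact: canonical_DE1 c k.
- move=> z z1 Phi zz1 /parabolic_canonical[T [X [U [c e]]]].
  have k := kappaP zz1 c.1 e.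
  (* Where both maps coincide with their lifts, both act on (t, x) as [base T X]. *)
  exists ([set y | Phi y = lift_u T X U y], [set y | kappa z Phi y = lift_g T X U y]).
    by split; [exact: e | exact: k].
  move=> [y y1] [/= ey ey1] yy1.
  by rewrite /same_base ey ey1 lift_u_base lift_g_base yy1.
- move=> z z1 Phi Psi zz1 /parabolic_canonical[T [X [U [c e]]]].
  move=> /parabolic_canonical[T' [X' [U' [c' e']]]].
  exact: kappa_germ zz1 c.1 e c'.1 e'.
- move=> z z1 Phi1 zz1 /DE1_canonical[T [X [U [c e]]]]; rewrite -zz1 in c.
  have eu : germ_eq z (lift_u T X U) (lift_u T X U) by near=> y.
  exists (lift_u T X U); first exact: canonical_parabolic c eu.
  by apply: filterS (filterI (kappaP zz1 c.1 eu) e) => y [-> ->].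
- move=> z z1 Phi Psi zz1 /parabolic_canonical[T1 [X1 [U1 [c1 e1]]]].
  move=> /parabolic_canonical[T2 [X2 [U2 [c2 e2]]]].
  have Pz : Phi z = lift_u T1 X1 U1 z := nbhs_singleton e1.
  rewrite Pz in e2; have bz := lift_u_base T1 X1 U1 z; rewrite -Pz in bz.
  rewrite bz in c2; have cc := canonical_comp c1.1 c2.1 c1.2 c2.2.
  have ua : analytic_map_at (lift_u T1 X1 U1) z.
    have := aff_map_analytic (lift_u_analytic c1.1).
    by apply: analytic_map_eq; near=> y; rewrite lift_u_aff.
  have ec : germ_eq z (Psi \o Phi)
      (lift_u (comp_T T1 T2) (comp_X T1 X1 X2) (comp_U T1 X1 U1 U2)).
    have := germ_eq_comp ua e1 e2.
    by apply: filterS => y ->; exact: lift_u_comp.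
  split; first exact: canonical_parabolic cc ec.
  have k1 := kappaP zz1 c1.1 e1; have kc := kappaP zz1 cc.1 ec.
  have zz2 : same_base (Phi z) (lift_g T1 X1 U1 z1) by rewrite /same_base bz lift_g_base zz1.
  have nd2 := c2.1; rewrite -bz in nd2; rewrite -Pz in e2.
  have k2 := kappaP zz2 nd2 e2.
  have nd1 := c1.1; rewrite zz1 in nd1.
  have ga : analytic_map_at (lift_g T1 X1 U1) z1.
    have := aff_map_analytic (lift_g_analytic nd1).
    by apply: analytic_map_eq; near=> y; rewrite lift_g_aff.
  have k12 := germ_eq_comp ga k1 k2.
  rewrite bz zz1 in nd2; have kk := lift_g_comp nd1 nd2.
  by apply: filterS (filterI kc (filterI k12 kk)) => y [-> [-> ->]].
Unshelve. all: by end_near. Qed.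

End Iso.

Theorem corollary8 (R : realType) :
  exists kappa : 'rV[R]_(2 + 1) -> ('rV[R]_(2 + 1) -> 'rV[R]_(2 + 1)) ->
                 ('rV[R]_(2 + 3) -> 'rV[R]_(2 + 3)),
  [/\ pseudogroup_iso (equivalence (@parabolic R)) (equivalence (@DE1 R)) kappa,
      (forall (Phi : 'rV[R]_(2 + 1) -> 'rV[R]_(2 + 1)) (z : 'rV[R]_(2 + 1)),
         point_transformation Phi z ->
         (equivalence (@parabolic R) Phi z <->
          exists (T : R -> R) (X U : 'rV[R]_2 -> R),
            nondegenerate_at T X U (lsubmx z) /\ germ_eq z Phi (lift_u T X U)))
    & forall (Phi : 'rV[R]_(2 + 1) -> 'rV[R]_(2 + 1))
             (z : 'rV[R]_(2 + 1)) (z1 : 'rV[R]_(2 + 3))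
             (T : R -> R) (X U : 'rV[R]_2 -> R),
        same_base z z1 ->
        equivalence (@parabolic R) Phi z ->
        nondegenerate_at T X U (lsubmx z) ->
        germ_eq z Phi (lift_u T X U) ->
        germ_eq z1 (kappa z Phi) (lift_g T X U) /\
        (forall th th' : coefs R,
           admissible th (lsubmx z) -> admissible th' (lsubmx (Phi z)) ->
           (maps_system (@parabolic R) Phi z th th' <->
            coefs_transformed T X U (lsubmx z) th th') /\
           (maps_system (@DE1 R) (kappa z Phi) z1 th th' <->
            coefs_transformed T X U (lsubmx z) th th'))].
Proof.
exists (@kappa R); split; first exact: kappa_iso.
- move=> Phi z Pt; split; first exact: parabolic_class.
  move=> [T [X [U [nd e]]]].
  (* The local inverse of the base map required by [canonical_at] is extracted from the inverse
     supplied by [point_transformation]. *)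
  have c : canonical_at T X U (lsubmx z) by split; [exact: nd | exact/(lift_u_iso nd e)].
  exact: canonical_parabolic c e.
move=> Phi z z1 T X U zz1 _ nd e; have k := kappaP zz1 nd e; split; first exact: k.
move=> th th' tha; rewrite (nbhs_singleton e) lift_u_base => tha'.
split; first exact: parabolic_maps e nd tha.
by rewrite zz1 in nd tha tha' *; exact: DE1_maps k nd tha tha'.
Qed.
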